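(* Let $\mathcal T$, $\mathcal T'$ be triple sequences (admissible for the types with which they are used below), with sequences of sums $\mathcal S,\mathcal S'$ and density indices $\delta,\delta'$. Consider the conditions: $(\mathcal A_1)$ $\mathcal T$ and $\mathcal T'$ have the same density type; $(\mathcal A_2)$ $\Pi(\mathcal S)\stackrel{\mathbb Q}{\sim}\Pi(\mathcal S')$; $(\mathcal A_3)$ if the triple sequences are dense or pure (types (D2) and (D3)), then $\frac{\delta}{\delta'}\in\frac{\Pi(\mathcal S)}{\Pi(\mathcal S')}$. Isomorphisms below are isomorphisms of algebras with involution. (i) Let $\mathrm{char}\,\mathbb F\ne2$. Then $A(\mathcal T,\mathbf A)\cong A(\mathcal T',\mathbf O)$ (resp., $A(\mathcal T,\mathbf A)\cong A(\mathcal T',\mathbf S)$) if and only if $\mathcal T$ is two-sided symmetric, $2^\infty$ divides $\Pi(\mathcal S')$, and the conditions $(\mathcal A_1),(\mathcal A_2),(\mathcal A_3)$ hold. (ii) Let $\mathrm{char}\,\mathbb F\ne2$. Then $A(\mathcal T,\mathbf O)\cong A(\mathcal T',\mathbf S)$ if and only if $2^\infty$ divides both $\Pi(\mathcal S)$ and $\Pi(\mathcal S')$, and the conditions $(\mathcal A_1),(\mathcal A_2),(\mathcal A_3)$ hold. (iii) Let $\mathrm{char}\,\mathbb F=2$. If $X,X'\in\{\mathbf A,\mathbf O,\mathbf S\}$ are different, then $A(\mathcal T,X)$ is not isomorphic to $A(\mathcal T',X')$.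
   Context: **Ground field and involutions.** $\mathbb F$ is an algebraically closed field. Algebras are associative over $\mathbb F$, not necessarily unital. An involution is an $\mathbb F$-linear map $*$ with $(a^* )^*=a$, $(ab)^*=b^*a^*$. **Canonical involutions.** Type $\mathbf O$: $M_n(\mathbb F)$ with $X\mapsto X^t$. Type $\mathbf S$: $M_n(\mathbb F)$, $n$ even, with $X\mapsto X^\tau=-JX^tJ$, where $J$ is block diagonal with $n/2$ blocks $\left(\begin{array}{cc}0&1\\-1&0\end{array}\right)$. Type $\mathbf A$: $M_n(\mathbb F)\oplus M_n(\mathbb F)$ with $(X_1,X_2)\mapsto(X_2^t,X_1^t)$. The number $n$ is the degree. The algebra $\mathbb F$ (degree 1, identity involution) is regarded as being of both types $\mathbf O$ and $\mathbf S$. **Canonical embeddings.** For types $\mathbf O,\mathbf S$, the canonical embedding of signature $(l,0,z)$ is $M\mapsto\mathrm{diag}(M,\dots,M,0,\dots,0)$ ($l$ copies of $M$, $z$ zeros). For type $\mathbf A$, the canonical embedding of signature $(l,r,z)$ is $(M,N)\mapsto(\mathrm{diag}(M,\dots,M,N,\dots,N,0,\dots,0),\ \mathrm{diag}(N,\dots,N,M,\dots,M,0,\dots,0))$, where the first component has $l$ copies of $M$, $r$ copies of $N$ and $z$ zeros, and the second has $l$ copies of $N$, $r$ copies of $M$ and $z$ zeros. **Triple sequences.** A triple sequence $\mathcal T=((l_i,r_i,z_i))_{i\in\mathbb N}$ consists of non-negative integers with $l_i\ge r_i$, $l_i+r_i\ge1$, $r_1=z_1=0$. Put $n_1=1$,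 $n_{i+1}=(l_i+r_i)n_i+z_i$ (so $l_1=n_2$); $(n_i)$ is unbounded. $\mathcal T$ is admissible for $X=\mathbf O$ if all $r_i=0$; for $X=\mathbf S$ if all $r_i=0$ and $n_i$ is even for $i\ge2$; for $X=\mathbf A$ there is no extra condition. $A(\mathcal T,X)$ is the direct limit (an algebra with involution) of $A_1\to A_2\to\cdots$, where $A_i$ is the algebra of type $X$ and degree $n_i$ with its canonical involution and $A_i\to A_{i+1}$ is the canonical embedding of signature $(l_i,r_i,z_i)$. **Invariants.** $s_i=l_i+r_i$, $\mathcal S=(s_i)_{i\in\mathbb N}$; $\delta_i=s_1\cdots s_{i-1}/n_i$ and $\delta=\delta(\mathcal T)=\lim\delta_i$ is the density index. Density types: (D1) sparse: $\delta=0$; (D2) dense: $\delta_i>\delta>0$ for all $i$; (D3) pure: $\delta_i=\delta>0$ for some $i$. $\mathcal T$ is two-sided symmetric if $l_j=r_j$ for infinitely many $j$. Primed quantities are defined in the same way from $\mathcal T'$. **Supernatural numbers.** A supernatural number is a formal product $\prod_p p^{\alpha_p}$ over all primes with $\alpha_p\in\{0,1,2,\dots\}\cup\{\infty\}$, multiplied by adding exponents; $\prod p^{\alpha_p}$ divides $\prod p^{\alpha_p'}$ iff $\alpha_p\le\alpha_p'$ for all $p$; positive integers are identified with supernatural numbers. For a sequence of positive integers $\mathcal S=(s_1,s_2,\dots)$, $\Pi(\mathcal S)=s_1s_2s_3\cdots$. For $q\in\mathbb Q$, write $\Pi=q\Pi'$, equivalently $q\in\frac{\Pi}{\Pi'}$,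 if there is $n\in\mathbb N$ (positive integer) with $nq\in\mathbb N$ and $n\Pi=(nq)\Pi'$. (For a real number $q$, $q\in\frac{\Pi}{\Pi'}$ includes the assertion that $q$ is rational.) $\Pi\stackrel{\mathbb Q}{\sim}\Pi'$ means that $\Pi=q\Pi'$ for some nonzero $q\in\mathbb Q$. *)

(* Defs.v *)
From HB Require Import structures.
From mathcomp Require Import all_boot all_order all_algebra.
From mathcomp Require Import all_classical all_reals all_analysis.
From mathcomp Require Import zify.

Set Implicit Arguments.
Unset Strict Implicit.
Unset Printing Implicit Defensive.

Import Order.TTheory GRing.Theory Num.Theory numFieldNormedType.Exports.
Local Open Scope ring_scope.

(** * Algebras with involution *)

(* The algebras are not assumed unital, hence they are not MathComp algTypes. *)
Record invAlg (F : fieldType) := InvAlg {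
  invAlg_sort :> lmodType F;
  imul : invAlg_sort -> invAlg_sort -> invAlg_sort;
  star : invAlg_sort -> invAlg_sort;
  imulA : associative imul;
  imul_linearl : forall y, linear (imul^~ y);
  imul_linearr : forall x, linear (imul x);
  star_linear : linear star;
  starK : involutive star;
  starM : forall x y, star (imul x y) = imul (star y) (star x)
}.

Definition inv_morph (F : fieldType) (A B : invAlg F) (f : A -> B) : Prop :=
  [/\ linear f,
      forall x y, f (imul x y) = imul (f x) (f y)
    & forall x, f (star x) = star (f x)].

Definition inv_iso (F : fieldType) (A B : invAlg F) : Prop :=
  exists f : A -> B, inv_morph f /\ bijective f.

(** * Direct limits of sequences of algebras with involution *)

Record dirSys (F : fieldType) := DirSys {
  ds_obj : nat -> invAlg F;
  ds_map : forall i, ds_obj i -> ds_obj i.+1;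
  ds_mapP : forall i, inv_morph (ds_map (i := i))
}.

Section DirectLimit.
Context (F : fieldType) (D : dirSys F).
Local Notation A := (ds_obj D).

(* The transition map A i -> A j, with the junk value 0 if j < i. *)
Fixpoint trans (i j : nat) : A i -> A j :=
  match i =P j with
  | ReflectT e => fun x => ecast k (A k) e x
  | ReflectF _ =>
    match j return A i -> A j with
    | 0 => fun=> 0
    | j'.+1 => fun x => ds_map (@trans i j' x)
    end
  end.

Arguments trans : clear implicits.

Definition germ := {i : nat & A i}.

Definition germ_eq (u v : germ) : bool :=
  `[< exists k, [/\ tag u <= k, tag v <= k
      & trans (tag u) k (tagged u) = trans (tag v) k (tagged v)]%N >].

Lemma trans_id i x : trans i i x = x.
Proof.
by case: i x => [|i] x /=; case: eqP => // e; rewrite eq_axiomK.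
Qed.

Lemma transS i j x : (i <= j)%N -> trans i j.+1 x = ds_map (trans i j x).
Proof.
by move=> ij /=; case: eqP => // e; exfalso; move: ij; rewrite e ltnn.
Qed.

Lemma trans_linear i j : (i <= j)%N -> linear (trans i j).
Proof.
move=> /subnK <-; elim: (j - i)%N => [|k IH] a x y; first by rewrite !trans_id.
rewrite addSn !transS ?leq_addl// IH.
by have [-> _ _] := ds_mapP D (k + i).
Qed.

Lemma transM i j x y : (i <= j)%N ->
  trans i j (imul x y) = imul (trans i j x) (trans i j y).
Proof.
move=> /subnK <-; elim: (j - i)%N => [|k IH]; first by rewrite !trans_id.
rewrite addSn !transS ?leq_addl// IH.
by have [_ -> _] := ds_mapP D (k + i).
Qed.

Lemma trans_star i j x : (i <= j)%N ->
  trans i j (star x) = star (trans i j x).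
Proof.
move=> /subnK <-; elim: (j - i)%N => [|k IH]; first by rewrite !trans_id.
rewrite addSn !transS ?leq_addl// IH.
by have [_ _ ->] := ds_mapP D (k + i).
Qed.

Lemma trans_comp i j k x : (i <= j)%N -> (j <= k)%N ->
  trans j k (trans i j x) = trans i k x.
Proof.
move=> ij /subnK <-; elim: (k - j)%N => [|m IH]; first by rewrite trans_id.
by rewrite addSn !transS ?leq_addl// ?IH// (leq_trans ij)// leq_addl.
Qed.

Lemma germ_eqP (u v : germ) :
  reflect (exists k, forall j, (k <= j)%N ->
             trans (tag u) j (tagged u) = trans (tag v) j (tagged v))
          (germ_eq u v).
Proof.
apply: (iffP (asboolP _)) => [[k [uk vk e]]|[k H]].
  by exists k => j kj; rewrite -(trans_comp _ uk kj) e trans_comp.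
exists (maxn (maxn (tag u) (tag v)) k).
by rewrite !leq_max !leqnn /= orbT; split=> //; apply: H; rewrite leq_maxr.
Qed.

Lemma germ_eq_refl : reflexive germ_eq.
Proof. by move=> u; apply/germ_eqP; exists 0%N. Qed.

Lemma germ_eq_sym : symmetric germ_eq.
Proof.
by move=> u v; apply/germ_eqP/germ_eqP => -[k H]; exists k => j /H ->.
Qed.

Lemma germ_eq_trans : transitive germ_eq.
Proof.
move=> v u w /germ_eqP[k H] /germ_eqP[l H']; apply/germ_eqP.
by exists (maxn k l) => j; rewrite geq_max => /andP[/H -> /H' ->].
Qed.

Canonical germ_equiv :=
  EquivRel germ_eq germ_eq_refl germ_eq_sym germ_eq_trans.

Definition dlim := {eq_quot germ_eq}%qT.
HB.instance Definition _ := Choice.on dlim.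

Definition dlim_in i (x : A i) : dlim := (\pi_({eq_quot germ_eq}) (Tagged A x))%qT.

Definition germ_bin (op : forall k, A k -> A k -> A k) (u v : germ) : germ :=
  let k := maxn (tag u) (tag v) in
  Tagged A (op k (trans (tag u) k (tagged u)) (trans (tag v) k (tagged v))).

Definition germ_un (op : forall k, A k -> A k) (u : germ) : germ :=
  Tagged A (op (tag u) (tagged u)).

Definition dlim_bin op (x y : dlim) : dlim :=
  let z := germ_bin op (repr x) (repr y) in dlim_in (tagged z).
Definition dlim_un op (x : dlim) : dlim :=
  let z := germ_un op (repr x) in dlim_in (tagged z).

Definition dlim0 : dlim := dlim_in (0 : A 0).
Definition dlim_add := dlim_bin (fun k (x y : A k) => x + y).
Definition dlim_opp := dlim_un (fun k (x : A k) => - x).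
Definition dlim_scale (a : F) := dlim_un (fun k (x : A k) => a *: x).
Definition dlim_mul := dlim_bin (fun k (x y : A k) => imul x y).
Definition dlim_star := dlim_un (fun k (x : A k) => star x).

Definition ev (x : dlim) (j : nat) : A j := trans (tag (repr x)) j (tagged (repr x)).

Lemma dlimP (x y : dlim) :
  (exists k, forall j, (k <= j)%N -> ev x j = ev y j) -> x = y.
Proof.
by move=> /germ_eqP H; rewrite -[x]reprK -[y]reprK; apply/eqmodP.
Qed.

Lemma evP (u : germ) : exists k, forall j, (k <= j)%N ->
  ev (dlim_in (tagged u)) j = trans (tag u) j (tagged u).
Proof.
apply/germ_eqP.
suff: repr (dlim_in (tagged u)) = u %[mod {eq_quot germ_eq}]%qT by move/eqmodP.
by rewrite reprK /dlim_in; case: u.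
Qed.

Lemma ev_bin op x y :
  (forall i j a b, (i <= j)%N ->
     trans i j (op i a b) = op j (trans i j a) (trans i j b)) ->
  exists k, forall j, (k <= j)%N -> ev (dlim_bin op x y) j = op j (ev x j) (ev y j).
Proof.
move=> opP; have [k H] := evP (germ_bin op (repr x) (repr y)).
exists (maxn k (maxn (tag (repr x)) (tag (repr y)))) => j.
rewrite geq_max => /andP[/H -> m]; rewrite /= opP//.
by rewrite !trans_comp ?leq_maxl ?leq_maxr.
Qed.

Lemma ev_un op x :
  (forall i j a, (i <= j)%N -> trans i j (op i a) = op j (trans i j a)) ->
  exists k, forall j, (k <= j)%N -> ev (dlim_un op x) j = op j (ev x j).
Proof.
move=> opP; have [k H] := evP (germ_un op (repr x)).
exists (maxn k (tag (repr x))) => j.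
by rewrite geq_max => /andP[/H -> m]; rewrite /= opP.
Qed.

Lemma trans0 i j : (i <= j)%N -> trans i j 0 = 0.
Proof.
move=> ij; have := trans_linear ij (-1) 0 0.
by rewrite !scaleN1r !addNr.
Qed.

Lemma transZ i j a x : (i <= j)%N -> trans i j (a *: x) = a *: trans i j x.
Proof. by move=> ij; have := trans_linear ij a x 0; rewrite trans0// !addr0. Qed.

Lemma ev0 : exists k, forall j, (k <= j)%N -> ev dlim0 j = 0.
Proof.
have [k H] := evP (Tagged A (0 : A 0)).
by exists k => j /H ->; rewrite trans0.
Qed.

Lemma evD x y : exists k, forall j, (k <= j)%N -> ev (dlim_add x y) j = ev x j + ev y j.
Proof.
apply: ev_bin => i j a b ij.
by have := trans_linear ij 1 a b; rewrite !scale1r.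
Qed.

Lemma evN x : exists k, forall j, (k <= j)%N -> ev (dlim_opp x) j = - ev x j.
Proof.
apply: (@ev_un (fun k (x : A k) => - x)) => i j a ij.
by rewrite -scaleN1r transZ// scaleN1r.
Qed.

Lemma evZ c x : exists k, forall j, (k <= j)%N -> ev (dlim_scale c x) j = c *: ev x j.
Proof.
by apply: (@ev_un (fun k (x : A k) => c *: x)) => i j a ij; rewrite transZ.
Qed.

Lemma evM x y : exists k, forall j, (k <= j)%N ->
  ev (dlim_mul x y) j = imul (ev x j) (ev y j).
Proof. by apply: ev_bin => i j a b ij; rewrite transM. Qed.

Lemma evS x : exists k, forall j, (k <= j)%N -> ev (dlim_star x) j = star (ev x j).
Proof.
by apply: (@ev_un (fun k (x : A k) => star x)) => i j a ij; rewrite trans_star.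
Qed.

Lemma dlim_addA : associative dlim_add.
Proof.
move=> x y z; apply: dlimP.
have [k1 H1] := evD x (dlim_add y z); have [k2 H2] := evD y z.
have [k3 H3] := evD (dlim_add x y) z; have [k4 H4] := evD x y.
exists (k1 + k2 + k3 + k4)%N => j kj.
by rewrite H1 ?H2 ?H3 ?H4 ?addrA//; apply: leq_trans kj; lia.
Qed.

Lemma dlim_addC : commutative dlim_add.
Proof.
move=> x y; apply: dlimP.
have [k1 H1] := evD x y; have [k2 H2] := evD y x.
exists (k1 + k2)%N => j kj.
by rewrite H1 ?H2 1?addrC//; apply: leq_trans kj; lia.
Qed.

Lemma dlim_add0 : left_id dlim0 dlim_add.
Proof.
move=> x; apply: dlimP.
have [k1 H1] := evD dlim0 x; have [k2 H2] := ev0.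
exists (k1 + k2)%N => j kj.
by rewrite H1 ?H2 ?add0r//; apply: leq_trans kj; lia.
Qed.

Lemma dlim_addN : left_inverse dlim0 dlim_opp dlim_add.
Proof.
move=> x; apply: dlimP.
have [k1 H1] := evD (dlim_opp x) x; have [k2 H2] := ev0; have [k3 H3] := evN x.
exists (k1 + k2 + k3)%N => j kj.
by rewrite H1 ?H2 ?H3 ?addNr//; apply: leq_trans kj; lia.
Qed.

HB.instance Definition _ :=
  GRing.isZmodule.Build dlim dlim_addA dlim_addC dlim_add0 dlim_addN.

Lemma dlim_scaleA a b x : dlim_scale a (dlim_scale b x) = dlim_scale (a * b) x.
Proof.
apply: dlimP.
have [k1 H1] := evZ a (dlim_scale b x); have [k2 H2] := evZ b x.
have [k3 H3] := evZ (a * b) x.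
exists (k1 + k2 + k3)%N => j kj.
by rewrite H1 ?H2 ?H3 ?scalerA//; apply: leq_trans kj; lia.
Qed.

Lemma dlim_scale1 : left_id 1 dlim_scale.
Proof.
move=> x; apply: dlimP; have [k H] := evZ 1 x.
by exists k => j kj; rewrite H ?scale1r.
Qed.

Lemma dlim_scaleDr : right_distributive dlim_scale +%R.
Proof.
move=> a x y; apply: dlimP.
have [k1 H1] := evZ a (x + y); have [k2 H2] := evD x y.
have [k3 H3] := evD (dlim_scale a x) (dlim_scale a y).
have [k4 H4] := evZ a x; have [k5 H5] := evZ a y.
exists (k1 + k2 + k3 + k4 + k5)%N => j kj.
by rewrite H1 ?H2 ?H3 ?H4 ?H5 ?scalerDr//; apply: leq_trans kj; lia.
Qed.

Lemma dlim_scaleDl x : {morph dlim_scale^~ x : a b / a + b}.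
Proof.
move=> a b; apply: dlimP.
have [k1 H1] := evZ (a + b) x.
have [k3 H3] := evD (dlim_scale a x) (dlim_scale b x).
have [k4 H4] := evZ a x; have [k5 H5] := evZ b x.
exists (k1 + k3 + k4 + k5)%N => j kj.
by rewrite H1 ?H3 ?H4 ?H5 ?scalerDl//; apply: leq_trans kj; lia.
Qed.

HB.instance Definition _ := GRing.Zmodule_isLmodule.Build F dlim
  dlim_scaleA dlim_scale1 dlim_scaleDr dlim_scaleDl.

Lemma ev_lin a x y : exists k, forall j, (k <= j)%N ->
  ev (a *: x + y) j = a *: ev x j + ev y j.
Proof.
have [k1 H1] := evD (a *: x) y; have [k2 H2] := evZ a x.
exists (k1 + k2)%N => j kj.
by rewrite H1 ?H2//; apply: leq_trans kj; lia.
Qed.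

Lemma dlim_mulA : associative dlim_mul.
Proof.
move=> x y z; apply: dlimP.
have [k1 H1] := evM x (dlim_mul y z); have [k2 H2] := evM y z.
have [k3 H3] := evM (dlim_mul x y) z; have [k4 H4] := evM x y.
exists (k1 + k2 + k3 + k4)%N => j kj.
by rewrite H1 ?H2 ?H3 ?H4 ?imulA//; apply: leq_trans kj; lia.
Qed.

Lemma dlim_mul_linearl y : linear (dlim_mul^~ y).
Proof.
move=> a x z; apply: dlimP.
have [k1 H1] := evM (a *: x + z) y; have [k2 H2] := ev_lin a x z.
have [k3 H3] := ev_lin a (dlim_mul x y) (dlim_mul z y).
have [k4 H4] := evM x y; have [k5 H5] := evM z y.
exists (k1 + k2 + k3 + k4 + k5)%N => j kj.
by rewrite H1 ?H2 ?H3 ?H4 ?H5 ?imul_linearl//; apply: leq_trans kj; lia.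
Qed.

Lemma dlim_mul_linearr y : linear (dlim_mul y).
Proof.
move=> a x z; apply: dlimP.
have [k1 H1] := evM y (a *: x + z); have [k2 H2] := ev_lin a x z.
have [k3 H3] := ev_lin a (dlim_mul y x) (dlim_mul y z).
have [k4 H4] := evM y x; have [k5 H5] := evM y z.
exists (k1 + k2 + k3 + k4 + k5)%N => j kj.
by rewrite H1 ?H2 ?H3 ?H4 ?H5 ?imul_linearr//; apply: leq_trans kj; lia.
Qed.

Lemma dlim_star_linear : linear dlim_star.
Proof.
move=> a x z; apply: dlimP.
have [k1 H1] := evS (a *: x + z); have [k2 H2] := ev_lin a x z.
have [k3 H3] := ev_lin a (dlim_star x) (dlim_star z).
have [k4 H4] := evS x; have [k5 H5] := evS z.
exists (k1 + k2 + k3 + k4 + k5)%N => j kj.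
by rewrite H1 ?H2 ?H3 ?H4 ?H5 ?star_linear//; apply: leq_trans kj; lia.
Qed.

Lemma dlim_starK : involutive dlim_star.
Proof.
move=> x; apply: dlimP.
have [k1 H1] := evS (dlim_star x); have [k2 H2] := evS x.
exists (k1 + k2)%N => j kj.
by rewrite H1 ?H2 ?starK//; apply: leq_trans kj; lia.
Qed.

Lemma dlim_starM x y :
  dlim_star (dlim_mul x y) = dlim_mul (dlim_star y) (dlim_star x).
Proof.
apply: dlimP.
have [k1 H1] := evS (dlim_mul x y); have [k2 H2] := evM x y.
have [k3 H3] := evM (dlim_star y) (dlim_star x).
have [k4 H4] := evS x; have [k5 H5] := evS y.
exists (k1 + k2 + k3 + k4 + k5)%N => j kj.
by rewrite H1 ?H2 ?H3 ?H4 ?H5 ?starM//; apply: leq_trans kj; lia.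
Qed.

Definition dirLim : invAlg F :=
  @InvAlg F dlim dlim_mul dlim_star dlim_mulA dlim_mul_linearl
    dlim_mul_linearr dlim_star_linear dlim_starK dlim_starM.

End DirectLimit.

(** * Canonical involutions *)

Section Canonical.
Context (F : fieldType).

Definition Jmx n : 'M[F]_n :=
  \matrix_(i, j) (if ~~ odd i && (j == i.+1 :> nat) then 1
                  else if odd i && (i == j.+1 :> nat) then -1 else 0).

(* The matrices of odd degree that occur in type S have degree 1, where the
   transpose is the identity involution. *)
Definition tau n (X : 'M[F]_n) : 'M[F]_n :=
  if odd n then X^T else - (Jmx n *m X^T *m Jmx n).

Lemma Jmx_tr n : (Jmx n)^T = - Jmx n.
Proof.
apply/matrixP => i j; rewrite !mxE.
case: (boolP (odd i)) => oi; case: (boolP (odd j)) => oj;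
  case: (eqVneq (i : nat) j.+1) => ij; case: (eqVneq (j : nat) i.+1) => ji /=;
  by [rewrite ?opprK ?oppr0 | exfalso; lia].
Qed.

Lemma Jmx_sqr n : ~~ odd n -> Jmx n *m Jmx n = - 1%:M.
Proof.
move=> n_even; apply/matrixP => i k; rewrite !mxE.
have kn : ((if odd i then i.-1 else i.+1) < n)%N.
  by move: (ltn_ord i); case: (boolP (odd i)) => oi; lia.
rewrite (bigD1 (Ordinal kn)) //= big1 ?addr0; last first.
  move=> j jk; rewrite !mxE.
  have {jk} : (j : nat) <> if odd i then i.-1 else i.+1.
    by move=> e; move/eqP: jk; apply; apply: val_inj.
  case: (boolP (odd i)) => oi /= ne; last first.
    by case: eqP => [?|_]; [lia|rewrite mul0r].
  by case: eqP => [?|_]; [lia|rewrite mul0r].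
rewrite !mxE /= -[i == k]val_eqE /=.
case: (boolP (odd i)) => oi /=.
  have oi1 : odd i.-1 = false by lia.
  have -> : (i == i.-1.+1 :> nat) by apply/eqP; lia.
  rewrite oi1 /= mulN1r.
  have -> : (k == i.-1.+1 :> nat) = (i == k :> nat) by lia.
  by case: eqP.
by rewrite eqxx oi /= eqSS mul1r; case: eqP => _; rewrite ?mulr1n ?mulr0n ?oppr0.
Qed.

Lemma tau_linear n : linear (@tau n).
Proof.
move=> a x y; rewrite /tau; case: ifP => _; first by rewrite linearP.
by rewrite linearP /= mulmxDr mulmxDl -scalemxAr -scalemxAl opprD scalerN.
Qed.

Lemma tauK n : involutive (@tau n).
Proof.
move=> x; rewrite /tau; case: (boolP (odd n)) => n_odd; first by rewrite trmxK.
rewrite linearN /= !trmx_mul trmxK Jmx_tr.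
rewrite !(mulNmx, mulmxN) !opprK !mulmxA Jmx_sqr// -mulmxA Jmx_sqr//.
by rewrite mulNmx mul1mx mulmxN mulmx1 opprK.
Qed.

Lemma tauM n (x y : 'M[F]_n) : tau (x *m y) = tau y *m tau x.
Proof.
rewrite /tau; case: ifPn => n_odd; first by rewrite trmx_mul.
rewrite trmx_mul mulNmx mulmxN opprK !mulmxA.
rewrite -[_ *m Jmx n *m Jmx n]mulmxA Jmx_sqr//.
by rewrite mulmxN mulmx1 !mulNmx.
Qed.

Lemma mulmx_linearl n (y : 'M[F]_n) : linear (fun x : 'M[F]_n => x *m y).
Proof. by move=> a x z; rewrite mulmxDl scalemxAl. Qed.

Lemma mulmx_linearr n (x : 'M[F]_n) : linear (fun y : 'M[F]_n => x *m y).
Proof. by move=> a y z; rewrite mulmxDr scalemxAr. Qed.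

Lemma trmx_linear n : linear (fun x : 'M[F]_n => x^T).
Proof. exact: linearP. Qed.

Definition algO (n : nat) : invAlg F :=
  @InvAlg F 'M[F]_n (fun X Y => X *m Y) (fun X => X^T)
    (@mulmxA F n n n n) (@mulmx_linearl n) (@mulmx_linearr n)
    (@trmx_linear n) (@trmxK F n n) (@trmx_mul F n n n).

Definition algS (n : nat) : invAlg F :=
  @InvAlg F 'M[F]_n (fun X Y => X *m Y) (@tau n)
    (@mulmxA F n n n n) (@mulmx_linearl n) (@mulmx_linearr n)
    (@tau_linear n) (@tauK n) (@tauM n).

Section TypeA.
Context (n : nat).
Let V : lmodType F := ('M[F]_n * 'M[F]_n)%type.

Definition pair_mul (X Y : V) : V := (X.1 *m Y.1, X.2 *m Y.2).
Definition pair_star (X : V) : V := (X.2^T, X.1^T).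

Lemma pair_mulA : associative pair_mul.
Proof. by move=> x y z; congr pair; rewrite mulmxA. Qed.

Lemma pair_mul_linearl y : linear (pair_mul^~ y).
Proof. by move=> a x z; congr pair; rewrite /= mulmxDl scalemxAl. Qed.

Lemma pair_mul_linearr x : linear (pair_mul x).
Proof. by move=> a y z; congr pair; rewrite /= mulmxDr scalemxAr. Qed.

Lemma pair_star_linear : linear pair_star.
Proof. by move=> a x z; congr pair; rewrite /= linearP. Qed.

Lemma pair_starK : involutive pair_star.
Proof. by case=> x y; rewrite /pair_star /= !trmxK. Qed.

Lemma pair_starM x y :
  pair_star (pair_mul x y) = pair_mul (pair_star y) (pair_star x).
Proof. by rewrite /pair_star /pair_mul /= !trmx_mul. Qed.

Definition algA : invAlg F :=
  @InvAlg F V pair_mul pair_star pair_mulA pair_mul_linearl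
    pair_mul_linearr pair_star_linear pair_starK pair_starM.

End TypeA.

End Canonical.

Inductive invType := typeA | typeO | typeS.

Definition canonAlg (F : fieldType) (X : invType) (n : nat) : invAlg F :=
  match X with
  | typeA => algA F n
  | typeO => algO F n
  | typeS => algS F n
  end.

(** * Canonical embeddings *)

Section Embeddings.
Context (F : fieldType) (n : nat).

Fixpoint diagrep (l : nat) (M : 'M[F]_n) : 'M[F]_(l * n) :=
  match l return 'M[F]_(l * n) with
  | 0 => 0
  | l'.+1 => block_mx M 0 0 (diagrep l' M)
  end.

Definition diagemb (l r z : nat) (M N : 'M[F]_n) : 'M[F]_(l * n + r * n + z) :=
  block_mx (block_mx (diagrep l M) 0 0 (diagrep r N)) 0 0 0.

End Embeddings.

(* For types O and S the signature is (l, 0, z); r is kept as an argument so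
   that the three types have the same degrees. *)
Definition canonEmb (F : fieldType) (X : invType) (n l r z : nat) :
    canonAlg F X n -> canonAlg F X (l * n + r * n + z) :=
  match X return canonAlg F X n -> canonAlg F X (l * n + r * n + z) with
  | typeA => fun P => (diagemb l r z P.1 P.2, diagemb l r z P.2 P.1)
  | typeO => fun M => diagemb l r z M M
  | typeS => fun M => diagemb l r z M M
  end.

(** * Triple sequences *)

(* All sequences are indexed from 0: the entry of index i is the one that is
   written with the index i + 1 in the usual notation. *)
Fixpoint degree_of (l r z : nat -> nat) (i : nat) : nat :=
  match i with
  | 0 => 1%N
  | j.+1 => (l j * degree_of l r z j + r j * degree_of l r z j + z j)%N
  end.

Record tripleSeq := TripleSeq {
  tl : nat -> nat;
  tr : nat -> nat;
  tz : nat -> nat;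
  tr_le_tl : forall i, (tr i <= tl i)%N;
  tlr_gt0 : forall i, (1 <= tl i + tr i)%N;
  tr0 : tr 0 = 0%N;
  tz0 : tz 0 = 0%N;
  t_unbounded : forall N, exists i, (N <= degree_of tl tr tz i)%N
}.

Definition degree (T : tripleSeq) : nat -> nat := degree_of (tl T) (tr T) (tz T).

Definition tsum (T : tripleSeq) (i : nat) : nat := (tl T i + tr T i)%N.

Lemma degreeS T i : degree T i.+1 = (tsum T i * degree T i + tz T i)%N.
Proof. by rewrite /tsum mulnDl. Qed.

Definition admissible (T : tripleSeq) (X : invType) : Prop :=
  match X with
  | typeA => True
  | typeO => forall i, tr T i = 0%N
  | typeS => (forall i, tr T i = 0%N) /\ (forall i, ~~ odd (degree T i.+1))
  end.

(** * The algebras A(T, X) *)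

Section EmbeddingLemmas.
Context (F : fieldType).

Lemma diagrep_linear n l : linear (@diagrep F n l).
Proof.
move=> a x y; elim: l => [|l IH] /=; first by rewrite scaler0 addr0.
by rewrite IH scale_block_mx add_block_mx !scaler0 !addr0.
Qed.

Lemma diagrepM n l (x y : 'M[F]_n) :
  diagrep l (x *m y) = diagrep l x *m diagrep l y.
Proof.
elim: l => [|l IH] /=; first by rewrite mul0mx.
by rewrite IH mulmx_block !(mulmx0, mul0mx, addr0, add0r).
Qed.

Lemma diagrep_tr n l (x : 'M[F]_n) : diagrep l x^T = (diagrep l x)^T.
Proof.
elim: l => [|l IH] /=; first by rewrite trmx0.
by rewrite IH tr_block_mx !trmx0.
Qed.

Lemma diagemb_linear n l r z a (x y u v : 'M[F]_n) :
  diagemb l r z (a *: x + y) (a *: u + v) =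
  a *: diagemb l r z x u + diagemb l r z y v.
Proof.
by rewrite /diagemb !diagrep_linear !scale_block_mx !add_block_mx !scaler0 !addr0.
Qed.

Lemma diagembM n l r z (x y u v : 'M[F]_n) :
  diagemb l r z (x *m y) (u *m v) = diagemb l r z x u *m diagemb l r z y v.
Proof.
by rewrite /diagemb !diagrepM !mulmx_block !(mulmx0, mul0mx, addr0, add0r).
Qed.

Lemma diagemb_tr n l r z (x u : 'M[F]_n) :
  diagemb l r z x^T u^T = (diagemb l r z x u)^T.
Proof. by rewrite /diagemb !diagrep_tr !tr_block_mx !trmx0. Qed.

Lemma Jmx_block m k : ~~ odd m ->
  Jmx F (m + k) = block_mx (Jmx F m) 0 0 (Jmx F k).
Proof.
move=> me; apply/matrixP => i j.
rewrite -(fintype.splitK i) -(fintype.splitK j).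
case: (fintype.split i) => i'; case: (fintype.split j) => j' /=;
  rewrite ?block_mxEul ?block_mxEur ?block_mxEdl ?block_mxEdr !mxE //=.
- rewrite (_ : (_ && (m + j' == i'.+1)) = false); last by move: (ltn_ord i'); lia.
  by rewrite (_ : (_ && (i' == _.+1 :> nat)) = false)//; move: (ltn_ord i'); lia.
- rewrite (_ : (_ && (j' == (m + i').+1 :> nat)) = false); last by move: (ltn_ord j'); lia.
  by rewrite (_ : (_ && _) = false)//; move: (ltn_ord j'); lia.
- by rewrite oddD (negbTE me) /= -!addnS !eqn_add2l.
Qed.

Lemma tau_block m k (x : 'M[F]_m) (y : 'M[F]_k) : ~~ odd m -> ~~ odd k ->
  tau (block_mx x 0 0 y) = block_mx (tau x) 0 0 (tau y).
Proof.
move=> me ke; rewrite /tau oddD (negbTE me) (negbTE ke) /=.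
rewrite Jmx_block// tr_block_mx !trmx0 !mulmx_block.
by rewrite !(mulmx0, mul0mx, addr0, add0r) opp_block_mx !oppr0.
Qed.

Lemma tau0 m : tau (0 : 'M[F]_m) = 0.
Proof. by rewrite /tau trmx0 mulmx0 mul0mx oppr0 if_same. Qed.

Lemma tau_diagrep n l (x : 'M[F]_n) : ~~ odd n ->
  diagrep l (tau x) = tau (diagrep l x).
Proof.
move=> ne; elim: l => [|l IH] /=; first by rewrite tau0.
rewrite IH; symmetry; apply: (@tau_block n (l * n)) => //.
by rewrite oddM negb_and ne orbT.
Qed.

Lemma tau_diagemb n l r z (x u : 'M[F]_n) : ~~ odd n -> ~~ odd z ->
  diagemb l r z (tau x) (tau u) = tau (diagemb l r z x u).
Proof.
move=> ne ze; rewrite /diagemb !tau_diagrep//.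
by rewrite !tau_block ?tau0// ?oddD !oddM (negbTE ne) ?andbF.
Qed.

Lemma diagrep1 l (x : 'M[F]_1) : diagrep l x = (x 0 0)%:M.
Proof.
elim: l => [|l IH] /=; first by rewrite [LHS]flatmx0 [RHS]flatmx0.
by rewrite IH {1}[x]mx11_scalar -scalar_mx_block.
Qed.

Lemma scalar_block0 m k (a : F) : k = 0%N ->
  block_mx (a%:M : 'M[F]_m) 0 0 (0 : 'M[F]_k) = a%:M.
Proof.
by move=> k0; subst k; rewrite scalar_mx_block; congr block_mx; apply/matrixP => -[].
Qed.

Lemma tau_scalar n (a : F) : tau (a%:M : 'M[F]_n) = a%:M.
Proof.
rewrite /tau tr_scalar_mx; case: ifPn => // ne.
by rewrite mul_mx_scalar -scalemxAl Jmx_sqr// scalerN opprK scalemx1.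
Qed.

End EmbeddingLemmas.

Section LimitAlgebra.
Context (F : fieldType) (T : tripleSeq) (X : invType).

Definition stage (i : nat) : invAlg F := canonAlg F X (degree T i).

Definition stage_emb (i : nat) : stage i -> stage i.+1 :=
  @canonEmb F X (degree T i) (tl T i) (tr T i) (tz T i).

Lemma stage_embP (adm : admissible T X) i : inv_morph (@stage_emb i).
Proof.
rewrite /stage_emb /stage; move: adm; case: X => /= adm.
- split=> /= [a x y|x y|x].
  + by congr pair; exact: diagemb_linear.
  + by rewrite !diagembM.
  + by rewrite !diagemb_tr.
- split=> /= [a x y|x y|x].
  + exact: diagemb_linear.
  + exact: diagembM.
  + exact: diagemb_tr.
- split=> /= [a x y|x y|x].
  + exact: diagemb_linear.
  + exact: diagembM.
  + case: adm => r0 ev; case: i x => [|i] x.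
      have hr := tr0 T; have hz := tz0 T.
      rewrite /diagemb !diagrep1.
      rewrite -!scalar_mx_block !scalar_block0// tau_scalar.
      by rewrite {1}[x]mx11_scalar tau_scalar mxE eqxx mulr1n.
    apply: tau_diagemb; first exact: ev.
    move: (ev i.+1); rewrite degreeS oddD oddM (negbTE (ev i)) andbF.
    by [].
Qed.

Definition limSys (adm : admissible T X) : dirSys F :=
  @DirSys F stage stage_emb (stage_embP adm).

Definition limAlg (adm : admissible T X) : invAlg F := dirLim (limSys adm).

End LimitAlgebra.

(** * Density *)

Definition density_seq (R : realType) (T : tripleSeq) (i : nat) : R :=
  (\prod_(j < i) tsum T j)%N%:R / (degree T i)%:R.

Definition density (R : realType) (T : tripleSeq) : R :=
  limn (density_seq R T).

Definition sparse (R : realType) (T : tripleSeq) : Prop := density R T = 0.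

Definition dense_type (R : realType) (T : tripleSeq) : Prop :=
  0 < density R T /\ forall i, density R T < density_seq R T i.

Definition pure_type (R : realType) (T : tripleSeq) : Prop :=
  0 < density R T /\ exists i, density_seq R T i = density R T.

Definition two_sided_symmetric (T : tripleSeq) : Prop :=
  forall N, exists j, (N <= j)%N /\ tl T j = tr T j.

(** * Supernatural numbers *)

(* The exponent of each prime; None stands for infinity. *)
Definition supernat := {p : nat | prime p} -> option nat.

Definition sn_mul (P Q : supernat) : supernat := fun p =>
  match P p, Q p with Some a, Some b => Some (a + b)%N | _, _ => None end.

Definition sn_dvd (P Q : supernat) : Prop := forall p,
  match P p, Q p return Prop with
  | _, None => True
  | None, Some _ => False
  | Some a, Some b => (a <= b)%N
  end.

Definition sn_nat (n : nat) : supernat := fun p => Some (logn (val p) n).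

Definition sn_two_infty : supernat := fun p =>
  if val p == 2%N then None else Some 0%N.

(* The exponent of p is the sum of the exponents of p in the s_i: the eventual
   value of the partial sums if these are bounded, infinity otherwise. *)
Definition sn_prod (s : nat -> nat) : supernat := fun p =>
  let u (k : nat) := (\sum_(i < k) logn (val p) (s i))%N in
  if `[< exists m, forall k, (u k <= m)%N >]
  then Some (xget 0%N [set m | exists N, forall k, (N <= k)%N -> u k = m]%classic)
  else None.

Definition sn_scaled (q : rat) (P P' : supernat) : Prop :=
  exists n m : nat, [/\ (0 < n)%N, (0 < m)%N, n%:R * q = m%:R
    & sn_mul (sn_nat n) P = sn_mul (sn_nat m) P'].

Definition sn_qequiv (P P' : supernat) : Prop :=
  exists q : rat, q != 0 /\ sn_scaled q P P'.

Definition in_sn_ratio (R : realType) (x : R) (P P' : supernat) : Prop :=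
  exists q : rat, x = ratr q /\ sn_scaled q P P'.

(** * The conditions A1, A2, A3 *)

Definition condA1 (R : realType) (T T' : tripleSeq) : Prop :=
  [\/ sparse R T /\ sparse R T',
      dense_type R T /\ dense_type R T'
    | pure_type R T /\ pure_type R T'].

Definition condA2 (T T' : tripleSeq) : Prop :=
  sn_qequiv (sn_prod (tsum T)) (sn_prod (tsum T')).

Definition condA3 (R : realType) (T T' : tripleSeq) : Prop :=
  dense_type R T \/ pure_type R T -> dense_type R T' \/ pure_type R T' ->
  in_sn_ratio (density R T / density R T')
    (sn_prod (tsum T)) (sn_prod (tsum T')).

(* Main.v *)
(* An isomorphism of the limits restricts to mutually inverse zigzags of
   embeddings between finite stages, and the multiplicity of an embedding is read
   off ranks of idempotents.  Multiplicities are multiplicative, so those of the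
   zigzag are a constant multiple of quotients of the partial products of the
   s_i and s'_i; this constant is the rational number occurring in A2 and A3.
   Compatibility with the involutions forces equal ranks in the two components
   of type A, and even multiplicities between types O and S because a
   skew-symmetric matrix has even rank.

   Conversely, M_n + M_n with the exchange involution embeds in degree 2n of both
   type O and type S, and types O and S of degree n embed in M_n + M_n.  Maps with
   prescribed multiplicities therefore exist, and two maps with the same
   multiplicities are unitarily conjugate: they are conjugate by Skolem-Noether,
   and for types O and S the conjugating g is corrected by a polynomial square
   root of g^* g.  Elliott's intertwining argument then applies.  Between types O
   and S one passes through an algebra of type A.

   In characteristic 2 the types are separated by which symmetric elements have
   the form y + y^*. *)

Require Import Defs.
From mathcomp Require Import all_boot all_order all_algebra.
From mathcomp Require Import all_classical all_reals all_analysis.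
From mathcomp Require Import zify ring.

Set Implicit Arguments.
Unset Strict Implicit.
Unset Printing Implicit Defensive.

Import Order.TTheory GRing.Theory Num.Theory numFieldNormedType.Exports.
Local Open Scope ring_scope.

(** * Linear algebra of idempotents *)

(** Both directions pass through one finite form of the conditions. If the invariants differ by the
    constant [m / n], a map from stage [i] to stage [j] should multiply ranks, taken relative to the
    degrees, by the quotient of [m * sum_prod T' j] by [n * sum_prod T i]. Such a map needs this
    quotient to be an integer and the copies to fit into [degree T' j]. Integrality in both
    directions amounts to A2; the size inequality, after division, compares the density sequences
    and yields A1 and the value in A3.

    The embeddings are not unital. Conjugacy therefore has to match the idempotents that are images
    of units, then their complements, and ranks of idempotents do the counting.

    A map from type O or S into type A has equal ranks in both components, so a round trip starting
    in type A can agree with a transition map only past an index with [tl k = tr k]: this is the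
    role of two-sided symmetry. The passage from [M_n + M_n] to degree [2n] costs a factor 2 in
    every round trip, hence the power of 2. The square root is a polynomial in [st g *m g] because
    it must be fixed by the involution and commute with the image. *)

Section LinearFunctions.
Context (F : fieldType) (U V : lmodType F) (f : U -> V) (f_lin : linear f).

Lemma lin0 : f 0 = 0.
Proof. by have := f_lin (-1) 0 0; rewrite !scaleN1r !addNr. Qed.

Lemma linD x y : f (x + y) = f x + f y.
Proof. by rewrite -[x in LHS]scale1r f_lin scale1r. Qed.

Lemma linZ a x : f (a *: x) = a *: f x.
Proof. by rewrite -[a *: x]addr0 f_lin lin0 addr0. Qed.

Lemma linN x : f (- x) = - f x.
Proof. by rewrite -scaleN1r linZ scaleN1r. Qed.

Lemma lin_sum (I : Type) (r : seq I) (P : pred I) (E : I -> U) :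
  f (\sum_(i <- r | P i) E i) = \sum_(i <- r | P i) f (E i).
Proof. by apply: (big_morph f linD lin0). Qed.

End LinearFunctions.

Section Idempotents.
Context (F : fieldType).

(** Each idempotent fixes its own row space and kills that of the other, so the two meet trivially;
    [p *m (p + q) = p] puts the row space of [p] inside that of the sum, and likewise for [q]. *)
Lemma mxrank_idemD N (p q : 'M[F]_N) : p *m p = p -> q *m q = q ->
  p *m q = 0 -> q *m p = 0 -> \rank (p + q)%R = (\rank p + \rank q)%N.
Proof.
move=> pp qq pq qp.
have dis : (p :&: q = 0)%MS.
  apply/eqP; rewrite -submx0; apply/rV_subP => v.
  rewrite sub_capmx => /andP[/submxP[a va] /submxP[b vb]].
  have : v *m p = v by rewrite va -mulmxA pp.
  by rewrite {1}vb -mulmxA qp mulmx0 => <-; exact: sub0mx.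
rewrite -mxrank_disjoint_sum//; apply: eqmx_rank; apply/andP; split.
  by rewrite addmx_sub_adds.
rewrite addsmx_sub; apply/andP; split; apply/submxP.
  by exists p; rewrite mulmxDr pp pq addr0.
by exists q; rewrite mulmxDr qq qp add0r.
Qed.

Lemma mxrank_idem_sum N (I : finType) (p : I -> 'M[F]_N) :
  (forall i j, p i *m p j = if i == j then p i else 0) ->
  \rank (\sum_i p i)%R = (\sum_i \rank (p i))%N.
Proof.
move=> pE.
suff H (s : seq I) : uniq s ->
    \rank (\sum_(i <- s) p i)%R = (\sum_(i <- s) \rank (p i))%N.
  by apply: H; exact: index_enum_uniq.
elim: s => [_|i s IH /= /andP[ni us]]; first by rewrite !big_nil mxrank0.
rewrite !big_cons mxrank_idemD ?IH//.
- by rewrite pE eqxx.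
- rewrite mulmx_suml [LHS]big_seq [RHS]big_seq; apply: eq_bigr => j js.
  rewrite mulmx_sumr (bigD1_seq j)//= pE eqxx big1 ?addr0// => k kj.
  by rewrite pE eq_sym (negbTE kj).
- rewrite mulmx_sumr big_seq big1// => j js; rewrite pE.
  by case: eqP ni => // ->; rewrite js.
- rewrite mulmx_suml big_seq big1// => j js; rewrite pE.
  by case: eqP ni => // <-; rewrite js.
Qed.

(** In the full rank factorization [C] cancels on the left and [R] on the right, so [p *m p = p]
    collapses to [R *m C = 1%:M]. *)
Lemma idem_factor N (p : 'M[F]_N) : p *m p = p ->
  exists (C : 'M[F]_(N, (\rank p))) (R : 'M[F]_((\rank p), N)), p = C *m R /\ R *m C = 1%:M.
Proof.
move=> pp; move: (row_base_free p) (col_base_full p) (mulmx_base p).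
move: (col_base p) (row_base p) => C R Rfree Cfull CR.
exists C, R; rewrite CR; split=> //.
apply: (row_free_inj Rfree); apply: (row_full_inj Cfull).
by rewrite mul1mx !mulmxA CR -mulmxA CR.
Qed.

Lemma mxrank_idemC N (a b : 'M[F]_N) : a *m b *m (a *m b) = a *m b ->
  b *m a *m (b *m a) = b *m a -> \rank (a *m b) = \rank (b *m a).
Proof.
move=> ab ba; apply/eqP; rewrite eqn_leq; apply/andP; split.
  rewrite -ab -mulmxA [b *m (a *m b)]mulmxA.
  by rewrite (leq_trans (mxrankM_maxr _ _))// mxrankM_maxl.
rewrite -ba -mulmxA [a *m (b *m a)]mulmxA.
by rewrite (leq_trans (mxrankM_maxr _ _))// mxrankM_maxl.
Qed.

Lemma mxrank_idemB N (p : 'M[F]_N) : p *m p = p ->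
  \rank (1%:M - p)%R = (N - \rank p)%N.
Proof.
move=> pp.
have e : (1%:M - p) *m (1%:M - p) = 1%:M - p.
  by rewrite mulmxBl !mulmxBr !mul1mx mulmx1 pp subrr subr0.
suff : N = (\rank p + \rank (1%:M - p)%R)%N by move=> /(congr1 (subn^~ (\rank p))); rewrite addKn.
rewrite -mxrank_idemD//; first by rewrite addrCA subrr addr0 mxrank1.
  by rewrite mulmxBr mulmx1 pp subrr.
by rewrite mulmxBl mul1mx pp subrr.
Qed.

Definition mx_hom n N (h : 'M[F]_n -> 'M[F]_N) : Prop :=
  linear h /\ forall x y, h (x *m y) = h x *m h y.

(** An idempotent splits into orthogonal idempotents of rank one, all equivalent to
    [delta_mx i0 i0]; homomorphisms preserve orthogonality and equivalence. *)
Lemma mx_hom_rank n N (h : 'M[F]_n -> 'M[F]_N) (i0 : 'I_n) : mx_hom h ->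
  forall x, x *m x = x -> \rank (h x) = (\rank (h (delta_mx i0 i0)) * \rank x)%N.
Proof.
move=> [hl hM] x xx; have [C [R [xE RC]]] := idem_factor xx.
pose p k := col k C *m row k R.
have RCE k l : row k R *m col l C = (k == l)%:R%:M.
  rewrite rowE colE -!mulmxA [R *m _]mulmxA RC mul1mx mul_delta_mx_cond.
  by apply/matrixP => i j; rewrite !mxE !ord1; case: eqP; rewrite !mxE.
have pE k l : p k *m p l = if k == l then p k else 0.
  rewrite /p -mulmxA [row k R *m _]mulmxA RCE.
  by case: eqP => [->|_]; rewrite ?mul1mx// mul_scalar_mx scale0r mulmx0.
have -> : x = \sum_k p k.
  rewrite {1}xE; apply/matrixP => i j; rewrite summxE mxE; apply: eq_bigr => k _.
  by rewrite mxE big_ord1 !mxE.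
rewrite mxrank_idem_sum// (lin_sum hl) mxrank_idem_sum; last first.
  by move=> k l; rewrite -hM pE; case: eqP; rewrite ?(lin0 hl).
rewrite big_distrr /=; apply: eq_bigr => k _.
have p1 : \rank (p k) = 1%N.
  apply/eqP; rewrite eqn_leq; apply/andP; split.
    by rewrite (leq_trans (mxrankM_maxl _ _))// rank_leq_col.
  rewrite lt0n mxrank_eq0; apply/eqP => pk0.
  have := RCE k k; rewrite eqxx => RCk.
  have /matrixP/(_ 0 0) : row k R *m (p k) *m col k C = 0 by rewrite pk0 mulmx0 mul0mx.
  rewrite /p mulmxA RCk mul1mx RCk !mxE /= => /eqP; by rewrite oner_eq0.
rewrite p1 muln1.
(* The products of [a] and [b] in the two orders are [p k] and [delta_mx i0 i0]; applying [h] keeps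
   this relation, hence the equality of ranks. *)
pose a := col k C *m delta_mx 0 i0; pose b := delta_mx i0 0 *m row k R.
have ab : a *m b = p k.
  have d1 : delta_mx 0 0 = 1%:M :> 'M[F]_1 by apply/matrixP => i j; rewrite !mxE !ord1.
  by rewrite /a /b -mulmxA [delta_mx _ _ *m (_ *m _)]mulmxA mul_delta_mx d1 mul1mx.
have ba : b *m a = delta_mx i0 i0.
  by rewrite /a /b -mulmxA [row _ _ *m (_ *m _)]mulmxA RCE eqxx mul1mx mul_delta_mx.
rewrite -ab -ba !hM mxrank_idemC// -!hM ?ab ?ba ?pE ?eqxx//.
by rewrite mul_delta_mx.
Qed.

(* Murray-von Neumann equivalence of idempotents. *)
Definition mvn_equiv N (p p' a b : 'M[F]_N) : Prop :=
  [/\ a *m b = p', b *m a = p, p' *m a *m p = a & p *m b *m p' = b].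

Lemma mvn_rank N (p p' : 'M[F]_N) : p *m p = p -> p' *m p' = p' ->
  \rank p = \rank p' -> exists a b, mvn_equiv p p' a b.
Proof.
move=> pp pp' er; have [C [R [pE RC]]] := idem_factor pp.
have [C' [R' [pE' RC']]] : exists (C' : 'M[F]_(N, (\rank p))) (R' : 'M[F]_((\rank p), N)),
    p' = C' *m R' /\ R' *m C' = 1%:M by rewrite er; exact: idem_factor.
rewrite pE pE'; exists (C' *m R), (C *m R'); split.
- by rewrite -mulmxA [R *m _]mulmxA RC mul1mx.
- by rewrite -mulmxA [R' *m _]mulmxA RC' mul1mx.
- by rewrite -!mulmxA [R *m _]mulmxA RC mul1mx [R' *m _]mulmxA RC' mul1mx.
- by rewrite -!mulmxA [R' *m _]mulmxA RC' mul1mx [R *m _]mulmxA RC mul1mx.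
Qed.

Lemma mvn_equivD N (p p' a b q q' c d : 'M[F]_N) :
  p *m p = p -> q *m q = q -> p' *m p' = p' -> q' *m q' = q' ->
  p *m q = 0 -> q *m p = 0 -> p' *m q' = 0 -> q' *m p' = 0 ->
  mvn_equiv p p' a b -> mvn_equiv q q' c d ->
  mvn_equiv (p + q) (p' + q') (a + c) (b + d).
Proof.
move=> pp qq pp' qq' pq qp pq' qp' [ab ba aE bE] [cd dc cE dE].
have ap : a *m p = a by rewrite -aE -mulmxA pp.
have pa : p' *m a = a by rewrite -aE !mulmxA pp'.
have bp : b *m p' = b by rewrite -bE -mulmxA pp'.
have pb : p *m b = b by rewrite -bE !mulmxA pp.
have cq : c *m q = c by rewrite -cE -mulmxA qq.
have qc : q' *m c = c by rewrite -cE !mulmxA qq'.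
have dq : d *m q' = d by rewrite -dE -mulmxA qq'.
have qd : q *m d = d by rewrite -dE !mulmxA qq.
(* Cross terms vanish because two orthogonal idempotents can be inserted between their factors. *)
have z (x y u v : 'M[F]_N) : x *m u = x -> v *m y = y -> u *m v = 0 -> x *m y = 0.
  by move=> <- <- uv; rewrite -mulmxA [u *m _]mulmxA uv mul0mx mulmx0.
split.
- by rewrite mulmxDl !mulmxDr ab cd (z a d p q)// (z c b q p)// addr0 add0r.
- by rewrite mulmxDl !mulmxDr ba dc (z b c p' q')// (z d a q' p')// addr0 add0r.
- have -> : (p' + q') *m (a + c) = a + c.
    by rewrite mulmxDl !mulmxDr pa qc (z p' c p' q')// (z q' a q' p')// addr0 add0r.
  by rewrite mulmxDl !mulmxDr ap cq (z a q p q)// (z c p q p)// addr0 add0r.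
- have -> : (p + q) *m (b + d) = b + d.
    by rewrite mulmxDl !mulmxDr pb qd (z p d p q)// (z q b q p)// addr0 add0r.
  by rewrite mulmxDl !mulmxDr bp dq (z b q' p' q')// (z d p' q' p')// addr0 add0r.
Qed.

(* The matrix units spread an equivalence of the images of one of them over
   the whole image. *)
Lemma mvn_hom n N (h h' : 'M[F]_n -> 'M[F]_N) (i0 : 'I_n) :
  mx_hom h -> mx_hom h' ->
  \rank (h (delta_mx i0 i0)) = \rank (h' (delta_mx i0 i0)) ->
  exists a b, mvn_equiv (h 1%:M) (h' 1%:M) a b /\ forall x, a *m h x = h' x *m a.
Proof.
move=> [hl hM] [hl' hM'] er.
have [||a0 [b0 [ab ba aE bE]]] := @mvn_rank N (h (delta_mx i0 i0)) (h' (delta_mx i0 i0)) _ _ er.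
- by rewrite -hM mul_delta_mx.
- by rewrite -hM' mul_delta_mx.
pose e k l : 'M[F]_n := delta_mx k l.
pose a := \sum_k h' (e k i0) *m a0 *m h (e i0 k).
pose b := \sum_k h (e k i0) *m b0 *m h' (e i0 k).
have one : 1%:M = \sum_k e k k.
  apply/matrixP => i j; rewrite summxE !mxE (bigD1 i)//= !mxE eqxx /=.
  rewrite big1 ?addr0; last by move=> k ki; rewrite mxE eq_sym (negbTE ki).
  by rewrite eq_sym.
have ha k l : a *m h (e k l) = h' (e k i0) *m a0 *m h (e i0 l).
  rewrite mulmx_suml (bigD1 k)//= -mulmxA -hM mul_delta_mx big1 ?addr0// => m mk.
  by rewrite -mulmxA -hM mul_delta_mx_cond (negbTE mk) mulr0n (lin0 hl) mulmx0.
have ha' k l : h' (e k l) *m a = h' (e k i0) *m a0 *m h (e i0 l).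
  rewrite mulmx_sumr (bigD1 l)//= !mulmxA -hM' mul_delta_mx big1 ?addr0// => m ml.
  by rewrite !mulmxA -hM' mul_delta_mx_cond eq_sym (negbTE ml) mulr0n (lin0 hl') !mul0mx.
have hb k l : b *m h' (e k l) = h (e k i0) *m b0 *m h' (e i0 l).
  rewrite mulmx_suml (bigD1 k)//= -mulmxA -hM' mul_delta_mx big1 ?addr0// => m mk.
  by rewrite -mulmxA -hM' mul_delta_mx_cond (negbTE mk) mulr0n (lin0 hl') mulmx0.
have a1 : a *m h 1%:M = a.
  by rewrite one (lin_sum hl) mulmx_sumr; apply: eq_bigr => k _; rewrite ha.
have a1' : h' 1%:M *m a = a.
  by rewrite one (lin_sum hl') mulmx_suml; apply: eq_bigr => k _; rewrite ha'.
exists a, b; split; last first.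
  move=> x; rewrite (matrix_sum_delta x) (lin_sum hl) (lin_sum hl').
  rewrite mulmx_sumr mulmx_suml; apply: eq_bigr => k _.
  rewrite (lin_sum hl) (lin_sum hl') mulmx_sumr mulmx_suml; apply: eq_bigr => l _.
  by rewrite (linZ hl) (linZ hl') -scalemxAl -scalemxAr ha ha'.
split.
- rewrite mulmx_sumr one (lin_sum hl'); apply: eq_bigr => k _.
  rewrite !mulmxA ha -!mulmxA [h _ *m (b0 *m _)]mulmxA.
  have -> : h (e i0 i0) *m b0 = b0.
    by rewrite -bE !mulmxA -hM mul_delta_mx.
  by rewrite [a0 *m _]mulmxA ab -hM' mul_delta_mx -hM' mul_delta_mx.
- rewrite mulmx_sumr one (lin_sum hl); apply: eq_bigr => k _.
  rewrite !mulmxA hb -!mulmxA [h' _ *m (a0 *m _)]mulmxA.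
  have -> : h' (e i0 i0) *m a0 = a0.
    by rewrite -aE !mulmxA -hM' mul_delta_mx.
  by rewrite [b0 *m _]mulmxA ba -hM mul_delta_mx -hM mul_delta_mx.
- by rewrite a1' a1.
- have b1 : b *m h' 1%:M = b.
    by rewrite one (lin_sum hl') mulmx_sumr; apply: eq_bigr => k _; rewrite hb.
  rewrite -mulmxA b1 one (lin_sum hl) mulmx_suml.
  apply: eq_bigr => k _; rewrite mulmx_sumr (bigD1 k)//= !mulmxA -hM mul_delta_mx.
  rewrite big1 ?addr0// => m mk.
  by rewrite !mulmxA -hM mul_delta_mx_cond eq_sym (negbTE mk) mulr0n (lin0 hl) !mul0mx.
Qed.

(** A pair of homomorphisms with orthogonal images stands for one homomorphism on [M_n + M_n]. The
    partial intertwiners of the two summands add up, and the complements of the images of the units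
    have equal rank. *)
Lemma mx_hom2_conj n N (h1 h2 h1' h2' : 'M[F]_n -> 'M[F]_N) (i0 : 'I_n) :
  mx_hom h1 -> mx_hom h2 -> mx_hom h1' -> mx_hom h2' ->
  (forall x y, h1 x *m h2 y = 0) -> (forall x y, h2 x *m h1 y = 0) ->
  (forall x y, h1' x *m h2' y = 0) -> (forall x y, h2' x *m h1' y = 0) ->
  \rank (h1 (delta_mx i0 i0)) = \rank (h1' (delta_mx i0 i0)) ->
  \rank (h2 (delta_mx i0 i0)) = \rank (h2' (delta_mx i0 i0)) ->
  exists g, [/\ g \in unitmx, forall x, g *m h1 x = h1' x *m g
             & forall x, g *m h2 x = h2' x *m g].
Proof.
move=> H1 H2 H1' H2' o12 o21 o12' o21' r1 r2.
have [a [b [ab aE]]] := mvn_hom H1 H1' r1.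
have [c [d [cd cE]]] := mvn_hom H2 H2' r2.
have idem h : mx_hom h -> h 1%:M *m h 1%:M = h (1%:M : 'M[F]_n) :> 'M[F]_N.
  by case=> _ hM; rewrite -hM mulmx1.
have ac := mvn_equivD (idem _ H1) (idem _ H2) (idem _ H1') (idem _ H2')
  (o12 _ _) (o21 _ _) (o12' _ _) (o21' _ _) ab cd.
set p := h1 1%:M + h2 1%:M in ac; set p' := h1' 1%:M + h2' 1%:M in ac.
have pp : p *m p = p.
  by rewrite /p mulmxDl !mulmxDr !idem// o12 o21 addr0 add0r.
have pp' : p' *m p' = p'.
  by rewrite /p' mulmxDl !mulmxDr !idem// o12' o21' addr0 add0r.
have [e1 e2 e3 e4] := ac.
have er : \rank p = \rank p'.
  by rewrite -e1 -e2; apply/esym/mxrank_idemC; rewrite ?e1 ?e2.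
have cI (q : 'M[F]_N) : q *m q = q -> (1%:M - q) *m (1%:M - q) = 1%:M - q.
  by move=> qq; rewrite mulmxBl !mulmxBr !mul1mx mulmx1 qq subrr subr0.
(* An equivalence of the complements makes the intertwiner invertible. It vanishes on the images, so
   the intertwining relations survive. *)
have [||//|f [k fk]] := @mvn_rank N (1%:M - p) (1%:M - p').
- exact: cI.
- exact: cI.
- by rewrite !mxrank_idemB ?er.
have cR (q : 'M[F]_N) : q *m q = q -> (q *m (1%:M - q) = 0).
  by move=> qq; rewrite mulmxBr mulmx1 qq subrr.
have cL (q : 'M[F]_N) : q *m q = q -> ((1%:M - q) *m q = 0).
  by move=> qq; rewrite mulmxBl mul1mx qq subrr.
have [g1 g2 _ _] := mvn_equivD pp (cI _ pp) pp' (cI _ pp') (cR _ pp) (cL _ pp)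
  (cR _ pp') (cL _ pp') ac fk.
have [_ _ fE _] := fk.
have [_ _ a3 _] := ab; have [_ _ c3 _] := cd.
have hk h (x : 'M[F]_n) : mx_hom h -> h 1%:M *m h x = h x :> 'M[F]_N.
  by case=> _ hM; rewrite -hM mul1mx.
have hk' h (x : 'M[F]_n) : mx_hom h -> h x *m h 1%:M = h x :> 'M[F]_N.
  by case=> _ hM; rewrite -hM mulmx1.
have ph1 x : (1%:M - p) *m h1 x = 0.
  by rewrite mulmxBl mul1mx mulmxDl hk// o21 addr0 subrr.
have ph2 x : (1%:M - p) *m h2 x = 0.
  by rewrite mulmxBl mul1mx mulmxDl hk// o12 add0r subrr.
have ph1' x : h1' x *m (1%:M - p') = 0.
  by rewrite mulmxBr mulmx1 mulmxDr hk'// o12' addr0 subrr.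
have ph2' x : h2' x *m (1%:M - p') = 0.
  by rewrite mulmxBr mulmx1 mulmxDr hk'// o21' add0r subrr.
exists (a + c + f); split.
- apply: (proj1 (mulmx1_unit (B := b + d + k) _)); rewrite g1 addrC subrK//.
- move=> x; rewrite !mulmxDl !mulmxDr aE.
  rewrite -[f in LHS]fE -[f in RHS]fE -!mulmxA ph1 [h1' x *m (_ *m _)]mulmxA ph1'.
  rewrite -[c in LHS]c3 -[c in RHS]c3 -!mulmxA o21 [h1' x *m (_ *m _)]mulmxA o12'.
  by rewrite !(mulmx0, mul0mx) !addr0.
- move=> x; rewrite !mulmxDl !mulmxDr cE.
  rewrite -[f in LHS]fE -[f in RHS]fE -!mulmxA ph2 [h2' x *m (_ *m _)]mulmxA ph2'.
  rewrite -[a in LHS]a3 -[a in RHS]a3 -!mulmxA o12 [h2' x *m (_ *m _)]mulmxA o21'.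
  by rewrite !(mulmx0, mul0mx) !addr0 ?add0r.
Qed.

End Idempotents.

(** * Polynomial square roots and unitary conjugation *)

Section SquareRoot.
Context (F : closedFieldType) (char2 : (2%:R : F) != 0).

(* Hensel lifting, one root at a time: passing from [Q] to [Q * ('X - z)]
   amounts to solving a nontrivial polynomial equation of degree at most 2. *)
Lemma poly_sqrtX (s : seq F) : 0 \notin s ->
  exists f : {poly F}, \prod_(z <- s) ('X - z%:P) %| f ^+ 2 - 'X.
Proof.
elim: s => [_|z s IH]; first by exists 0; rewrite big_nil dvd1p.
rewrite inE negb_or => /andP[z0 /IH[f /dvdpP[R fR]]]; rewrite big_cons.
set Q := \prod_(w <- s) _ in fR *.
(* As a polynomial in [t], the value at [z] of the cofactor [R + 2 t f + t^2 Q] that arises when [f]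
   is replaced by [f + t *: Q]. *)
pose p : {poly F} := (Q.[z])%:P * 'X^2 + (2%:R * f.[z])%:P * 'X + (R.[z])%:P.
have p1 : p`_1 = 2%:R * f.[z].
  by rewrite !coefE /= !mulr0 add0r mulr1 addr0.
have p2 : p`_2 = Q.[z].
  by rewrite !coefE /= !mulr0 mulr1 !addr0.
(* Only a nonzero constant lacks a root. For a constant, [f] and [Q] both vanish at [z], and
   evaluating [f ^+ 2 - 'X = R * Q] there gives [z = 0]. *)
have /closed_rootP[t /rootP] : size p != 1%N.
  apply/negP => /size_poly1P[c _ pc].
  have f0 : f.[z] = 0.
    by apply/eqP; move/eqP: p1; rewrite pc coefC /= eq_sym mulf_eq0 (negbTE char2).
  have Q0 : Q.[z] = 0 by rewrite -p2 pc coefC.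
  have /(congr1 (horner^~ z)) := fR.
  rewrite !hornerE /= f0 Q0 mulr0 expr0n /= sub0r => /eqP.
  by rewrite oppr_eq0 eq_sym (negbTE z0).
rewrite !hornerE /= => pt.
exists (f + t *: Q).
have -> : (f + t *: Q) ^+ 2 - 'X = Q * (R + (2%:R * t) *: f + t ^+ 2 *: Q).
  transitivity ((f ^+ 2 - 'X) + Q * ((2%:R * t) *: f + t ^+ 2 *: Q)); last by rewrite fR; ring.
  rewrite -!mul_polyC !rmorphM /= polyCMn; ring.
rewrite mulrC dvdp_mul2l; last first.
  by apply/monic_neq0/monic_prod => w _; exact: monicXsubC.
rewrite dvdp_XsubCl; apply/rootP; rewrite !hornerE /= -pt; ring.
Qed.

(** By Cayley-Hamilton a square root of ['X] modulo the characteristic polynomial is enough, and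
    invertibility keeps 0 out of its roots. *)
Lemma mx_sqrt n (h : 'M[F]_n.+1) : h \in unitmx ->
  exists f : {poly F}, horner_mx h f *m horner_mx h f = h.
Proof.
move=> hU; have [s sE] := closed_field_poly_normal (char_poly h).
have [|f /dvdpP[R fR]] := @poly_sqrtX s.
  apply/negP => s0; have : (char_poly h).[0] = 0.
    apply/rootP; rewrite sE rootZ; last by rewrite lead_coef_eq0 monic_neq0// char_poly_monic.
    by rewrite root_prod_XsubC.
  rewrite horner_coef0 char_poly_det => /eqP.
  rewrite mulf_eq0 signr_eq0 /=; move: hU; rewrite unitmxE unitfE.
  by move/negbTE->.
exists f; rewrite -[LHS]/(horner_mx h f * horner_mx h f) -rmorphM /= -expr2.
have -> : f ^+ 2 = R * char_poly h + 'X.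
  rewrite {1}sE (monicP (char_poly_monic h)) scale1r -fR; ring.
by rewrite rmorphD rmorphM /= Cayley_Hamilton mulr0 add0r horner_mx_X.
Qed.

(* An intertwiner [g] becomes unitary after division by a square root of
   [st g *m g], which can be taken inside the commutant of the image. *)
Lemma unitary_conj N (st : 'M[F]_N -> 'M[F]_N) (S : Type) (h h' : S -> 'M[F]_N)
    (g : 'M[F]_N) :
  linear st -> (forall x y, st (x *m y) = st y *m st x) -> involutive st ->
  g \in unitmx -> (forall x, g *m h x = h' x *m g) ->
  (forall x, exists y, st (h x) = h y /\ st (h' x) = h' y) ->
  exists u, [/\ u *m st u = 1%:M, st u *m u = 1%:M & forall x, u *m h x = h' x *m u].
Proof.
case: N st h h' g => [|N] st h h' g stl stM stK gU gh hst.
  exists 1%:M; rewrite ![1%:M]flatmx0; split=> [||x]; apply/matrixP => -[] //.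
have st1 : st 1%:M = 1%:M.
  by rewrite -[RHS]stK -[in RHS](mul1mx (st 1%:M)) stM !stK mul1mx.
pose k := st g *m g.
have kst : st k = k by rewrite /k stM stK.
(* Apply [st] to the intertwining relation; both images are stable under [st] in a matching way.
   Hence [k] commutes with the image of [h]. *)
have hsth x : h x *m st g = st g *m h' x.
  have [y [hy hy']] := hst x.
  have : st (g *m h y) = st (h' y *m g) by rewrite gh.
  by rewrite !stM -hy -hy' !stK.
have kh x : k *m h x = h x *m k.
  by rewrite /k -mulmxA gh !mulmxA hsth.
have sgU : st g \in unitmx.
  apply: (proj1 (mulmx1_unit (B := st (invmx g)) _)).
  by rewrite -stM mulVmx.
have kU : k \in unitmx by rewrite unitmx_mul sgU.
have [f ff] := mx_sqrt kU.
set w := horner_mx k f in ff.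
have wU : w \in unitmx by move: kU; rewrite -ff unitmx_mul => /andP[].
(* Being a polynomial in [k], [w] inherits from it the invariance under [st] and the commutation
   with the image. *)
have stw : st w = w.
  have stX i : st (k ^+ i) = k ^+ i.
    elim: i => [|i IH]; first by rewrite expr0 -[1]/(1%:M) st1.
    by rewrite exprS [LHS]stM IH kst -[LHS]/(k ^+ i * k) -exprSr exprS.
  rewrite /w -[f]coefK poly_def rmorph_sum /= (lin_sum stl); apply: eq_bigr => i _.
  by rewrite horner_mxZ (linZ stl) rmorphXn /= horner_mx_X stX.
have wh x : w *m h x = h x *m w by apply: comm_horner_mx; exact: kh.
have stwV : st (invmx w) = invmx w.
  have e : st (invmx w) *m w = 1%:M by rewrite -{2}stw -stM mulmxV// st1.
  by rewrite -[LHS]mulmx1 -(mulmxV wU) mulmxA e mul1mx.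
have wVh x : invmx w *m h x = h x *m invmx w.
  by rewrite -[h x in LHS]mulmx1 -(mulmxV wU) !mulmxA -[invmx w *m h x *m w]mulmxA -wh !mulmxA mulVmx// mul1mx.
have uu : st (g *m invmx w) *m (g *m invmx w) = 1%:M.
  rewrite stM stwV -!mulmxA [st g *m _]mulmxA -/k -ff -mulmxA mulmxV// mulmx1.
  by rewrite mulVmx.
exists (g *m invmx w); split=> //; first exact: mulmx1C.
by move=> x; rewrite -mulmxA wVh !mulmxA gh.
Qed.

End SquareRoot.

(** * Direct limits *)

Section DirectLimitTheory.
Context (F : fieldType) (D : dirSys F).
Local Notation A := (ds_obj D).

Lemma dlim_in_eq i j (x : A i) (y : A j) :
  dlim_in x = dlim_in y <->
  exists k, forall l, (k <= l)%N -> trans l x = trans l y.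
Proof.
have [k1 H1] := evP (Tagged A x); have [k2 H2] := evP (Tagged A y).
split=> [e|[k H]].
  exists (maxn k1 k2) => l; rewrite geq_max => /andP[l1 l2].
  by rewrite -(H1 _ l1) -(H2 _ l2) /= e.
apply: dlimP; exists (maxn k (maxn k1 k2)) => l; rewrite !geq_max => /and3P[lk l1 l2].
by rewrite (H1 _ l1) (H2 _ l2); apply: H.
Qed.

Lemma dlim_in_trans i j (x : A i) : (i <= j)%N -> dlim_in (trans j x) = dlim_in x.
Proof.
by move=> ij; apply/dlim_in_eq; exists j => l jl; rewrite trans_comp.
Qed.

Lemma dlim_in_surj (x : dlim D) :
  exists i0, forall i, (i0 <= i)%N -> exists a : A i, x = dlim_in a.
Proof.
exists (tag (repr x)) => i ri; exists (ev x i); rewrite /ev dlim_in_trans//.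
by rewrite /dlim_in -[LHS]reprK; congr (\pi_ _ _)%qT; case: (repr x).
Qed.

Lemma dlim_in_ext (x : dlim D) i (a : A i) :
  (exists k, forall j, (k <= j)%N -> ev x j = trans j a) -> x = dlim_in a.
Proof.
move=> [k H]; apply: dlimP; have [l Hl] := evP (Tagged A a).
by exists (maxn k l) => j; rewrite geq_max => /andP[/H -> /Hl ->].
Qed.

Lemma dlim_in_linear i : linear (@dlim_in F D i).
Proof.
move=> c a b; apply/esym/dlim_in_ext.
have [k Hk] := ev_lin c (dlim_in a) (dlim_in b).
have [l Hl] := evP (Tagged A a); have [m Hm] := evP (Tagged A b).
exists (maxn (maxn i k) (maxn l m)) => j; rewrite !geq_max => /andP[/andP[ij kj] /andP[lj mj]].
by rewrite Hk// (Hl _ lj) (Hm _ mj) /= (trans_linear ij).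
Qed.

Lemma dlim_inM i (a b : A i) :
  dlim_in (imul a b) = imul (dlim_in a : dirLim D) (dlim_in b).
Proof.
apply/esym/dlim_in_ext; have [k Hk] := evM (dlim_in a) (dlim_in b).
have [l Hl] := evP (Tagged A a); have [m Hm] := evP (Tagged A b).
exists (maxn (maxn i k) (maxn l m)) => j; rewrite !geq_max => /andP[/andP[ij kj] /andP[lj mj]].
by rewrite Hk// (Hl _ lj) (Hm _ mj) /= transM.
Qed.

Lemma dlim_in_star i (a : A i) : dlim_in (star a) = star (dlim_in a : dirLim D).
Proof.
apply/esym/dlim_in_ext; have [k Hk] := evS (dlim_in a).
have [l Hl] := evP (Tagged A a).
exists (maxn (maxn i k) l) => j; rewrite !geq_max => /andP[/andP[ij kj] lj].
by rewrite Hk// (Hl _ lj) /= trans_star.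
Qed.

Lemma dlim_in_morph i : inv_morph (@dlim_in F D i : A i -> dirLim D).
Proof. by split; [exact: dlim_in_linear|exact: dlim_inM|exact: dlim_in_star]. Qed.

Lemma trans_morph i j : (i <= j)%N -> inv_morph (@trans F D i j).
Proof.
by move=> ij; split=> [|x y|x]; [exact: trans_linear|exact: transM|exact: trans_star].
Qed.

Hypothesis ds_inj : forall i, injective (ds_map (d := D) (i := i)).

Lemma trans_inj i j : (i <= j)%N -> injective (@trans F D i j).
Proof.
move=> /subnK <-; elim: (j - i)%N => [|k IH] x y; first by rewrite !trans_id.
by rewrite addSn !transS ?leq_addl// => /ds_inj /IH.
Qed.

Lemma dlim_in_inj i : injective (@dlim_in F D i).
Proof.
move=> x y /dlim_in_eq[k H]; apply: (@trans_inj i (maxn i k)); first by rewrite leq_maxl.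
by apply: H; rewrite leq_maxr.
Qed.

End DirectLimitTheory.

Section Isomorphisms.
Context (F : fieldType).

Lemma inv_morph_comp (A B C : invAlg F) (f : A -> B) (g : B -> C) :
  inv_morph f -> inv_morph g -> inv_morph (g \o f).
Proof.
move=> [fl fM fs] [gl gM gs]; split=> [a x y|x y|x] /=.
- by rewrite fl gl.
- by rewrite fM gM.
- by rewrite fs gs.
Qed.

Lemma inv_morph_can (A B : invAlg F) (f : A -> B) (g : B -> A) :
  inv_morph f -> cancel f g -> cancel g f -> inv_morph g.
Proof.
move=> [fl fM fs] fg gf; split=> [a x y|x y|x]; apply: (can_inj fg).
- by rewrite gf fl !gf.
- by rewrite gf fM !gf.
- by rewrite gf fs !gf.
Qed.

Lemma inv_iso_sym (A B : invAlg F) : inv_iso A B -> inv_iso B A.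
Proof.
move=> [f [fm [g fg gf]]]; exists g; split; first exact: inv_morph_can fm fg gf.
by exists f.
Qed.

Lemma inv_iso_trans (A B C : invAlg F) : inv_iso A B -> inv_iso B C -> inv_iso A C.
Proof.
move=> [f [fm fb]] [g [gm gb]]; exists (g \o f); split; first exact: inv_morph_comp.
exact: bij_comp.
Qed.

End Isomorphisms.

(* Elliott's intertwining argument. *)
Section Intertwining.
Context (F : fieldType) (D D' : dirSys F).
Local Notation A := (ds_obj D).
Local Notation B := (ds_obj D').
(** Left abstract: these predicates carry the data on multiplicities that a map must keep for the
    next step to be possible. *)
Context (good : forall i j, (A i -> B j) -> Prop).
Context (good' : forall j i, (B j -> A i) -> Prop).
Hypothesis goodP : forall i j phi, good (i := i) (j := j) phi -> inv_morph phi.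
Hypothesis good_start : exists i j phi, good (i := i) (j := j) phi.
Hypothesis good_step : forall i j phi, good (i := i) (j := j) phi -> forall N,
  exists i' psi, [/\ (N <= i')%N, (i <= i')%N, good' (j := j) (i := i') psi
    & forall x, psi (phi x) = trans i' x].
Hypothesis good_step' : forall j i psi, good' (j := j) (i := i) psi -> forall N,
  exists j' phi, [/\ (N <= j')%N, (j <= j')%N, good (i := i) (j := j') phi
    & forall y, phi (psi y) = trans j' y].

Let state := {i : nat & {j : nat & {phi : A i -> B j | good phi}}}.
Let si (s : state) : nat := projT1 s.
Let sj (s : state) : nat := projT1 (projT2 s).
Let sphi (s : state) : A (si s) -> B (sj s) := sval (projT2 (projT2 s)).

Let next (s t : state) : Prop := [/\ (si s < si t)%N, (sj s < sj t)%N
  & exists psi : B (sj s) -> A (si t),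
    (forall x, psi (@sphi s x) = trans (si t) x) /\
    (forall y, @sphi t (psi y) = trans (sj t) y)].

Let next_ex s : exists t, next s t.
Proof.
case: s => i [j [phi gphi]].
have [i' [psi [Ni ii gpsi e]]] := good_step gphi i.+1.
have [j' [phi' [Nj jj gphi' e']]] := good_step' gpsi j.+1.
exists (existT _ i' (existT _ j' (exist _ phi' gphi'))); split=> //.
by exists psi.
Qed.

Lemma intertwining : inv_iso (dirLim D) (dirLim D').
Proof.
have [i0 [j0 [phi0 g0]]] := good_start.
have [nx nxP] := choice next_ex.
pose s k := iter k nx (existT _ i0 (existT _ j0 (exist _ phi0 g0)) : state).
have sP k : next (s k) (s k.+1) by exact: nxP.
have mphi k : inv_morph (@sphi (s k)) by apply: goodP; exact: (svalP (projT2 (projT2 (s k)))).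
have ki k : (k <= si (s k))%N.
  by elim: k => // k IH; case: (sP k) => lt _ _; exact: leq_ltn_trans lt.
have kj k : (k <= sj (s k))%N.
  by elim: k => // k IH; case: (sP k) => _ lt _; exact: leq_ltn_trans lt.
(* The ascending maps are natural: the return map [psi] turns [sphi] after a transition into [sphi]
   after [psi] after [sphi], which is a transition after [sphi]. *)
have step k l (x : A (si (s k))) : (k <= l)%N ->
    [/\ (si (s k) <= si (s l))%N, (sj (s k) <= sj (s l))%N
      & sphi (trans (si (s l)) x) = trans (sj (s l)) (sphi x)].
  move=> /subnK <-; elim: (l - k)%N => [|m [IHi IHj IH]].
    by rewrite !add0n !trans_id.
  rewrite addSn; have [lti ltj [psi [e1 e2]]] := sP (m + k)%N.
  have hi := leq_trans IHi (ltnW lti); have hj := leq_trans IHj (ltnW ltj).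
  split=> //; rewrite -(trans_comp _ IHi (ltnW lti)) -e1 e2 IH.
  by rewrite trans_comp// ltnW.
(* The limit map is chosen from a relation; naturality then shows that it does not depend on the
   representative. *)
pose G (x : dlim D) (y : dlim D') :=
  exists k (a : A (si (s k))), x = dlim_in a /\ y = dlim_in (sphi a).
have [f fG] : {f : dlim D -> dlim D' & forall x, G x (f x)}.
  apply: choice => x; have [i1 H] := dlim_in_surj x.
  have [a xa] := H (si (s i1)) (ki _).
  by exists (dlim_in (sphi a)), i1, a.
have fE k (a : A (si (s k))) : f (dlim_in a) = dlim_in (sphi a).
  have [l [b [ab ->]]] := fG (dlim_in a).
  have /dlim_in_eq[m H] := ab; apply/dlim_in_eq.
  pose n := maxn m (maxn k l).
  have nk : (k <= n)%N by rewrite !leq_max leqnn orbT.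
  have nl : (l <= n)%N by rewrite !leq_max leqnn !orbT.
  exists (sj (s n)) => q nq; have [h1 h2 h3] := step k n a nk; have [h1' h2' h3'] := step l n b nl.
  rewrite -(trans_comp _ h2' nq) -(trans_comp _ h2 nq) -h3 -h3' H//.
  by apply: leq_trans (ki n); rewrite leq_max leqnn.
have two (x y : dlim D) : exists k (a b : A (si (s k))), x = dlim_in a /\ y = dlim_in b.
  have [i1 H1] := dlim_in_surj x; have [i2 H2] := dlim_in_surj y.
  have [|a xa] := H1 (si (s (maxn i1 i2))).
    by apply: leq_trans (ki _); rewrite leq_maxl.
  have [|b yb] := H2 (si (s (maxn i1 i2))).
    by apply: leq_trans (ki _); rewrite leq_maxr.
  by exists (maxn i1 i2), a, b.
exists f; split.
  split.
  - move=> c x y; have [k [a [b [-> ->]]]] := two x y.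
    have [pl _ _] := mphi k.
    by rewrite -dlim_in_linear !fE pl dlim_in_linear.
  - move=> x y; have [k [a [b [-> ->]]]] := two x y.
    have [_ pM _] := mphi k.
    by rewrite -dlim_inM !fE pM dlim_inM.
  - move=> x; have [k [a [_ [-> _]]]] := two x x.
    have [_ _ ps] := mphi k.
    by rewrite -dlim_in_star !fE ps dlim_in_star.
(* Injectivity comes from [psi] after [sphi] being a transition map, surjectivity from [sphi] after
   [psi] being one. *)
suff [inj surj] : injective f /\ forall y, exists x, f x = y.
  have [g gP] := choice surj.
  by exists g => // x; apply: inj; rewrite gP.
split.
  move=> x y; have [k [a [b [-> ->]]]] := two x y; rewrite !fE => /dlim_in_eq[m H].
  apply/dlim_in_eq; pose n := maxn m k; have nk : (k <= n)%N by rewrite leq_maxr.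
  have [lti ltj [psi [e1 e2]]] := sP n.
  have [h1 h2 h3] := step k n a nk; have [_ _ h3'] := step k n b nk.
  exists (si (s n.+1)) => q nq.
  have h1' := leq_trans h1 (ltnW lti).
  rewrite -(trans_comp _ h1' nq) -[in RHS](trans_comp _ h1' nq).
  congr trans; rewrite -!(trans_comp _ h1 (ltnW lti)) -!e1 h3 h3' H//.
  by apply: leq_trans (kj n); rewrite leq_maxl.
move=> y; have [j1 H] := dlim_in_surj y; have [b ->] := H (sj (s j1)) (kj _).
have [lti ltj [psi [e1 e2]]] := sP j1.
by exists (dlim_in (psi b)); rewrite fE e2 dlim_in_trans// ltnW.
Qed.

End Intertwining.

(** * Restriction of maps between limits to finite stages *)

Section FiniteStages.
Context (F : fieldType).

(** Finite dimensionality in the form needed for lifting: linear coordinates with respect to a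
    finite family. *)
Definition has_coords (A : invAlg F) : Prop :=
  exists (I : finType) (e : I -> A) (c : I -> A -> F),
    (forall i a x y, c i (a *: x + y) = a * c i x + c i y) /\
    forall x, x = \sum_i c i x *: e i.

Lemma canonAlg_coords X n : has_coords (canonAlg F X n).
Proof.
have M : has_coords (algO F n).
  exists ('I_n * 'I_n)%type, (fun p => delta_mx p.1 p.2), (fun p (x : 'M[F]_n) => x p.1 p.2).
  split=> [[i j] a x y|x] /=; first by rewrite !mxE.
  rewrite [LHS](matrix_sum_delta (x : 'M[F]_n)) pair_bigA /=; exact: eq_bigr.
case: X => //=.
exists (bool * ('I_n * 'I_n))%type,
  (fun p : bool * ('I_n * 'I_n) => if p.1 then (delta_mx p.2.1 p.2.2, 0) else (0, delta_mx p.2.1 p.2.2)),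
  (fun (p : bool * ('I_n * 'I_n)) (x : 'M[F]_n * 'M[F]_n) => if p.1 then x.1 p.2.1 p.2.2 else x.2 p.2.1 p.2.2).
split=> [[[] [i j]] a x y|[x y]] /=; rewrite ?mxE//.
rewrite -(pair_bigA _ (fun (b : bool) (p : 'I_n * 'I_n) =>
  (if b then x p.1 p.2 else y p.1 p.2) *:
  (if b then (delta_mx p.1 p.2, 0) else (0, delta_mx p.1 p.2)) :> 'M[F]_n * 'M[F]_n)) /=.
rewrite big_bool /=.
have -> : \sum_(p : 'I_n * 'I_n) x p.1 p.2 *: ((delta_mx p.1 p.2, 0) : 'M[F]_n * 'M[F]_n) = (x, 0).
  rewrite [x in RHS]matrix_sum_delta pair_bigA /=.
  apply: (big_rec2 (fun (u : 'M[F]_n * 'M[F]_n) v => u = (v, 0))) => // p u v _ ->.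
  by congr pair; rewrite /= scaler0 addr0.
have -> : \sum_(p : 'I_n * 'I_n) y p.1 p.2 *: ((0, delta_mx p.1 p.2) : 'M[F]_n * 'M[F]_n) = (0, y).
  rewrite [y in RHS]matrix_sum_delta pair_bigA /=.
  apply: (big_rec2 (fun (u : 'M[F]_n * 'M[F]_n) v => u = (0, v))) => // p u v _ ->.
  by congr pair; rewrite /= scaler0 addr0.
by congr pair; rewrite /= ?addr0 ?add0r.
Qed.

(** The images of the finitely many [e i] occur at a common stage, and linear extension gives [phi].
    Injectivity of [dlim_in] pulls the identities of [f] back to [phi]. *)
Lemma dirLim_lift (A : invAlg F) (D : dirSys F) (f : A -> dirLim D) :
  has_coords A -> (forall i, injective (ds_map (d := D) (i := i))) -> inv_morph f ->
  exists j0, forall j, (j0 <= j)%N -> exists phi : A -> ds_obj D j,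
    inv_morph phi /\ forall x, f x = dlim_in (phi x).
Proof.
move=> [I [e [c [cl eE]]]] inj [fl fM fs].
have [j0 j0P] := choice (fun i => dlim_in_surj (f (e i))).
exists (\max_i j0 i) => j j0j.
have [i|y yP] := choice (fun i => j0P i j _).
  by apply: leq_trans j0j; exact: leq_bigmax.
pose phi x := \sum_i c i x *: y i.
have fphi x : f x = dlim_in (phi x).
  rewrite {1}[x]eE (lin_sum fl) (lin_sum (@dlim_in_linear _ _ _)).
  by apply: eq_bigr => i _; rewrite (linZ fl) (linZ (@dlim_in_linear _ _ _)) yP.
exists phi; split=> //.
split=> [a x z|x z|x]; apply: (dlim_in_inj inj).
- by rewrite dlim_in_linear -!fphi fl.
- by rewrite dlim_inM -!fphi fM.
- by rewrite dlim_in_star -!fphi fs.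
Qed.

Lemma diagemb_inj n l r z (x x' u u' : 'M[F]_n) : (0 < l)%N ->
  diagemb l r z x u = diagemb l r z x' u' -> x = x'.
Proof.
case: l => // l _; rewrite /diagemb => /eq_block_mx[/eq_block_mx[/= + _ _ _] _ _ _].
by case/eq_block_mx.
Qed.

Lemma tl_gt0 T i : (0 < tl T i)%N.
Proof. by have := tr_le_tl T i; have := tlr_gt0 T i; lia. Qed.

Lemma stage_emb_inj T X i : injective (@stage_emb F T X i).
Proof.
have l0 := tl_gt0 T i.
rewrite /stage_emb /stage; case: X => /= [[x y] [x' y'] /= [h h']|x y|x y].
- by rewrite (diagemb_inj l0 h) (diagemb_inj l0 h').
- exact: diagemb_inj.
- exact: diagemb_inj.
Qed.

Lemma limAlg_lift T X T' X' (a : admissible T X) (a' : admissible T' X')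
    (f : limAlg F a -> limAlg F a') : inv_morph f -> forall i,
  exists j0, forall j, (j0 <= j)%N -> exists phi : stage F T X i -> stage F T' X' j,
    inv_morph phi /\
    forall x, f (dlim_in (D := limSys F a) (i := i) x) = dlim_in (D := limSys F a') (i := j) (phi x).
Proof.
move=> fm i.
apply: (@dirLim_lift (stage F T X i) (limSys F a') (f \o dlim_in (D := limSys F a) (i := i))).
- exact: canonAlg_coords.
- by move=> j; exact: stage_emb_inj.
- apply: inv_morph_comp fm; exact: (@dlim_in_morph F (limSys F a) i).
Qed.

Definition compat T X T' X' (a : admissible T X) (a' : admissible T' X')
    (f : limAlg F a -> limAlg F a') i j (phi : stage F T X i -> stage F T' X' j) : Prop :=
  inv_morph phi /\
  forall x, f (dlim_in (D := limSys F a) (i := i) x) = dlim_in (D := limSys F a') (i := j) (phi x).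

Lemma compat_comp T X T' X' (a : admissible T X) (a' : admissible T' X')
    (f : limAlg F a -> limAlg F a') (g : limAlg F a' -> limAlg F a) i j i'
    (phi : stage F T X i -> stage F T' X' j) (psi : stage F T' X' j -> stage F T X i') :
  cancel f g -> compat f phi -> compat g psi -> (i <= i')%N ->
  forall x, psi (phi x) = trans (D := limSys F a) (i := i) i' x.
Proof.
move=> fg [_ fphi] [_ gpsi] ii x; apply: (@dlim_in_inj _ (limSys F a)).
  by move=> k; exact: stage_emb_inj.
by rewrite dlim_in_trans// -gpsi -fphi fg.
Qed.

End FiniteStages.

(** * Multiplicities *)

Section Multiplicity.
Context (F : fieldType).

(** In type A the two ranks are added so that the exchange involution preserves the result. *)
Definition rk X n : canonAlg F X n -> nat :=
  match X return canonAlg F X n -> nat with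
  | typeA => fun x => (\rank x.1 + \rank x.2)%N
  | typeO => fun x => \rank x
  | typeS => fun x => \rank x
  end.

Definition full_rank X n : nat := if X is typeA then (2 * n)%N else n.

Definition has_mult X Y n N (phi : canonAlg F X n -> canonAlg F Y N) m : Prop :=
  forall x, imul x x = x -> rk (phi x) = (m * rk x)%N.

Lemma canonAlg_one X n : exists e : canonAlg F X n, imul e e = e /\ rk e = full_rank X n.
Proof.
case: X; [exists (1%:M, 1%:M)|exists 1%:M|exists 1%:M]; rewrite /= ?mxrank1.
- by rewrite /pair_mul !mulmx1; split=> //; lia.
- by rewrite mulmx1.
- by rewrite mulmx1.
Qed.

Lemma rk_leq X n (x : canonAlg F X n) : (rk x <= full_rank X n)%N.
Proof.
move: x; case: X => /= x; rewrite ?rank_leq_row//.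
by have := rank_leq_row x.1; have := rank_leq_row x.2; lia.
Qed.

Lemma has_mult_bound X Y n N (phi : canonAlg F X n -> canonAlg F Y N) m :
  has_mult phi m -> (m * full_rank X n <= full_rank Y N)%N.
Proof.
by have [e [ee er]] := canonAlg_one X n; move=> /(_ _ ee); rewrite er => <-; exact: rk_leq.
Qed.

Lemma full_rank_gt0 X n : (0 < n)%N -> (0 < full_rank X n)%N.
Proof. by case: X => /=; lia. Qed.

Lemma has_mult_inj X Y n N (phi psi : canonAlg F X n -> canonAlg F Y N) m m' :
  (0 < n)%N -> phi =1 psi -> has_mult phi m -> has_mult psi m' -> m = m'.
Proof.
move=> n0 e H H'; have [x [xx xr]] := canonAlg_one X n.
have := H _ xx; rewrite e H'// xr => /eqP.
by rewrite eqn_pmul2r ?full_rank_gt0// => /eqP.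
Qed.

Lemma has_mult_comp X Y Z n N K (phi : canonAlg F X n -> canonAlg F Y N)
    (psi : canonAlg F Y N -> canonAlg F Z K) m m' :
  inv_morph phi -> has_mult phi m -> has_mult psi m' ->
  has_mult (psi \o phi) (m * m')%N.
Proof.
move=> [_ pM _] H H' x xx; rewrite /= H'; last by rewrite -pM xx.
by rewrite H// mulnA [(m' * m)%N]mulnC.
Qed.

Lemma rk_star X n (x : canonAlg F X n) : rk (star x) = rk x.
Proof.
move: x; case: X => /= [[x y]|x|x] /=; rewrite ?mxrank_tr//; first by rewrite addnC.
rewrite /tau; case: ifPn => ne; rewrite ?mxrank_tr// mxrank_opp.
have JU : Jmx F n \in unitmx.
  by apply: (proj1 (mulmx1_unit (B := - Jmx F n) _)); rewrite mulmxN Jmx_sqr// opprK.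
by rewrite mxrankMfree ?row_free_unit// eqmxMfull ?row_full_unit// mxrank_tr.
Qed.

Lemma mx_hom_mult n N (h : 'M[F]_n -> 'M[F]_N) : (0 < n)%N -> mx_hom h ->
  exists m, forall x, x *m x = x -> \rank (h x) = (m * \rank x)%N.
Proof. by move=> n0 hh; eexists => x; exact: (mx_hom_rank (Ordinal n0) hh). Qed.

Lemma mult_BB X Y n N (phi : canonAlg F X n -> canonAlg F Y N) :
  (0 < n)%N -> X <> typeA -> Y <> typeA -> inv_morph phi -> exists m, has_mult phi m.
Proof.
move=> n0; move: phi; case: X => // phi _; move: phi; case: Y => // phi _ [pl pM _];
  exact: (@mx_hom_mult n N phi n0 (conj pl pM)).
Qed.

(** The involution sends [(x, 0)] to [(0, x^T)] and preserves [rk], so both summands have the same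
    multiplicity. *)
Lemma mult_AB Y n N (phi : canonAlg F typeA n -> canonAlg F Y N) :
  (0 < n)%N -> Y <> typeA -> inv_morph phi -> exists m, has_mult phi m.
Proof.
move=> n0 YA [pl pM ps].
have ranks (x : 'M[F]_n) : rk (phi (0, x^T)) = rk (phi (x, 0)).
  by rewrite -rk_star -ps /= /pair_star /= trmxK trmx0.
have [m mP] : exists m, forall x : 'M[F]_n, x *m x = x -> rk (phi (x, 0)) = (m * \rank x)%N.
  move: phi YA pl pM ps {ranks}; case: Y => // phi _ pl pM _;
    apply: (@mx_hom_mult n N (fun x => phi (x, 0)) n0); split=> [a x y|x y].
  - by rewrite -pl; congr phi; congr pair; rewrite /= ?scaler0 ?addr0.
  - by rewrite -[RHS]pM /= /pair_mul /= mulmx0.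
  - by rewrite -pl; congr phi; congr pair; rewrite /= ?scaler0 ?addr0.
  - by rewrite -[RHS]pM /= /pair_mul /= mulmx0.
exists m => -[x y] [xx yy].
have mP' : rk (phi (0, y)) = (m * \rank y)%N.
  by rewrite -[y]trmxK ranks mP ?mxrank_tr// -trmx_mul yy.
have -> : rk (phi (x, y)) = (rk (phi (x, 0%R)) + rk (phi (0%R, y)))%N.
  have idem u : imul u u = u -> imul (phi u) (phi u) = phi u by move=> uu; rewrite -pM uu.
  have xI : imul (phi (x, 0)) (phi (x, 0)) = phi (x, 0).
    by apply: idem; congr pair; rewrite /= ?mulmx0.
  have yI : imul (phi (0, y)) (phi (0, y)) = phi (0, y).
    by apply: idem; congr pair; rewrite /= ?mulmx0.
  have pD : phi (x, y) = phi (x, 0) + phi (0, y).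
    by rewrite -(linD pl); congr phi; congr pair; rewrite /= ?addr0 ?add0r.
  have p1 : imul (phi (x, 0)) (phi (0, y)) = 0.
    by rewrite -pM -(lin0 pl); congr phi; congr pair; rewrite /= ?mulmx0 ?mul0mx.
  have p2 : imul (phi (0, y)) (phi (x, 0)) = 0.
    by rewrite -pM -(lin0 pl); congr phi; congr pair; rewrite /= ?mulmx0 ?mul0mx.
  rewrite pD; move: phi xI yI p1 p2 {pD pl pM ps ranks mP mP' idem} YA.
  by case: Y => // phi xI yI p1 p2 _; exact: mxrank_idemD.
by rewrite mP// mP' mulnDr.
Qed.

(** The second component at [x] is the transpose of the first at [star x], so both have multiplicity
    [m]. The resulting even total is the source of the factors 2. *)
Lemma mult_BA X n N (psi : canonAlg F X n -> canonAlg F typeA N) :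
  (0 < n)%N -> X <> typeA -> inv_morph psi -> exists m,
    (forall x, imul x x = x -> \rank (psi x).1 = (m * rk x)%N /\ \rank (psi x).2 = (m * rk x)%N) /\
    has_mult psi (m * 2)%N.
Proof.
move=> n0 XA [pl pM ps].
have [m mP] : exists m, forall x, imul x x = x -> \rank (psi x).1 = (m * rk x)%N.
  move: psi XA pl pM ps; case: X => // psi _ pl pM _;
    apply: (@mx_hom_mult n N (fun x => (psi x).1) n0); split=> [a x y|x y].
  - by rewrite pl.
  - by rewrite [psi _]pM.
  - by rewrite pl.
  - by rewrite [psi _]pM.
have mP' x : imul x x = x -> \rank (psi x).2 = (m * rk x)%N.
  move=> xx; have := mP (star x); rewrite -starM xx => /(_ erefl).
  by rewrite ps rk_star /= mxrank_tr.
exists m; split=> [x xx|x xx]; first by rewrite mP ?mP'.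
by rewrite /= mP ?mP'// muln2 -addnn mulnDl.
Qed.

Lemma rank_diagrep n l (x : 'M[F]_n) : \rank (diagrep l x) = (l * \rank x)%N.
Proof.
elim: l => [|l IH] /=; first by rewrite mxrank0.
by rewrite rank_diag_block_mx IH mulSn.
Qed.

Lemma rank_diagemb n l r z (x y : 'M[F]_n) :
  \rank (diagemb l r z x y) = (l * \rank x + r * \rank y)%N.
Proof. by rewrite /diagemb !rank_diag_block_mx !rank_diagrep mxrank0 addn0. Qed.

Definition sum_prod (T : tripleSeq) i : nat := (\prod_(j < i) tsum T j)%N.

Lemma sum_prodS T i : sum_prod T i.+1 = (sum_prod T i * tsum T i)%N.
Proof. by rewrite /sum_prod big_ord_recr. Qed.

Lemma tsum_gt0 T i : (0 < tsum T i)%N. Proof. exact: tlr_gt0. Qed.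

Lemma sum_prod_gt0 T i : (0 < sum_prod T i)%N.
Proof. by elim: i => [|i IH]; rewrite ?sum_prodS ?muln_gt0 ?IH ?tsum_gt0// /sum_prod big_ord0. Qed.

Lemma degree_gt0 T i : (0 < degree T i)%N.
Proof. by elim: i => // i IH; rewrite degreeS addn_gt0 muln_gt0 tsum_gt0 IH. Qed.

(** In type A [l] and [r] change places between the components, so the sum of the ranks is still
    multiplied by [l + r]. *)
Lemma trans_mult T X (a : admissible T X) i j : (i <= j)%N ->
  exists m, (m * sum_prod T i = sum_prod T j)%N /\
    has_mult (trans (D := limSys F a) (i := i) j : stage F T X i -> stage F T X j) m.
Proof.
move=> /subnK <-; elim: (j - i)%N => [|k [m [mE mP]]].
  by exists 1%N; rewrite mul1n; split=> // x xx; rewrite trans_id mul1n.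
exists (m * tsum T (k + i))%N; split; first by rewrite addSn sum_prodS -mE; lia.
move=> x xx; rewrite addSn transS ?leq_addl//.
rewrite -mulnA [(tsum _ _ * _)%N]mulnC mulnA -(mP _ xx).
move: (trans _ _) => y /=; rewrite /stage_emb /stage.
by case: X a {mP xx x} y => /= _ y; rewrite ?rank_diagemb /tsum; ring.
Qed.

End Multiplicity.

(** * Parity of multiplicities and asymmetry of ranks *)

Section Parity.
Context (F : fieldType).

(** A full rank factorization writes [A] as [R^T *m B *m R] with [B] invertible and skew of size
    [\rank A]; in odd size [\det B = - \det B] would force a zero determinant. *)
Lemma skew_rank N (A : 'M[F]_N) : (2%:R : F) != 0 -> A^T = - A -> ~~ odd (\rank A).
Proof.
move=> char2 skew; move: (row_base_free A) (col_base_full A) (mulmx_base A).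
move: (col_base A) (row_base A); set r := \rank A => C R Rfree Cfull CR.
have [R' RR'] := row_freeP Rfree; have [C' CC'] := row_fullP Cfull.
(* Solves [C = R^T *m B], since [C = A *m R'] and [A = - R^T *m C^T]. *)
pose B := - (C^T *m R').
have CE : C = R^T *m B.
  rewrite /B mulmxN mulmxA -trmx_mul CR skew mulNmx opprK -CR.
  by rewrite -mulmxA RR' mulmx1.
have BU : B \in unitmx.
  apply: (proj2 (mulmx1_unit (A := C' *m R^T) _)).
  by rewrite -mulmxA -CE CC'.
have RR'T : R'^T *m R^T = 1%:M by rewrite -trmx_mul RR' trmx1.
have AE : A = R^T *m B *m R by rewrite -CE CR.
have h : R'^T *m A *m R' = B.
  by rewrite {1}AE !mulmxA RR'T mul1mx -mulmxA RR' mulmx1.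
have BT : B^T = - B.
  by rewrite -[in LHS]h !trmx_mul trmxK skew mulmxA mulmxN mulNmx h.
apply/negP => r_odd; move: BU; rewrite unitmxE unitfE => /negP; apply.
have := det_tr B; rewrite BT -scaleN1r detZ -signr_odd -/r r_odd expr1 mulN1r.
move/eqP; rewrite eq_sym -subr_eq0 opprK -mulr2n -mulr_natl mulf_eq0.
by rewrite (negbTE char2).
Qed.

Lemma Jmx_delta n (i j : 'I_n) :
  Jmx F n *m delta_mx i j *m Jmx F n = \matrix_(a, b) (Jmx F n a i * Jmx F n j b).
Proof.
rewrite -(mul_delta_mx (0 : 'I_1)) !mulmxA -colE -mulmxA -rowE.
by apply/matrixP => a b; rewrite !mxE big_ord1 !mxE.
Qed.

Lemma tau_delta01 n (i0 i1 : 'I_n) : ~~ odd n -> i0 = 0%N :> nat -> i1 = 1%N :> nat ->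
  tau (delta_mx i0 i1 : 'M[F]_n) = - delta_mx i0 i1.
Proof.
move=> ne e0 e1; rewrite /tau (negbTE ne) trmx_delta Jmx_delta; congr (- _).
apply/matrixP => a b; rewrite mxE [in RHS]mxE -!val_eqE /= e0 e1.
have -> : Jmx F n a i1 = (a == 0%N :> nat)%:R.
  rewrite mxE e1; case: ifP => h1; first by rewrite (_ : (a == 0 :> nat)%N)//; lia.
  case: ifP => h2; first by exfalso; lia.
  by rewrite (_ : (a == 0 :> nat)%N = false)//; lia.
have -> : Jmx F n i0 b = (b == 1%N :> nat)%:R.
  by rewrite mxE e0 /=; case: eqP.
by rewrite -natrM mulnb.
Qed.

(** The matrix unit at position [(0, 1)] is skew for [tau], so its image is a skew-symmetric matrix
    of rank [m]. *)
Lemma mult_SO_even n N (phi : canonAlg F typeS n -> canonAlg F typeO N) m :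
  (2%:R : F) != 0 -> (0 < n)%N -> ~~ odd n -> inv_morph phi -> has_mult phi m -> ~~ odd m.
Proof.
move=> char2 n0 ne [pl pM ps] pm; have n1 : (1 < n)%N by case: n n0 ne {phi pl pM ps pm} => [|[]].
pose i0 : 'I_n := Ordinal n0; pose i1 : 'I_n := Ordinal n1.
have <- : \rank (phi (delta_mx i0 i1) : 'M[F]_N) = m.
  have e00 : \rank (phi (delta_mx i0 i0) : 'M[F]_N) = m.
    by have := pm (delta_mx i0 i0); rewrite /= mul_delta_mx mxrank_delta muln1 => ->.
  (* The matrix units at [(0, 1)] and [(0, 0)] are multiples of each other, so their images have the
     same rank. *)
  rewrite -e00; apply/eqP; rewrite eqn_leq; apply/andP; split.
    by rewrite -(mul_delta_mx i0 i0 i1) [phi _]pM mxrankM_maxl.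
  by rewrite -[in X in (X <= _)%N](mul_delta_mx i1 i0 i0) [phi _]pM mxrankM_maxl.
apply: skew_rank => //.
by have := ps (delta_mx i0 i1); rewrite /= tau_delta01// (linN pl) => <-.
Qed.

(** The image [p] of a diagonal matrix unit is fixed by [tau], which says that [p *m Jmx F N] is
    skew-symmetric; the factor [Jmx F N] is invertible. *)
Lemma mult_OS_even n N (phi : canonAlg F typeO n -> canonAlg F typeS N) m :
  (2%:R : F) != 0 -> (0 < n)%N -> ~~ odd N -> inv_morph phi -> has_mult phi m -> ~~ odd m.
Proof.
move=> char2 n0 Ne [pl pM ps] pm; pose i0 : 'I_n := Ordinal n0.
have e00 : \rank (phi (delta_mx i0 i0) : 'M[F]_N) = m.
  by have := pm (delta_mx i0 i0); rewrite /= mul_delta_mx mxrank_delta muln1 => ->.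
rewrite -e00; have := ps (delta_mx i0 i0); rewrite /= trmx_delta /tau (negbTE Ne).
have JU : Jmx F N \in unitmx.
  by apply: (proj1 (mulmx1_unit (B := - Jmx F N) _)); rewrite mulmxN Jmx_sqr// opprK.
have skew (p : 'M[F]_N) : p = - (Jmx F N *m p^T *m Jmx F N) -> ~~ odd (\rank p).
  move=> pE; rewrite -(mxrankMfree p (B := Jmx F N)) ?row_free_unit//.
  apply: skew_rank => //; rewrite trmx_mul Jmx_tr mulNmx; congr (- _).
  by rewrite [in RHS]pE mulNmx -[_ *m Jmx F N *m Jmx F N]mulmxA Jmx_sqr// mulmxN mulmx1 opprK.
exact: skew.
Qed.

(** The expansion of [(l - r) * (b - a) > 0]. *)
Lemma cross_lt l r a b : (r <= l)%N -> l <> r -> (a < b)%N ->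
  (l * a + r * b < l * b + r * a)%N.
Proof.
move=> rl lr ab; have [d ->] : exists d, b = (a + d.+1)%N by exists (b - a).-1; lia.
have [e ->] : exists e, l = (r + e.+1)%N by exists (l - r).-1; lia.
by rewrite !mulnDl !mulnDr; have : (0 < e.+1 * d.+1)%N by []; lia.
Qed.

(* Unless some [tl k = tr k] intervenes, transition maps preserve the strict
   inequality between the ranks of the two components. *)
Lemma trans_symmetric T (a : admissible T typeA) i j (x : stage F T typeA i) :
  (i <= j)%N -> (\rank x.2 < \rank x.1)%N ->
  (\rank (trans (D := limSys F a) (i := i) j x : stage F T typeA j).1 <=
   \rank (trans (D := limSys F a) (i := i) j x : stage F T typeA j).2)%N ->
  exists k, (i <= k)%N /\ tl T k = tr T k.
Proof.
move=> ij lt ge; apply: contrapT => none.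
suff: forall j, (i <= j)%N -> (\rank (trans (D := limSys F a) (i := i) j x : stage F T typeA j).2 <
    \rank (trans (D := limSys F a) (i := i) j x : stage F T typeA j).1)%N.
  by move=> /(_ _ ij); rewrite ltnNge ge.
move=> {}j {}ij {ge}; move: ij => /subnK <-; elim: (j - i)%N => [|k IH].
  by rewrite !trans_id.
rewrite addSn transS ?leq_addl//; move: IH; move: (trans _ _) => y /= IH.
rewrite !rank_diagemb.
have le := tr_le_tl T (k + i).
have ne : tl T (k + i) <> tr T (k + i).
  by move=> e; apply: none; exists (k + i)%N; rewrite leq_addl.
exact: cross_lt.
Qed.

End Parity.

(** * Density and supernatural numbers *)

Section Density.
Context (R : realType) (T : tripleSeq).
Local Notation d := (density_seq R T).

Lemma density_seqE i : d i = (sum_prod T i)%:R / (degree T i)%:R.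
Proof. by []. Qed.

Lemma density_seq_gt0 i : 0 < d i.
Proof. by rewrite divr_gt0// ltr0n ?sum_prod_gt0 ?degree_gt0. Qed.

Lemma density_seq_noninc : {homo d : i j / (i <= j)%N >-> j <= i}.
Proof.
apply: homo_leq => [x|y x z xy yz|i]; first exact: lexx.
  exact: le_trans yz xy.
rewrite !density_seqE ler_pdivrMr ?ltr0n ?degree_gt0//.
rewrite mulrAC ler_pdivlMr ?ltr0n ?degree_gt0// -!natrM ler_nat.
rewrite degreeS sum_prodS; have := sum_prod_gt0 T i; nia.
Qed.

Lemma density_seq_cvg : cvgn d.
Proof.
apply: nonincreasing_is_cvgn; first exact: density_seq_noninc.
by exists 0 => _ [i _ <-]; exact: ltW (density_seq_gt0 i).
Qed.

Lemma density_le i : density R T <= d i.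
Proof. exact: (nonincreasing_cvgn_ge density_seq_noninc density_seq_cvg). Qed.

Lemma density_ge x : (forall i, x <= d i) -> x <= density R T.
Proof.
by move=> H; apply: limr_ge; [exact: density_seq_cvg|apply: nearW].
Qed.

Lemma density_lt x : density R T < x -> exists i, d i < x.
Proof.
move=> lt; apply: contrapT => none; move: lt; rewrite ltNge => /negP; apply.
by apply: density_ge => i; rewrite leNgt; apply/negP => ix; apply: none; exists i.
Qed.

Lemma density_ge0 : 0 <= density R T.
Proof. by apply: density_ge => i; exact: ltW (density_seq_gt0 i). Qed.

Lemma density_cases : [\/ sparse R T, dense_type R T | pure_type R T].
Proof.
have := density_ge0; rewrite le_eqVlt => /orP[/eqP e|pos]; first exact: Or31.
have [[i e]|none] := pselect (exists i, d i = density R T).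
  by apply: Or33; split=> //; exists i.
apply: Or32; split=> // i; rewrite lt_neqAle density_le andbT eq_sym.
by apply/negP => /eqP e; apply: none; exists i.
Qed.

End Density.

Lemma sum_prod_dvd T i j : (i <= j)%N -> (sum_prod T i %| sum_prod T j)%N.
Proof.
move=> /subnK <-; elim: (j - i)%N => [|k IH]; first by rewrite add0n.
by rewrite addSn sum_prodS; exact: dvdn_mulr.
Qed.

(** Partial exponents are nondecreasing, so a finite exponent is their maximum and is attained. This
    form replaces the [xget] of the definition from here on. *)
Lemma sn_prodP T (p : {p : nat | prime p}) :
  match sn_prod (tsum T) p with
  | Some v => (forall k, (logn (sval p) (sum_prod T k) <= v)%N) /\
              exists k, logn (sval p) (sum_prod T k) = v
  | None => forall m, exists k, (m < logn (sval p) (sum_prod T k))%N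
  end.
Proof.
have uE k : (\sum_(i < k) logn (sval p) (tsum T i))%N = logn (sval p) (sum_prod T k).
  elim: k => [|k IH]; first by rewrite /sum_prod !big_ord0 logn1.
  by rewrite big_ord_recr /= IH sum_prodS lognM ?sum_prod_gt0 ?tsum_gt0.
have mono i j : (i <= j)%N -> (logn (sval p) (sum_prod T i) <= logn (sval p) (sum_prod T j))%N.
  by move=> ij; apply: dvdn_leq_log; [exact: sum_prod_gt0|exact: sum_prod_dvd].
rewrite /sn_prod; case: asboolP => [[m mP]|unb].
  have [v vP] : exists v, exists N, forall k, (N <= k)%N ->
      (\sum_(i < k) logn (sval p) (tsum T i))%N = v.
    have ex : exists v, `[< exists k, logn (sval p) (sum_prod T k) = v >].
      by exists (logn (sval p) (sum_prod T 0)); apply/asboolP; exists 0%N.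
    have ub v : `[< exists k, logn (sval p) (sum_prod T k) = v >] -> (v <= m)%N.
      by move=> /asboolP[k <-]; rewrite -uE.
    case: (ex_maxnP ex ub) => v /asboolP[N NP] vmax; exists v, N => k Nk.
    rewrite uE; apply/eqP; rewrite eqn_leq -{2}NP mono// andbT.
    by apply: vmax; apply/asboolP; exists k.
  case: xgetP => [w _ [N NP]|/(_ v)]; last by case.
  split=> [k|]; last by exists N; rewrite -uE NP.
  by rewrite -(NP (maxn k N)) ?leq_maxr// uE mono// leq_maxl.
move=> m; apply: contrapT => none; apply: unb; exists m => k; rewrite uE leqNgt.
by apply/negP => mk; apply: none; exists k.
Qed.

Lemma dvdn_leq_logn a b : (0 < a)%N -> (0 < b)%N ->
  (forall p, prime p -> (logn p a <= logn p b)%N) -> (a %| b)%N.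
Proof.
move=> a0 b0 H; apply/dvdn_partP => // p; rewrite mem_primes => /and3P[pp _ _].
by rewrite p_part pfactor_dvdn// H.
Qed.

(** Each [n * sum_prod T i] has finitely many prime factors, so one [j] serves for all of them.
    Conversely, mutual divisibility bounds the exponent of every prime on both sides. *)
Lemma sn_eqP T T' n m : (0 < n)%N -> (0 < m)%N ->
  sn_mul (sn_nat n) (sn_prod (tsum T)) = sn_mul (sn_nat m) (sn_prod (tsum T')) <->
  (forall i, exists j, n * sum_prod T i %| m * sum_prod T' j)%N /\
  (forall j, exists i, m * sum_prod T' j %| n * sum_prod T i)%N.
Proof.
have half S S' a b : (0 < a)%N -> (0 < b)%N ->
    sn_mul (sn_nat a) (sn_prod (tsum S)) = sn_mul (sn_nat b) (sn_prod (tsum S')) ->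
    (forall i, exists j, a * sum_prod S i %| b * sum_prod S' j)%N.
  move=> a0 b0 e i.
  have ex (p : {p : nat | prime p}) : exists j,
      (logn (sval p) (a * sum_prod S i) <= logn (sval p) (b * sum_prod S' j))%N.
    have /(congr1 (fun P : supernat => P p)) := e; rewrite /sn_mul /sn_nat.
    have := sn_prodP S p; have := sn_prodP S' p.
    case: (sn_prod (tsum S') p) => [v'|]; case: (sn_prod (tsum S) p) => [v|] //=.
      move=> [H' [j jP]] [H _] [vv]; exists j.
      by rewrite !lognM ?sum_prod_gt0// jP -vv leq_add2l.
    move=> H' _ _; have [j jP] := H' (logn (sval p) (a * sum_prod S i)).
    by exists j; rewrite (lognM _ b0) ?sum_prod_gt0//; lia.
  have [jf jP] := choice ex.
  (* The default 0 at non-primes is harmless: the maximum is taken over [primes]. *)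
  pose js (q : nat) := if insub q is Some p then jf p else 0%N.
  exists (\max_(q <- primes (a * sum_prod S i)) js q).
  apply: dvdn_leq_logn; rewrite ?muln_gt0 ?a0 ?b0 ?sum_prod_gt0// => q qp.
  have [qin|qnin] := boolP (q \in primes (a * sum_prod S i)); last first.
    by move: qnin; rewrite -logn_gt0 lt0n negbK => /eqP->.
  have := jP (exist _ q qp); move=> /= le; apply: leq_trans le _.
  apply: dvdn_leq_log; first by rewrite muln_gt0 b0 sum_prod_gt0.
  apply: dvdn_mul => //; apply: sum_prod_dvd.
  have -> : jf (exist _ q qp) = js q.
    by rewrite /js insubT.
  exact: leq_bigmax_seq.
move=> n0 m0; split=> [e|[H H']].
  by split; [exact: half e|exact: half (esym e)].
apply: funext => p; rewrite /sn_mul /sn_nat.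
have le S S' a b : (0 < a)%N -> (0 < b)%N ->
    (forall i, exists j, a * sum_prod S i %| b * sum_prod S' j)%N ->
    forall i, exists j, (logn (sval p) a + logn (sval p) (sum_prod S i) <=
                         logn (sval p) b + logn (sval p) (sum_prod S' j))%N.
  move=> a0 b0 K i; have [j ij] := K i; exists j.
  rewrite -!lognM ?sum_prod_gt0//; apply: dvdn_leq_log => //.
  by rewrite muln_gt0 b0 sum_prod_gt0.
have {}H := le _ _ _ _ n0 m0 H; have {}H' := le _ _ _ _ m0 n0 H'.
have := sn_prodP T p; have := sn_prodP T' p.
case: (sn_prod (tsum T') p) => [v'|]; case: (sn_prod (tsum T) p) => [v|] //=.
- move=> [K' [k' kP']] [K [k kP]]; congr Some; apply/eqP; rewrite eqn_leq.
  have [j] := H k; have := K' j; rewrite kP.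
  by have [i] := H' k'; have := K i; rewrite kP'; lia.
- move=> [K' _] K; have [k kP] := K (logn (sval p) m + v')%N.
  by have [j] := H k; have := K' j; lia.
- move=> K' [K _]; have [k kP] := K' (logn (sval p) n + v)%N.
  by have [j] := H' k; have := K j; lia.
Qed.

Lemma two_infty_dvdP T : sn_dvd sn_two_infty (sn_prod (tsum T)) <->
  forall j, exists i, (j <= i)%N /\ (2 * sum_prod T j %| sum_prod T i)%N.
Proof.
have p2 : prime 2 by [].
split=> [/(_ (exist _ 2%N p2)) /= dv j|H].
  have := sn_prodP T (exist _ 2%N p2); move: dv; rewrite /sn_two_infty /=.
  case: (sn_prod _ _) => //= _ unb.
  have [i iP] := unb (logn 2 (sum_prod T j)).
  exists (maxn j i); rewrite leq_maxl; split=> //.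
  have /dvdnP[c cE] : (sum_prod T j %| sum_prod T (maxn j i))%N.
    by apply: sum_prod_dvd; rewrite leq_maxl.
  rewrite cE dvdn_pmul2r ?sum_prod_gt0//.
  have c0 : (0 < c)%N by have := sum_prod_gt0 T (maxn j i); rewrite cE muln_gt0 => /andP[].
  rewrite (@pfactor_dvdn 2 1)//.
  have : (logn 2 (sum_prod T i) <= logn 2 (sum_prod T (maxn j i)))%N.
    by apply: dvdn_leq_log; rewrite ?sum_prod_gt0// sum_prod_dvd// leq_maxr.
  by rewrite cE lognM ?sum_prod_gt0//; lia.
move=> p; rewrite /sn_two_infty; case: eqP => [p2'|_]; last by case: (sn_prod _ _).
have := sn_prodP T p; case: (sn_prod _ _) => // v [ub [k kE]].
have [i [_ iP]] := H k.
have := dvdn_leq_log 2 (sum_prod_gt0 T i) iP; have p2E : sval p = 2%N := p2'.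
rewrite lognM ?sum_prod_gt0// logn_prime// eqxx.
by have := ub i; rewrite -kE p2E; lia.
Qed.

(* [linked T T' n m] says that [n / m] times the invariants of [T] are those of
   [T'], in a form that refers to finite stages only. *)
Definition half_linked (T T' : tripleSeq) (n m : nat) : Prop :=
  forall i, exists j0, forall j, (j0 <= j)%N ->
    (m * sum_prod T' j * degree T i <= n * sum_prod T i * degree T' j)%N /\
    (n * sum_prod T i %| m * sum_prod T' j)%N.

Definition linked (T T' : tripleSeq) (n m : nat) : Prop :=
  [/\ (0 < n)%N, (0 < m)%N, half_linked T T' n m & half_linked T' T m n].

Section Linked.
Context (R : realType).
Implicit Types T : tripleSeq.

Lemma leq_density T T' n m i j : (0 < n)%N ->
  (m * sum_prod T' j * degree T i <= n * sum_prod T i * degree T' j)%N =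
  (m%:R / n%:R * density_seq R T' j <= density_seq R T i).
Proof.
move=> n0; rewrite !density_seqE ler_pdivlMr ?ltr0n ?degree_gt0//.
rewrite !mulrA -[X in X <= _]mulrA mulrAC -!mulrA [_^-1 * _]mulrC mulrA.
rewrite -[X in _ = (X <= _)](_ : (m * sum_prod T' j * degree T i)%:R / (n * degree T' j)%:R = _).
  rewrite ler_pdivrMr ?ltr0n ?muln_gt0 ?n0 ?degree_gt0//.
  by rewrite -natrM ler_nat mulnA [(sum_prod T i * n)%N]mulnC.
rewrite !natrM invfM; ring.
Qed.

(** Both relations persist for larger [j]: the density sequence decreases and the partial products
    divide one another. *)
Lemma half_linkedP T T' n m : (0 < n)%N -> (0 < m)%N ->
  (forall i, exists j, m%:R / n%:R * density_seq R T' j <= density_seq R T i) ->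
  (forall i, exists j, n * sum_prod T i %| m * sum_prod T' j)%N ->
  half_linked T T' n m.
Proof.
move=> n0 m0 H1 H2 i; have [j1 h1] := H1 i; have [j2 h2] := H2 i.
exists (maxn j1 j2) => j; rewrite geq_max => /andP[j1j j2j]; split.
  rewrite leq_density//; apply: le_trans h1; rewrite ler_wpM2l//.
  exact: density_seq_noninc.
by apply: dvdn_trans h2 _; rewrite dvdn_mul// sum_prod_dvd.
Qed.

Lemma half_linked_density T T' n m : (0 < n)%N -> half_linked T T' n m ->
  m%:R / n%:R * density R T' <= density R T.
Proof.
move=> n0 H; apply: density_ge => i; have [j /(_ j (leqnn j))[le _]] := H i.
rewrite leq_density// in le; apply: le_trans le; rewrite ler_wpM2l//.
exact: density_le.
Qed.

Lemma linked_density T T' n m : linked T T' n m ->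
  density R T = m%:R / n%:R * density R T'.
Proof.
move=> [n0 m0 H H']; apply/eqP; rewrite eq_le half_linked_density// andbT.
rewrite [X in X <= _](_ : _ = m%:R / n%:R * (n%:R / m%:R * density R T)).
  by rewrite ler_wpM2l// half_linked_density.
by field; rewrite !pnatr_eq0 -!lt0n n0 m0.
Qed.

(** The densities differ by the factor [m / n]. Comparison at finite stages then transfers whether
    the limit is attained, which separates dense from pure. *)
Lemma linked_conds T T' n m : linked T T' n m ->
  [/\ condA1 R T T', condA2 T T' & condA3 R T T'].
Proof.
move=> L; have dE := linked_density L; have [n0 m0 H H'] := L.
have q0 : 0 < (m%:R / n%:R : R) by rewrite divr_gt0// ltr0n.
have sn : sn_scaled (m%:R / n%:R) (sn_prod (tsum T)) (sn_prod (tsum T')).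
  exists n, m; split=> //.
    by rewrite mulrC divfK// pnatr_eq0 -lt0n.
  apply/sn_eqP => //; split=> i.
    by have [j /(_ j (leqnn j))[_ dv]] := H i; exists j.
  by have [j /(_ j (leqnn j))[_ dv]] := H' i; exists j.
split.
- have pos : (0 < density R T) = (0 < density R T') by rewrite dE pmulr_rgt0.
  case: (density_cases R T) => [s|[p dn]|[p [i iE]]].
  + apply: Or31; split=> //; move/eqP: s; rewrite dE mulf_eq0 => /orP[|/eqP//].
    by rewrite gt_eqF.
  + apply: Or32; split=> //; split; first by rewrite -pos.
    move=> j; have [i /(_ i (leqnn i))[le _]] := H' j.
    have : density R T < m%:R / n%:R * density_seq R T' j.
      apply: lt_le_trans (dn i) _; rewrite leq_density// in le.
      rewrite [X in X <= _](_ : _ = m%:R / n%:R * (n%:R / m%:R * density_seq R T i)).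
        by rewrite ler_wpM2l.
      by field; rewrite !pnatr_eq0 -!lt0n n0 m0.
    by rewrite dE ltr_pM2l.
  + apply: Or33; split; split=> //; first by exists i.
      by rewrite -pos.
    have [j /(_ j (leqnn j))[le _]] := H i; exists j.
    rewrite leq_density// iE dE ler_pM2l// in le.
    by apply/eqP; rewrite eq_le le density_le.
- exists (m%:R / n%:R); split=> //.
  by rewrite mulf_neq0// ?invr_eq0 pnatr_eq0 -lt0n.
- move=> _ pd; have p' : 0 < density R T' by case: pd => -[].
  exists (m%:R / n%:R); split=> //.
  by rewrite dE mulfK ?gt_eqF// fmorph_div /= !ratr_nat.
Qed.

(** A strict inequality against the limit holds already at a finite stage. This settles the sparse
    and dense cases; in the pure case the limit itself is a term of the sequence. *)
Lemma conds_linked T T' : condA1 R T T' -> condA2 T T' -> condA3 R T T' ->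
  exists n m, linked T T' n m.
Proof.
have quo (S S' : tripleSeq) n m i : (0 < n)%N ->
    (m%:R / n%:R * density R S' < density_seq R S i) ->
    (0 < m)%N ->
    exists j, m%:R / n%:R * density_seq R S' j <= density_seq R S i.
  move=> n0 lt m0; have q0 : 0 < (m%:R / n%:R : R) by rewrite divr_gt0// ltr0n.
  have [|j jP] := @density_lt R S' (density_seq R S i / (m%:R / n%:R)).
    by rewrite ltr_pdivlMr// mulrC.
  by exists j; rewrite mulrC -ler_pdivlMr// ltW.
have fin n m : (0 < n)%N -> (0 < m)%N ->
   sn_mul (sn_nat n) (sn_prod (tsum T)) = sn_mul (sn_nat m) (sn_prod (tsum T')) ->
   (forall i, exists j, m%:R / n%:R * density_seq R T' j <= density_seq R T i) ->
   (forall j, exists i, n%:R / m%:R * density_seq R T i <= density_seq R T' j) ->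
   exists n m, linked T T' n m.
  move=> n0 m0 /sn_eqP[]// e1 e2 H H'.
  by exists n, m; split=> //; apply: half_linkedP.
move=> A1 A2 A3.
have scaled : dense_type R T /\ dense_type R T' \/ pure_type R T /\ pure_type R T' ->
    exists n m, [/\ (0 < n)%N, (0 < m)%N,
      sn_mul (sn_nat n) (sn_prod (tsum T)) = sn_mul (sn_nat m) (sn_prod (tsum T')),
      m%:R / n%:R * density R T' = density R T & n%:R / m%:R * density R T = density R T'].
  move=> h; have [||q [qE [n [m [n0 m0 nq e]]]]] := A3.
  - by case: h => -[]; [left|right].
  - by case: h => -[]; [left|right].
  have d0 : 0 < density R T by case: h => -[[]].
  have d0' : 0 < density R T' by case: h => -[_ []].
  have qR : ratr q = m%:R / n%:R :> R.
    have -> : q = m%:R / n%:R by rewrite -nq mulrC mulKf// pnatr_eq0 -lt0n.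
    by rewrite fmorph_div /= !ratr_nat.
  have dE : m%:R / n%:R * density R T' = density R T.
    by rewrite -qR -qE divfK// gt_eqF.
  exists n, m; split=> //; rewrite -dE.
  by field; rewrite !pnatr_eq0 -!lt0n n0 m0.
case: A1 => [[s s']|[d d']|[p p']].
(* With both densities zero every positive constant satisfies the inequalities, so the one from A2
   can be taken. *)
- have [q [q0 [n [m [n0 m0 nq e]]]]] := A2; apply: (fin n m) => // i; apply: quo => //.
    by rewrite [density R T']s' mulr0 density_seq_gt0.
  by rewrite [density R T]s mulr0 density_seq_gt0.
- have [|n [m [n0 m0 e d1 d2]]] := scaled; first by left.
  apply: (fin n m) => // i; apply: quo => //.
    by rewrite d1; case: d.
  by rewrite d2; case: d'.
- have [|n [m [n0 m0 e d1 d2]]] := scaled; first by right.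
  apply: (fin n m) => // i.
    by case: p' => _ [j jE]; exists j; rewrite jE d1 density_le.
  by case: p => _ [j jE]; exists j; rewrite jE d2 density_le.
Qed.

End Linked.

(** * Necessity of the conditions *)

Section IsoInvariants.
Context (F : fieldType) (T T' : tripleSeq) (X X' : invType).
Context (a : admissible T X) (a' : admissible T' X').
Context (f : limAlg F a -> limAlg F a') (g : limAlg F a' -> limAlg F a).
Hypothesis fg : cancel f g.

(** The unit of type A counts [2 * n] in [rk]. The divisibility says that the multiplicity relative
    to degrees, [full_rank Y 1 * m] over [full_rank Y' 1], is an integer. *)
Definition mult_dvd (Y Y' : invType) : Prop :=
  forall n N (phi : canonAlg F Y n -> canonAlg F Y' N), (0 < n)%N -> inv_morph phi ->
  exists m, has_mult phi m /\ (full_rank Y' 1 %| full_rank Y 1 * m)%N.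

Lemma full_rankE Y n : full_rank Y n = (full_rank Y 1 * n)%N.
Proof. by case: Y => /=; rewrite ?mul1n ?muln1. Qed.

Lemma compat_trans (S S' : tripleSeq) Y Y' (b : admissible S Y) (b' : admissible S' Y')
    (h : limAlg F b -> limAlg F b') i j k (phi : stage F S Y j -> stage F S' Y' k) :
  (i <= j)%N -> compat h phi ->
  compat h (phi \o trans (D := limSys F b) (i := i) j).
Proof.
move=> ij [pm pP]; split.
  by apply: inv_morph_comp pm; exact: (trans_morph (limSys F b) ij).
by move=> x; rewrite /= -pP dlim_in_trans.
Qed.

(** The round trip from [i] to [l], with the transition from [j] to [k] inserted, is a transition
    map, whose multiplicity is a quotient of partial products. *)
Lemma round_mult i j k l (phi : stage F T X i -> stage F T' X' j)
    (psi : stage F T' X' k -> stage F T X l) m m' :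
  compat f phi -> compat g psi -> has_mult phi m -> has_mult psi m' ->
  (j <= k)%N -> (i <= l)%N ->
  (m * m' * sum_prod T' k * sum_prod T i = sum_prod T' j * sum_prod T l)%N.
Proof.
move=> cphi cpsi mphi mpsi jk il.
have [t [tE tP]] := trans_mult F a' jk; have [s [sE sP]] := trans_mult F a il.
have cpsi' := compat_trans jk cpsi.
have e := compat_comp fg cphi cpsi' il.
have mt := has_mult_comp (trans_morph (limSys F a') jk) tP mpsi.
have := has_mult_inj (degree_gt0 T i) e (has_mult_comp (proj1 cphi) mphi mt) sP.
by move=> se; rewrite -tE -sE -se; ring.
Qed.

End IsoInvariants.

Section IsoLinked.
Context (F : fieldType) (T T' : tripleSeq) (X X' : invType).
Context (a : admissible T X) (a' : admissible T' X').

(** A reference map [phi0] from stage 0 fixes the constant: all other multiplicities are compared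
    with [m0]. The size bound and the divisibility of each lift then give the two halves of
    [linked]. *)
Lemma iso_linked : mult_dvd F X X' -> mult_dvd F X' X ->
  inv_iso (limAlg F a) (limAlg F a') -> exists n m, linked T T' n m.
Proof.
move=> dvd dvd' [f [fm [g fg gf]]]; have gm := inv_morph_can fm fg gf.
have P0 := sum_prod_gt0 T; have P0' := sum_prod_gt0 T'.
have up i J : exists j phi m, [/\ (J <= j)%N, compat (i := i) (j := j) f phi, has_mult phi m
    & (full_rank X' 1 %| full_rank X 1 * m)%N].
  have [j0 H] := limAlg_lift fm i; have [|phi cphi] := H (maxn j0 J); first exact: leq_maxl.
  have [m [mP md]] := dvd _ _ phi (degree_gt0 T i) (proj1 cphi).
  by exists (maxn j0 J), phi, m; split=> //; exact: leq_maxr.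
have dn j I : exists i psi m, [/\ (I <= i)%N, compat (i := j) (j := i) g psi, has_mult psi m
    & (full_rank X 1 %| full_rank X' 1 * m)%N].
  have [i0 H] := limAlg_lift gm j; have [|psi cpsi] := H (maxn i0 I); first exact: leq_maxl.
  have [m [mP md]] := dvd' _ _ psi (degree_gt0 T' j) (proj1 cpsi).
  by exists (maxn i0 I), psi, m; split=> //; exact: leq_maxr.
have [j0 [phi0 [m0 [_ cphi0 mphi0 _]]]] := up 0%N 0%N.
(* Compose both [phi] and [phi0] with a common return map [psi] and cancel its multiplicity. *)
have nat_phi i j phi m : compat (i := i) (j := j) f phi -> has_mult phi m ->
    (m * sum_prod T i * sum_prod T' j0 = m0 * sum_prod T' j)%N.
  move=> cphi mphi.
  have [l [psi [c [il cpsi mpsi _]]]] := dn (maxn j0 j) i.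
  have e1 := round_mult fg cphi cpsi mphi mpsi (leq_maxr _ _) il.
  have e2 := round_mult fg cphi0 cpsi mphi0 mpsi (leq_maxl _ _) (leq0n l).
  rewrite /(sum_prod T 0) big_ord0 muln1 in e2.
  have k0 : (0 < c * sum_prod T' (maxn j0 j))%N.
    have : (0 < m0 * c * sum_prod T' (maxn j0 j))%N by rewrite e2 muln_gt0 P0 P0'.
    by rewrite -mulnA muln_gt0 => /andP[].
  apply/eqP; rewrite -(eqn_pmul2r k0); apply/eqP.
  transitivity (m * c * sum_prod T' (maxn j0 j) * sum_prod T i * sum_prod T' j0)%N; first by ring.
  rewrite e1; transitivity (m0 * c * sum_prod T' (maxn j0 j) * sum_prod T' j)%N; last by ring.
  by rewrite e2; ring.
have m00 : (0 < m0)%N.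
  have [l [psi [c [il cpsi mpsi _]]]] := dn j0 0%N.
  have := round_mult fg cphi0 cpsi mphi0 mpsi (leqnn _) il.
  by case: (m0) => // /esym/eqP; rewrite !mul0n muln_eq0 !gtn_eqF.
have nat_psi j i psi c : compat (i := j) (j := i) g psi -> has_mult psi c ->
    (c * m0 * sum_prod T' j = sum_prod T i * sum_prod T' j0)%N.
  move=> cpsi mpsi; have [l [phi [m [jl cphi mphi _]]]] := up i j.
  have e1 := round_mult gf cpsi cphi mpsi mphi (leqnn _) jl.
  have e2 := nat_phi _ _ _ _ cphi mphi.
  have k0 : (0 < m)%N.
    by move: e1; case: (m) => //; rewrite muln0 !mul0n => /esym/eqP; rewrite muln_eq0 !gtn_eqF.
  apply/eqP; rewrite -(eqn_pmul2r k0) -(eqn_pmul2r (P0 i)); apply/eqP.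
  transitivity (m0 * (c * m * sum_prod T i * sum_prod T' j))%N; first by ring.
  rewrite e1; transitivity (sum_prod T i * (m0 * sum_prod T' l))%N; first by ring.
  by rewrite -e2; ring.
have k0 : (0 < full_rank X 1)%N by exact: full_rank_gt0.
have k0' : (0 < full_rank X' 1)%N by exact: full_rank_gt0.
(* By [nat_phi] the constant is [m0] over [sum_prod T' j0]; the factors [full_rank] convert
   multiplicities of [rk] into multiplicities relative to degrees. *)
exists (full_rank X' 1 * sum_prod T' j0)%N, (full_rank X 1 * m0)%N; split.
- by rewrite muln_gt0 k0' P0'.
- by rewrite muln_gt0 k0.
- move=> i; have [j1 H] := limAlg_lift fm i; exists j1 => j /H[phi cphi].
  have [m [mP md]] := dvd _ _ phi (degree_gt0 T i) (proj1 cphi).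
  have e := nat_phi _ _ _ _ cphi mP; have bd := has_mult_bound mP.
  rewrite full_rankE (full_rankE _ (degree T' j)) in bd.
  have -> : (full_rank X 1 * m0 * sum_prod T' j)%N =
      (full_rank X 1 * m * (sum_prod T i * sum_prod T' j0))%N.
    by rewrite -mulnA -e; ring.
  split.
    have -> : (full_rank X 1 * m * (sum_prod T i * sum_prod T' j0) * degree T i =
      (sum_prod T i * sum_prod T' j0) * (m * (full_rank X 1 * degree T i)))%N by ring.
    rewrite (leq_trans (n := (sum_prod T i * sum_prod T' j0 * (full_rank X' 1 * degree T' j))%N))//.
      by rewrite leq_mul2l bd orbT.
    by apply: eq_leq; ring.
  have -> : (full_rank X' 1 * sum_prod T' j0 * sum_prod T i =
    full_rank X' 1 * (sum_prod T i * sum_prod T' j0))%N by ring.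
  by rewrite dvdn_mul.
- move=> j; have [i1 H] := limAlg_lift gm j; exists i1 => i /H[psi cpsi].
  have [c [mP md]] := dvd' _ _ psi (degree_gt0 T' j) (proj1 cpsi).
  have e := nat_psi _ _ _ _ cpsi mP; have bd := has_mult_bound mP.
  rewrite full_rankE (full_rankE _ (degree T i)) in bd.
  have -> : (full_rank X' 1 * sum_prod T' j0 * sum_prod T i)%N =
      (full_rank X' 1 * c * (m0 * sum_prod T' j))%N.
    by rewrite -mulnA [(sum_prod T' j0 * _)%N]mulnC -e; ring.
  split.
    have -> : (full_rank X' 1 * c * (m0 * sum_prod T' j) * degree T' j =
      (m0 * sum_prod T' j) * (c * (full_rank X' 1 * degree T' j)))%N by ring.
    rewrite (leq_trans (n := (m0 * sum_prod T' j * (full_rank X 1 * degree T i))%N))//.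
      by rewrite leq_mul2l bd orbT.
    by apply: eq_leq; ring.
  have -> : (full_rank X 1 * m0 * sum_prod T' j =
    full_rank X 1 * (m0 * sum_prod T' j))%N by ring.
  by rewrite dvdn_mul.
Qed.

Lemma iso_round i : inv_iso (limAlg F a) (limAlg F a') ->
  exists j k (phi : stage F T X i -> stage F T' X' j) (psi : stage F T' X' j -> stage F T X k),
    [/\ (0 < j)%N, (i <= k)%N, inv_morph phi, inv_morph psi &
    forall x, psi (phi x) = trans (D := limSys F a) (i := i) k x].
Proof.
move=> [f [fm [g fg gf]]]; have gm := inv_morph_can fm fg gf.
have [j0 H] := limAlg_lift fm i; have [|phi cphi] := H j0.+1; first exact: leqnSn.
have [k0 H'] := limAlg_lift gm j0.+1; have [|psi cpsi] := H' (maxn k0 i); first exact: leq_maxl.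
exists j0.+1, (maxn k0 i), phi, psi; split=> //.
- exact: leq_maxr.
- by case: cphi.
- by case: cpsi.
- by move=> x; apply: (compat_comp fg cphi cpsi); exact: leq_maxr.
Qed.

Lemma iso_round_mult i : mult_dvd F X X' -> mult_dvd F X' X ->
  inv_iso (limAlg F a) (limAlg F a') ->
  exists j k (phi : stage F T X i -> stage F T' X' j) (psi : stage F T' X' j -> stage F T X k) m c,
    [/\ (0 < j)%N /\ (i <= k)%N, inv_morph phi, inv_morph psi, has_mult phi m /\ has_mult psi c
    & (m * c * sum_prod T i = sum_prod T k)%N].
Proof.
move=> dvd dvd' /(iso_round i)[j [k [phi [psi [j0 ik pm qm e]]]]].
have [m [mP _]] := dvd _ _ phi (degree_gt0 T i) pm.
have [c [cP _]] := dvd' _ _ psi (degree_gt0 T' j) qm.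
exists j, k, phi, psi, m, c; split=> //.
have [s [sE sP]] := trans_mult F a ik.
by rewrite (has_mult_inj (degree_gt0 T i) e (has_mult_comp pm mP cP) sP).
Qed.

End IsoLinked.

Lemma mult_dvd_AB (F : fieldType) Y : Y <> typeA -> mult_dvd F typeA Y.
Proof.
move=> YA n N phi n0 pm; have [m mP] := mult_AB n0 YA pm; exists m; split=> //.
by case: Y YA {phi pm mP} => //= _; rewrite dvd1n.
Qed.

Lemma mult_dvd_BA (F : fieldType) Y : Y <> typeA -> mult_dvd F Y typeA.
Proof.
move=> YA n N phi n0 pm; have [m [_ mP]] := mult_BA n0 YA pm; exists (m * 2)%N; split=> //.
by case: Y YA {phi pm mP} => //= _; rewrite mul1n dvdn_mull.
Qed.

Lemma mult_dvd_BB (F : fieldType) X Y : X <> typeA -> Y <> typeA -> mult_dvd F X Y.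
Proof.
move=> XA YA n N phi n0 pm; have [m mP] := mult_BB n0 XA YA pm; exists m; split=> //.
by case: Y YA {phi pm mP} => //= _; rewrite dvd1n.
Qed.

Section Necessity.
Context (F : fieldType) (T T' : tripleSeq).

(** A round trip through [X'] ends with equal ranks in the two components, although it starts from
    [(delta_mx i0 i0, 0)] with ranks 1 and 0. *)
Lemma iso_AB_symmetric X' (a : admissible T typeA) (a' : admissible T' X') :
  X' <> typeA -> inv_iso (limAlg F a) (limAlg F a') -> two_sided_symmetric T.
Proof.
move=> XA iso i; have [j [k [phi [psi [_ ik [_ pM _] qm e]]]]] := iso_round i iso.
have [c [cP _]] := mult_BA (degree_gt0 T' j) XA qm.
pose i0 := Ordinal (degree_gt0 T i).
pose x : stage F T typeA i := ((delta_mx i0 i0, 0) : 'M[F]_(degree T i) * 'M[F]_(degree T i)).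
have xx : imul x x = x.
  by congr pair; rewrite /= ?mul_delta_mx ?mulmx0.
have [r1 r2] := cP (phi x) (etrans (esym (pM x x)) (congr1 phi xx)).
apply: (trans_symmetric (a := a) (x := x) ik); first by rewrite /= mxrank_delta mxrank0.
by rewrite -e r1 r2.
Qed.

Lemma iso_AB_two_infty X' (a : admissible T typeA) (a' : admissible T' X') :
  X' <> typeA -> inv_iso (limAlg F a) (limAlg F a') ->
  sn_dvd sn_two_infty (sn_prod (tsum T')).
Proof.
move=> XA iso; apply/two_infty_dvdP => j.
have [i [k [phi [psi [_ jk pm qm e]]]]] := iso_round j (inv_iso_sym iso).
have [c [_ cP]] := mult_BA (degree_gt0 T' j) XA pm.
have [m mP] := mult_AB (degree_gt0 T i) XA qm.
exists k; split=> //; have [s [sE sP]] := trans_mult F a' jk.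
rewrite -sE -(has_mult_inj (degree_gt0 T' j) e (has_mult_comp pm cP mP) sP).
by rewrite dvdn_mul// -mulnA mulnCA dvdn_mulr.
Qed.

Lemma iso_OS_two_infty (a : admissible T typeO) (a' : admissible T' typeS) :
  (2%:R : F) != 0 -> inv_iso (limAlg F a) (limAlg F a') ->
  sn_dvd sn_two_infty (sn_prod (tsum T)) /\ sn_dvd sn_two_infty (sn_prod (tsum T')).
Proof.
move=> char2 iso.
have ev j : (0 < j)%N -> ~~ odd (degree T' j) by move=> j0; have [_ H] := a'; case: j j0.
have OS : mult_dvd F typeO typeS by exact: mult_dvd_BB.
have SO : mult_dvd F typeS typeO by exact: mult_dvd_BB.
split; apply/two_infty_dvdP => i.
  have [j [k [phi [psi [m [c [[j0 ik] pm qm [mP cP] e]]]]]]] := iso_round_mult i OS SO iso.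
  have me := mult_OS_even char2 (degree_gt0 T i) (ev _ j0) pm mP.
  by exists k; split=> //; rewrite -e dvdn_mul// dvdn_mulr// dvdn2.
(* Starting at [i.+1] guarantees an even degree in type S. *)
have [j [k [phi [psi [m [c [[j0 ik] pm qm [mP cP] e]]]]]]] :=
  iso_round_mult i.+1 SO OS (inv_iso_sym iso).
have me := mult_SO_even char2 (degree_gt0 T' i.+1) (ev _ (ltn0Sn i)) pm mP.
exists k; split; first exact: ltnW.
rewrite -e; apply: dvdn_mul; first by rewrite dvdn_mulr// dvdn2.
by apply: sum_prod_dvd; exact: leqnSn.
Qed.

End Necessity.

(** * Characteristic 2 *)

Section CharTwo.
Context (F : fieldType).

(** Together with [square_traces] this separates the types in characteristic 2: type A has both
    properties, type S only the second, type O neither. *)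
Definition sym_traces (A : invAlg F) : Prop :=
  forall x : A, star x = x -> exists y, x = y + star y.

Definition square_traces (A : invAlg F) : Prop :=
  forall x : A, exists y, imul x (star x) = y + star y.

Lemma sym_traces_square A : sym_traces A -> square_traces A.
Proof. by move=> H x; apply: H; rewrite starM starK. Qed.

Lemma sym_traces_iso A B : inv_iso A B -> sym_traces A -> sym_traces B.
Proof.
move=> [f [fm [g fg gf]]] H x xx; have [fl fM fs] := fm.
have [_ _ gs] := inv_morph_can fm fg gf.
have [|y yE] := H (g x); first by rewrite -gs xx.
by exists (f y); rewrite -fs -(linD fl) -yE gf.
Qed.

Lemma square_traces_iso A B : inv_iso A B -> square_traces A -> square_traces B.
Proof.
move=> [f [[fl fM fs] [g fg gf]]] H x; have [y yE] := H (g x).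
by exists (f y); rewrite -fs -(linD fl) -yE fM fs gf.
Qed.

Lemma limA_sym_traces T (a : admissible T typeA) : sym_traces (limAlg F a).
Proof.
move=> x; have [i0 /(_ i0 (leqnn _))[[u v] ->]] := dlim_in_surj (D := limSys F a) x.
rewrite -(dlim_in_star (D := limSys F a)).
move=> /(dlim_in_inj (D := limSys F a) (@stage_emb_inj F T typeA)) [uv vu].
exists (dlim_in (D := limSys F a) (i := i0) ((u, 0) : 'M[F]_(degree T i0) * 'M[F]_(degree T i0))).
rewrite -(dlim_in_star (D := limSys F a)) -(linD (@dlim_in_linear _ (limSys F a) _)).
by congr dlim_in; congr pair; rewrite /= ?trmx0 ?addr0 ?add0r -?uv ?trmxK.
Qed.

(** The projection on the even positions works: [Jmx F n] exchanges even and odd positions, so [tau]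
    sends it to its complement. *)
Lemma tau_trace1 n : ~~ odd n -> exists x : 'M[F]_n, x + tau x = 1%:M.
Proof.
move=> ne; pose d := \row_(i < n) (~~ odd i)%:R : 'rV[F]_n.
exists (diag_mx d); rewrite /tau (negbTE ne) tr_diag_mx.
have -> : Jmx F n *m diag_mx d = (1%:M - diag_mx d) *m Jmx F n.
  rewrite mulmxBl mul1mx; apply/matrixP => i j; rewrite mul_mx_diag mul_diag_mx !mxE.
  case: ifP => [/andP[oi /eqP ji]|_].
    by rewrite oi ji /= oi mulr0 mul1r subrr.
  case: ifP => [/andP[oi /eqP ji]|_]; last by rewrite mulr0 mul0r subrr.
  by move: oi; rewrite ji /= => oi; rewrite oi /= mulr1 mul0r subr0.
by rewrite -mulmxA Jmx_sqr// mulmxN mulmx1 opprK addrC subrK.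
Qed.

(** With [w + tau w = 1%:M] the product of [u] and [star u] is [y + star y] for [y] the product of
    [u], [w] and [star u]. *)
Lemma limS_square_traces T (a : admissible T typeS) : square_traces (limAlg F a).
Proof.
move=> x; have [i0 /(_ i0.+1 (leqnSn _))[u ->]] := dlim_in_surj (D := limSys F a) x.
have [|w wE] := @tau_trace1 (degree T i0.+1); first by have [_ H] := a; exact: H.
pose W : stage F T typeS i0.+1 := w.
have WE (v : stage F T typeS i0.+1) : imul v (W + star W) = v by rewrite /= wE mulmx1.
exists (dlim_in (D := limSys F a) (i := i0.+1) (imul (imul u W) (star u))).
rewrite -!(dlim_in_star (D := limSys F a)) -(dlim_inM (D := limSys F a)).
rewrite -(linD (@dlim_in_linear _ (limSys F a) _)); congr dlim_in.
rewrite !starM starK imulA -(linD (imul_linearl (star u))) -(linD (imul_linearr u)).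
by rewrite WE.
Qed.

(** Positions are natural numbers because the degree grows along transition maps while the top left
    block stays in place. *)
Definition entry X n : canonAlg F X n -> nat -> nat -> F -> Prop :=
  match X return canonAlg F X n -> nat -> nat -> F -> Prop with
  | typeA => fun _ _ _ _ => True
  | _ => fun (x : 'M[F]_n) p q v =>
      forall i j : 'I_n, i = p :> nat -> j = q :> nat -> x i j = v
  end.

Lemma diagemb_entry n l r z (x y : 'M[F]_n) (i j : 'I_n) (i' j' : 'I_(l * n + r * n + z)) :
  (0 < l)%N -> i' = i :> nat -> j' = j :> nat -> diagemb l r z x y i' j' = x i j.
Proof.
case: l i' j' => // l i' j' _ ei ej.
have -> : i' = lshift z (lshift (r * n) (lshift (l * n) i)) by apply: val_inj.
have -> : j' = lshift z (lshift (r * n) (lshift (l * n) j)) by apply: val_inj.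
by rewrite /diagemb block_mxEul block_mxEul /= block_mxEul.
Qed.

Lemma degree_leS T i : (degree T i <= degree T i.+1)%N.
Proof. by rewrite degreeS; have := tsum_gt0 T i; nia. Qed.

Lemma trans_entry T X (a : admissible T X) i j (x : stage F T X i) p q v : (i <= j)%N ->
  (p < degree T i)%N -> (q < degree T i)%N -> entry x p q v ->
  entry (trans (D := limSys F a) (i := i) j x : stage F T X j) p q v.
Proof.
move=> + + + xe; move=> /subnK <- pi qi; elim: (j - i)%N => [|k IH]; first by rewrite trans_id.
have di : (degree T i <= degree T (k + i))%N.
  by elim: (k) => // m IHm; rewrite addSn (leq_trans IHm)// degree_leS.
have pk := leq_trans pi di; have qk := leq_trans qi di.
rewrite addSn transS ?leq_addl//; move: IH; move: (trans _ _) => y {xe x}.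
have l0 := tl_gt0 T (k + i); case: X a y => //= _ y ye i' j' ei ej.
  rewrite (@diagemb_entry _ _ _ _ _ _ (Ordinal pk) (Ordinal qk))//.
  exact: ye.
rewrite (@diagemb_entry _ _ _ _ _ _ (Ordinal pk) (Ordinal qk))//.
exact: ye.
Qed.

(** In characteristic 2 a matrix [u + u^T] has zero diagonal, but the image of the unit of stage 0
    keeps the entry 1 at [(0, 0)]. *)
Lemma limO_not_square T (a : admissible T typeO) :
  2%:R = 0 :> F -> ~ square_traces (limAlg F a).
Proof.
move=> char2; pose x : stage F T typeO 0 := (1%:M : 'M[F]_1).
move=> /(_ (dlim_in (D := limSys F a) (i := 0%N) x))[y].
have [j0 /(_ j0 (leqnn _))[u ->]] := dlim_in_surj (D := limSys F a) y.
rewrite -!(dlim_in_star (D := limSys F a)) -(dlim_inM (D := limSys F a)).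
rewrite -(linD (@dlim_in_linear _ (limSys F a) _)) -(dlim_in_trans _ (leq0n j0)).
move=> /(dlim_in_inj (D := limSys F a) (@stage_emb_inj F T typeO)) e.
have := @trans_entry T typeO a 0 j0 (imul x (star x)) 0 0 1 (leq0n _) isT isT.
rewrite e => H; have : entry (imul x (star x)) 0 0 1.
  by move=> i j _ _ /=; rewrite trmx1 mulmx1 mxE !ord1.
move=> /H; pose k := Ordinal (degree_gt0 T j0).
move=> /(_ k k erefl erefl) /=; rewrite !mxE -mulr2n -mulr_natl char2 mul0r.
by move=> /esym/eqP; rewrite oner_eq0.
Qed.

(** In characteristic 2 the skew matrix unit at [(0, 1)] is symmetric for [tau], and its entry 1
    survives at every later stage. *)
Lemma limS_not_sym T (a : admissible T typeS) :
  2%:R = 0 :> F -> ~ sym_traces (limAlg F a).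
Proof.
move=> char2; have [_ ev] := a.
have d1 : (1 < degree T 1)%N.
  by have := degree_gt0 T 1; have := ev 0%N; case: (degree T 1) => [|[]].
have d0 : (0 < degree T 1)%N by exact: ltnW.
pose x : stage F T typeS 1 := (delta_mx (Ordinal d0) (Ordinal d1) : 'M[F]_(degree T 1)).
have N1 (u : stage F T typeS 1) : - u = u.
  by apply/eqP; rewrite eq_sym -subr_eq0 opprK -mulr2n -scaler_nat char2 scale0r.
have xs : star x = x by rewrite /= tau_delta01 ?ev//; exact: N1.
move=> /(_ (dlim_in (D := limSys F a) (i := 1%N) x)).
rewrite -(dlim_in_star (D := limSys F a)) xs => /(_ erefl)[y].
have [j0 /(_ j0.+1 (leqnSn _))[u ->]] := dlim_in_surj (D := limSys F a) y.
rewrite -!(dlim_in_star (D := limSys F a)).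
rewrite -(linD (@dlim_in_linear _ (limSys F a) _)) -(dlim_in_trans _ (ltn0Sn j0 : (1 <= j0.+1)%N)).
move=> /(dlim_in_inj (D := limSys F a) (@stage_emb_inj F T typeS)) e.
have := @trans_entry T typeS a 1 j0.+1 x 0 1 1 (ltn0Sn j0) d0 d1.
rewrite e => H; have : entry x 0 1 1.
  by move=> i j ei ej /=; rewrite mxE -!val_eqE /= ei ej !eqxx.
move=> /H /=.
have dj : (degree T 1 <= degree T j0.+1)%N.
  by elim: (j0) => // m IHm; rewrite (leq_trans IHm)// degree_leS.
pose k0 := Ordinal (leq_trans d0 dj); pose k1 := Ordinal (leq_trans d1 dj).
move=> /(_ k0 k1 erefl erefl).
have ne := ev j0.
(* Multiplication by [Jmx] turns elements [u + tau u] into alternating matrices. The diagonal entry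
   at [k1] picks up, up to sign, the entry at [(0, 1)]. *)
have alt : Jmx F _ *m (u + tau u : 'M[F]_(degree T j0.+1)) =
    Jmx F _ *m (u : 'M[F]_(degree T j0.+1)) - (Jmx F _ *m (u : 'M[F]_(degree T j0.+1)))^T.
  rewrite mulmxDr /tau (negbTE ne) mulmxN !mulmxA Jmx_sqr// !mulNmx mul1mx opprK.
  by rewrite trmx_mul Jmx_tr mulmxN opprK.
have : (Jmx F _ *m (u + tau u : 'M[F]_(degree T j0.+1))) k1 k1 = 0.
  by rewrite alt !mxE subrr.
rewrite mxE (bigD1 k0)//= big1 ?addr0; last first.
  move=> m mk; rewrite [X in X * _]mxE /=; case: eqP => [e1|_]; last by rewrite mul0r.
  by move: mk; rewrite -val_eqE /=; case: e1 => <-; rewrite eqxx.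
rewrite [X in X * _]mxE /= => + ue; rewrite ue => /eqP.
by rewrite mulr1 oppr_eq0 oner_eq0.
Qed.

Lemma char2_not_iso T T' X X' (a : admissible T X) (a' : admissible T' X') :
  2%:R = 0 :> F -> X <> X' -> ~ inv_iso (limAlg F a) (limAlg F a').
Proof.
move=> char2 XX iso; have iso' := inv_iso_sym iso.
case: X X' a a' XX iso iso' => -[] a a' // _ iso iso'.
- exact: (limO_not_square char2 (square_traces_iso iso (sym_traces_square (@limA_sym_traces _ _)))).
- exact: (limS_not_sym char2 (sym_traces_iso iso (@limA_sym_traces _ _))).
- exact: (limO_not_square char2 (square_traces_iso iso' (sym_traces_square (@limA_sym_traces _ _)))).
- exact: (limO_not_square char2 (square_traces_iso iso' (@limS_square_traces _ _))).
- exact: (limS_not_sym char2 (sym_traces_iso iso' (@limA_sym_traces _ _))).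
- exact: (limO_not_square char2 (square_traces_iso iso (@limS_square_traces _ _))).
Qed.

End CharTwo.

(** * Sufficiency of the conditions *)

Section Uniqueness.
Context (F : closedFieldType).

(** Only the first components need an intertwiner [g]: acting by the inverse transpose of [g] on the
    second makes the conjugation compatible with the exchange, with no square root. *)
Lemma conj_AA n N (chi chi' : canonAlg F typeA n -> canonAlg F typeA N) (i0 : 'I_n) :
  inv_morph chi -> inv_morph chi' ->
  let e : 'M[F]_n := delta_mx i0 i0 in
  \rank (chi (e, 0)).1 = \rank (chi' (e, 0)).1 ->
  \rank (chi (0, e)).1 = \rank (chi' (0, e)).1 ->
  exists theta : canonAlg F typeA N -> canonAlg F typeA N,
    [/\ inv_morph theta, forall x, theta (chi x) = chi' x
      & forall y, \rank (theta y).1 = \rank y.1 /\ \rank (theta y).2 = \rank y.2].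
Proof.
move=> [cl cM cs] [cl' cM' cs'] e r1 r2.
have hom1 (f : canonAlg F typeA n -> canonAlg F typeA N) : linear f ->
    (forall x y, f (imul x y) = imul (f x) (f y)) ->
    mx_hom (fun x : 'M[F]_n => (f (x, 0)).1).
  move=> fl fM; split=> [a x y|x y].
    by rewrite -[RHS]/((a *: f (x, 0) + f (y, 0)).1) -fl; congr (f _).1; congr pair; rewrite /= ?scaler0 ?addr0.
  by rewrite -[RHS]/((imul (f (x, 0)) (f (y, 0))).1) -fM; congr (f _).1; congr pair; rewrite /= ?mulmx0.
have hom2 (f : canonAlg F typeA n -> canonAlg F typeA N) : linear f ->
    (forall x y, f (imul x y) = imul (f x) (f y)) ->
    mx_hom (fun x : 'M[F]_n => (f (0, x)).1).
  move=> fl fM; split=> [a x y|x y].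
    by rewrite -[RHS]/((a *: f (0, x) + f (0, y)).1) -fl; congr (f _).1; congr pair; rewrite /= ?scaler0 ?addr0.
  by rewrite -[RHS]/((imul (f (0, x)) (f (0, y))).1) -fM; congr (f _).1; congr pair; rewrite /= ?mulmx0.
have o12 (f : canonAlg F typeA n -> canonAlg F typeA N) (fl : linear f)
    (fM : forall x y, f (imul x y) = imul (f x) (f y)) (x y : 'M[F]_n) :
    (f (x, 0)).1 *m (f (0, y)).1 = 0.
  rewrite -[LHS]/((imul (f (x, 0)) (f (0, y))).1) -fM.
  by rewrite -[RHS]/((0 : canonAlg F typeA N).1) -(lin0 fl); congr (f _).1; congr pair; rewrite /= ?mulmx0 ?mul0mx.
have o21 (f : canonAlg F typeA n -> canonAlg F typeA N) (fl : linear f)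
    (fM : forall x y, f (imul x y) = imul (f x) (f y)) (x y : 'M[F]_n) :
    (f (0, x)).1 *m (f (y, 0)).1 = 0.
  rewrite -[LHS]/((imul (f (0, x)) (f (y, 0))).1) -fM.
  by rewrite -[RHS]/((0 : canonAlg F typeA N).1) -(lin0 fl); congr (f _).1; congr pair; rewrite /= ?mulmx0 ?mul0mx.
have [g [gU g1 g2]] := mx_hom2_conj (hom1 _ cl cM) (hom2 _ cl cM) (hom1 _ cl' cM') (hom2 _ cl' cM')
  (o12 _ cl cM) (o21 _ cl cM) (o12 _ cl' cM') (o21 _ cl' cM') r1 r2.
pose theta (y : canonAlg F typeA N) : canonAlg F typeA N :=
  (g *m y.1 *m invmx g, (invmx g)^T *m y.2 *m g^T).
have gVg : (invmx g)^T *m g^T = 1%:M by rewrite -trmx_mul mulmxV// trmx1.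
have ggV : g^T *m (invmx g)^T = 1%:M by rewrite -trmx_mul mulVmx// trmx1.
have tm : inv_morph theta.
  split=> [a x y|x y|x]; rewrite /theta; congr pair => /=.
  - by rewrite mulmxDr mulmxDl -scalemxAr -scalemxAl.
  - by rewrite mulmxDr mulmxDl -scalemxAr -scalemxAl.
  - by rewrite !mulmxA -[_ *m invmx g *m g]mulmxA mulVmx// mulmx1.
  - by rewrite !mulmxA -[_ *m g^T *m (invmx g)^T]mulmxA ggV mulmx1.
  - by rewrite !trmx_mul !trmxK mulmxA.
  - by rewrite !trmx_mul mulmxA.
have split1 (f : canonAlg F typeA n -> canonAlg F typeA N) (fl : linear f) (x : canonAlg F typeA n) :
    (f x).1 = (f (x.1, 0)).1 + (f (0, x.2)).1.
  rewrite -[RHS]/((f (x.1, 0) + f (0, x.2)).1) -(linD fl); congr (f _).1.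
  by case: x => x y; congr pair; rewrite /= ?addr0 ?add0r.
have t1 x : (theta (chi x)).1 = (chi' x).1.
  rewrite /= (split1 _ cl) (split1 _ cl') mulmxDr mulmxDl g1 g2.
  by rewrite -!mulmxA mulmxV// !mulmx1.
exists theta; split=> //.
  move=> x; apply: injective_projections; first exact: t1.
  rewrite -[x](starK) cs cs'; have [_ _ ts] := tm; rewrite ts /=.
  by congr (_^T); exact: t1.
have gT : g^T \in unitmx by rewrite unitmx_tr.
have gVU : invmx g \in unitmx by rewrite unitmx_inv.
by move=> y; split; rewrite /theta /= mxrankMfree ?row_free_unit// eqmxMfull
  ?row_full_unit ?unitmx_tr.
Qed.

Lemma conj_BB X n N (chi chi' : canonAlg F X n -> canonAlg F X N) m :
  (2%:R : F) != 0 -> X <> typeA -> (0 < n)%N ->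
  inv_morph chi -> inv_morph chi' -> has_mult chi m -> has_mult chi' m ->
  exists theta : canonAlg F X N -> canonAlg F X N,
    [/\ inv_morph theta, forall x, theta (chi x) = chi' x & has_mult theta 1].
Proof.
move=> char2 XA n0.
pose i0 := Ordinal n0; pose e : 'M[F]_n := delta_mx i0 i0.
have ee : e *m e = e by rewrite /e mul_delta_mx.
have main (st : 'M[F]_N -> 'M[F]_N) (h h' : 'M[F]_n -> 'M[F]_N) (sn : 'M[F]_n -> 'M[F]_n) :
    linear st -> (forall x y, st (x *m y) = st y *m st x) -> involutive st ->
    mx_hom h -> mx_hom h' -> (forall x, h (sn x) = st (h x)) ->
    (forall x, h' (sn x) = st (h' x)) -> \rank (h e) = \rank (h' e) ->
    exists theta : 'M[F]_N -> 'M[F]_N,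
      [/\ linear theta, forall x y, theta (x *m y) = theta x *m theta y,
        forall x, theta (st x) = st (theta x), forall x, theta (h x) = h' x
        & forall y, \rank (theta y) = \rank y].
  move=> stl stM stK hh hh' hs hs' er.
  (* The zero map as second summand reduces a single homomorphism to the case of a pair. *)
  have zero : mx_hom (fun _ : 'M[F]_n => (0 : 'M[F]_N)).
    by split=> [a x y|x y]; rewrite ?scaler0 ?addr0 ?mulmx0.
  have [||||//|g [gU gh _]] := mx_hom2_conj hh zero hh' zero _ _ _ _ er.
  - by move=> x y; rewrite mulmx0.
  - by move=> x y; rewrite mul0mx.
  - by move=> x y; rewrite mulmx0.
  - by move=> x y; rewrite mul0mx.
  have [|u [uu' u'u uh]] := unitary_conj char2 stl stM stK gU gh.
    by move=> x; exists (sn x); rewrite hs hs'.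
  have uU : u \in unitmx by exact: (proj1 (mulmx1_unit uu')).
  have uU' : st u \in unitmx by exact: (proj2 (mulmx1_unit uu')).
  exists (fun y => u *m y *m st u); split.
  - by move=> a x y; rewrite mulmxDr mulmxDl -scalemxAr -scalemxAl.
  - by move=> x y; rewrite !mulmxA -[_ *m st u *m u]mulmxA u'u mulmx1.
  - by move=> x; rewrite !stM stK mulmxA.
  - by move=> x; rewrite uh -mulmxA uu' mulmx1.
  - by move=> y; rewrite mxrankMfree ?row_free_unit// eqmxMfull ?row_full_unit.
case: X chi chi' XA => // chi chi' _ [cl cM cs] [cl' cM' cs'] H H'.
- have [|t [t1 t2 t3 t4 t5]] := main (fun x => x^T) chi chi' (fun x => x^T) (@trmx_linear F N)
    (@trmx_mul F N N N) (@trmxK F N N) (conj cl cM) (conj cl' cM') cs cs'.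
    by have := H _ ee; have := H' _ ee => /= -> ->.
  by exists t; split=> // x xx; rewrite mul1n /= t5.
- have [|t [t1 t2 t3 t4 t5]] := main (@tau F N) chi chi' (@tau F n) (@tau_linear F N)
    (@tauM F N) (@tauK F N) (conj cl cM) (conj cl' cM') cs cs'.
    by have := H _ ee; have := H' _ ee => /= -> ->.
  by exists t; split=> // x xx; rewrite mul1n /= t5.
Qed.

End Uniqueness.

(** * Maps with prescribed multiplicities *)

Section Existence.
Context (F : closedFieldType).

(** Compatibility with the exchange dictates the second component: the transpose of the first one
    evaluated at [st x]. *)
Lemma exists_BA X n N c : X <> typeA -> (c * n <= N)%N ->
  exists psi : canonAlg F X n -> canonAlg F typeA N, inv_morph psi /\
    forall x, \rank (psi x).1 = (c * rk x)%N /\ \rank (psi x).2 = (c * rk x)%N.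
Proof.
move=> XA le; have [z ->] : exists z, N = (c * n + 0 * n + z)%N.
  by exists (N - c * n)%N; rewrite mul0n addn0 subnKC.
have main (st : 'M[F]_n -> 'M[F]_n) : linear st ->
    (forall x y, st (x *m y) = st y *m st x) -> involutive st ->
    let psi (x : 'M[F]_n) : 'M[F]_(c * n + 0 * n + z) * 'M[F]_(c * n + 0 * n + z) :=
      (diagemb c 0 z x x, (diagemb c 0 z (st x) (st x))^T) in
    [/\ linear psi, forall x y, psi (x *m y) = pair_mul (psi x) (psi y)
      & forall x, psi (st x) = pair_star (psi x)].
  move=> stl stM stK psi; rewrite /psi; split=> [a x y|x y|x].
  - by congr pair; rewrite ?stl diagemb_linear// -trmx_linear.
  - by congr pair; rewrite ?stM diagembM //= trmx_mul.
  - by rewrite /pair_star /= trmxK stK.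
case: X XA => // _.
- have [pl pM ps] := main (fun x => x^T) (@trmx_linear F n) (@trmx_mul F n n n) (@trmxK F n n).
  exists (fun x => (diagemb c 0 z x x, (diagemb c 0 z x^T x^T)^T)); split; first by split.
  by move=> x /=; rewrite mxrank_tr !rank_diagemb !mul0n !addn0 mxrank_tr.
- have [pl pM ps] := main _ (@tau_linear F n) (@tauM F n) (@tauK F n).
  exists (fun x => (diagemb c 0 z x x, (diagemb c 0 z (tau x) (tau x))^T)); split; first by split.
  move=> x /=; rewrite mxrank_tr !rank_diagemb !mul0n !addn0.
  by split=> //; congr (_ * _)%N; exact: (@rk_star F typeS n x).
Qed.

Lemma scalar_half (x : F) : (2%:R : F) != 0 -> 2%:R^-1 * x + 2%:R^-1 * x = x.
Proof. by move=> char2; field. Qed.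

(* The two components of [M_n + M_n] go to complementary isotropic corners,
   exchanged by the involution of the target. *)
Lemma hyperbolic_mx n N (st : 'M[F]_N -> 'M[F]_N) (V1 V2 : 'M[F]_(N, n)) (U1 U2 : 'M[F]_(n, N)) :
  linear st ->
  U1 *m V1 = 1%:M -> U2 *m V2 = 1%:M -> U1 *m V2 = 0 -> U2 *m V1 = 0 ->
  (forall M, st (V1 *m M *m U1) = V2 *m M^T *m U2) ->
  (forall M, st (V2 *m M *m U2) = V1 *m M^T *m U1) ->
  let phi (x : canonAlg F typeA n) := V1 *m x.1 *m U1 + V2 *m x.2 *m U2 in
  [/\ linear phi, forall x y, phi (imul x y) = phi x *m phi y,
      forall x, phi (star x) = st (phi x) & forall M : 'M[F]_n, \rank (phi (M, 0)) = \rank M].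
Proof.
move=> stl u11 u22 u12 u21 s1 s2 phi; rewrite /phi; split=> [a x y|x y|x|M] /=.
- rewrite !mulmxDr !mulmxDl -!scalemxAr -!scalemxAl scalerDr !addrA.
  by congr (_ + _); rewrite addrAC.
- rewrite mulmxDl !mulmxDr !mulmxA.
  rewrite -![_ *m U1 *m V1]mulmxA -![_ *m U1 *m V2]mulmxA.
  rewrite -![_ *m U2 *m V1]mulmxA -![_ *m U2 *m V2]mulmxA u11 u22 u12 u21.
  by rewrite !mulmx1 !mulmx0 !mul0mx addr0 add0r.
- by rewrite (linD stl) s1 s2 addrC.
- rewrite mulmx0 mul0mx addr0; apply/eqP; rewrite eqn_leq; apply/andP; split.
    by rewrite (leq_trans (mxrankM_maxl _ _))// mxrankM_maxr.
  have {1}-> : M = U1 *m (V1 *m M *m U1) *m V1.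
    by rewrite !mulmxA u11 mul1mx -mulmxA u11 mulmx1.
  by rewrite (leq_trans (mxrankM_maxl _ _))// mxrankM_maxr.
Qed.

Lemma hyperbolic_AB X n : (2%:R : F) != 0 -> (0 < n)%N -> X <> typeA ->
  exists phi : canonAlg F typeA n -> canonAlg F X (n + n), inv_morph phi /\ has_mult phi 1.
Proof.
move=> char2 n0 XA.
suff [phi [pm pr]] : exists phi : canonAlg F typeA n -> canonAlg F X (n + n),
    inv_morph phi /\ forall M : 'M[F]_n, rk (phi (M, 0)) = \rank M.
  exists phi; split=> //; have [m mP] := mult_AB n0 XA pm.
  suff -> : 1%N = m by [].
  have := mP ((1%:M, 0) : 'M[F]_n * 'M[F]_n).
  rewrite pr /= mxrank1 mxrank0 addn0 => /(_ _)/eqP.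
  rewrite -[X in X == _]mul1n eqn_pmul2r// => H; apply/eqP; apply: H.
  by congr pair; rewrite /= ?mulmx1 ?mulmx0.
case: X XA => // _.
- have [i iP] : exists i : F, i * i = -1.
    have /closed_rootP[i] : size ('X^2 + 1 : {poly F}) != 1%N.
      by rewrite size_polyDl size_polyXn// size_poly1.
    by move=> /rootP; rewrite !hornerE expr2 => /eqP; rewrite addr_eq0 => /eqP; exists i.
  (* The columns of [V] and [W] span complementary isotropic subspaces for the transpose form, since
     [i * i = -1]; the factor one half makes them dual bases. *)
  pose V : 'M[F]_(n + n, n) := col_mx 1%:M i%:M.
  pose W : 'M[F]_(n + n, n) := col_mx (2%:R^-1)%:M (- (2%:R^-1 * i))%:M.
  have WV : W^T *m V = 1%:M.
    rewrite tr_col_mx mul_row_col !tr_scalar_mx -!scalar_mxM -raddfD /=; congr (_%:M).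
    by rewrite mulNr -mulrA iP mulrN opprK mulr1 -{1}[2%:R^-1]mulr1 -{2}[2%:R^-1]mulr1 scalar_half.
  have VV : V^T *m V = 0.
    by rewrite tr_col_mx mul_row_col !tr_scalar_mx -!scalar_mxM -raddfD /= iP mulr1 subrr raddf0.
  have WW : W^T *m W = 0.
    rewrite tr_col_mx mul_row_col !tr_scalar_mx -!scalar_mxM -raddfD /= mulrNN.
    by rewrite mulrACA iP mulrN1 subrr raddf0.
  have [|||||pl pM ps pr] := @hyperbolic_mx n (n + n) (fun x => x^T) V W W^T V^T (@trmx_linear F _) WV.
  + by rewrite -[V^T *m W]trmxK trmx_mul trmxK WV trmx1.
  + exact: WW.
  + exact: VV.
  + by move=> M; rewrite !trmx_mul trmxK mulmxA.
  + by move=> M; rewrite !trmx_mul trmxK mulmxA.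
  by exists (fun x => V *m x.1 *m W^T + W *m x.2 *m V^T).
(* Even and odd standard basis vectors span the two isotropic subspaces, and [Jmx] exchanges them up
   to sign. *)
- pose V : 'M[F]_(n + n, n) := \matrix_(a, k) (a == (k + k)%N :> nat)%:R.
  pose W : 'M[F]_(n + n, n) := \matrix_(a, k) (a == (k + k).+1 :> nat)%:R.
  have kn (k : 'I_n) : (k + k < n + n)%N by have := ltn_ord k; lia.
  have kn1 (k : 'I_n) : ((k + k).+1 < n + n)%N by have := ltn_ord k; lia.
  have XV p (X : 'M[F]_(p, n + n)) : X *m V = \matrix_(a, k) X a (Ordinal (kn k)).
    apply/matrixP => a k; rewrite !mxE (bigD1 (Ordinal (kn k)))//= mxE eqxx mulr1 big1 ?addr0// => b bk.
    have nb : (b != (k + k)%N :> nat) by apply: contra bk => /eqP e; apply/eqP/val_inj.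
    by rewrite mxE (negbTE nb) mulr0.
  have XW p (X : 'M[F]_(p, n + n)) : X *m W = \matrix_(a, k) X a (Ordinal (kn1 k)).
    apply/matrixP => a k; rewrite !mxE (bigD1 (Ordinal (kn1 k)))//= mxE eqxx mulr1 big1 ?addr0// => b bk.
    have nb : (b != (k + k).+1 :> nat) by apply: contra bk => /eqP e; apply/eqP/val_inj.
    by rewrite mxE (negbTE nb) mulr0.
  have VV : V^T *m V = 1%:M.
    by rewrite XV; apply/matrixP => a k; rewrite !mxE -val_eqE /=; congr (_%:R); congr nat_of_bool; lia.
  have WW : W^T *m W = 1%:M.
    by rewrite XW; apply/matrixP => a k; rewrite !mxE -val_eqE /=; congr (_%:R); congr nat_of_bool; lia.
  have VW : V^T *m W = 0.
    by rewrite XW; apply/matrixP => a k; rewrite !mxE /=; case: eqP => // e; exfalso; lia.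
  have WV : W^T *m V = 0.
    by rewrite XV; apply/matrixP => a k; rewrite !mxE /=; case: eqP => // e; exfalso; lia.
  have ne : odd (n + n) = false by lia.
  have JW : Jmx F (n + n) *m W = V.
    rewrite XW; apply/matrixP => a k; rewrite !mxE /=.
    case: ifP => h1; first by rewrite (_ : (a == (k + k)%N :> nat)) //; lia.
    case: ifP => h2; first by exfalso; lia.
    by rewrite (_ : (a == (k + k)%N :> nat) = false)//; lia.
  have JV : Jmx F (n + n) *m V = - W.
    rewrite XV; apply/matrixP => a k; rewrite !mxE /=.
    case: ifP => h1; first by exfalso; lia.
    case: ifP => h2; first by rewrite (_ : (a == (k + k).+1 :> nat)) //; lia.
    by rewrite (_ : (a == (k + k).+1 :> nat) = false) ?oppr0//; lia.
  have VJ : V^T *m Jmx F (n + n) = W^T.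
    by apply: trmx_inj; rewrite trmx_mul Jmx_tr !trmxK mulNmx JV opprK.
  have WJ : W^T *m Jmx F (n + n) = - V^T.
    by apply: trmx_inj; rewrite trmx_mul Jmx_tr trmxK mulNmx JW linearN /= trmxK.
  have [||pl pM ps pr] := @hyperbolic_mx n (n + n) (@tau F _) V W V^T W^T (@tau_linear F _) VV WW VW WV.
  + move=> M; rewrite /tau ne !trmx_mul trmxK !mulmxA JV.
    by rewrite -[_ *m V^T *m _]mulmxA VJ !mulNmx opprK.
  + move=> M; rewrite /tau ne !trmx_mul trmxK !mulmxA JW.
    by rewrite -[_ *m W^T *m _]mulmxA WJ mulmxN opprK.
  by exists (fun x => V *m x.1 *m V^T + W *m x.2 *m W^T).
Qed.

Lemma canonEmb_morph X n l z : X <> typeA -> (X = typeS -> ~~ odd n /\ ~~ odd z) ->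
  inv_morph (@canonEmb F X n l 0 z) /\ has_mult (@canonEmb F X n l 0 z) l.
Proof.
case: X => // _ pe; split.
- by split=> [a x y|x y|x]; [exact: diagemb_linear|exact: diagembM|exact: diagemb_tr].
- by move=> x _ /=; rewrite rank_diagemb mul0n addn0.
- have [ne ze] := pe erefl.
  by split=> [a x y|x y|x]; [exact: diagemb_linear|exact: diagembM|exact: tau_diagemb].
- by move=> x _ /=; rewrite rank_diagemb mul0n addn0.
Qed.

Lemma exists_AB X n N m : (2%:R : F) != 0 -> (0 < n)%N -> X <> typeA ->
  (X = typeS -> ~~ odd N) -> (2 * m * n <= N)%N ->
  exists phi : canonAlg F typeA n -> canonAlg F X N, inv_morph phi /\ has_mult phi m.
Proof.
move=> char2 n0 XA Ne le; have [b [bm bP]] := hyperbolic_AB char2 n0 XA.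
have [z NE] : exists z, N = (m * (n + n) + 0 * (n + n) + z)%N.
  by exists (N - m * (n + n))%N; rewrite mul0n addn0 subnKC//; nia.
(* In type S the padding [z] must be even; it is, since [N] and [n + n] are. *)
have [|em eP] := @canonEmb_morph X (n + n) m z XA.
  by move=> /Ne; rewrite NE; lia.
rewrite NE; exists (@canonEmb F X (n + n) m 0 z \o b); split.
  exact: inv_morph_comp.
by rewrite -[m in has_mult _ m]mul1n; exact: has_mult_comp.
Qed.

End Existence.

(** A step with [tl k = tr k] makes the two ranks equal, and later steps keep them equal. *)
Lemma trans_sym_rank (F : fieldType) T (a : admissible T typeA) i k i' (x : stage F T typeA i) :
  (i <= k < i')%N -> tl T k = tr T k ->
  \rank (trans (D := limSys F a) (i := i) i' x : stage F T typeA i').1 =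
  \rank (trans (D := limSys F a) (i := i) i' x : stage F T typeA i').2.
Proof.
move=> /andP[ik ki'] e; move: ki' => /subnK <-; elim: (i' - k.+1)%N => [|m IH].
  rewrite transS//; move: (trans _ _) => y /=.
  by rewrite !rank_diagemb e addnC.
have le : (i <= m + k.+1)%N by lia.
rewrite addSn transS//; move: IH; move: (trans _ _) => y /= IH.
by rewrite !rank_diagemb; congr (_ * _ + _ * _)%N.
Qed.

(** * The intertwining between type A and type O or S *)

Section Sufficiency.
Context (F : closedFieldType) (char2 : (2%:R : F) != 0) (T T' : tripleSeq) (X : invType).
Context (a : admissible T typeA) (a' : admissible T' X) (p q : nat).
Hypotheses (XA : X <> typeA) (T_sym : two_sided_symmetric T).
Hypothesis T'_two : sn_dvd sn_two_infty (sn_prod (tsum T')).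
Hypothesis TT' : linked T T' p q.

Let S := sum_prod T.
Let S' := sum_prod T'.

(* The multiplicity is twice [m], because [M_n + M_n] is sent to [M_2n]. *)
Definition good_up i j (phi : stage F T typeA i -> stage F T' X j) : Prop :=
  [/\ (0 < j)%N, inv_morph phi
    & exists m, has_mult phi m /\ (2 * p * m * S i = q * S' j)%N].

Definition good_down j i (psi : stage F T' X j -> stage F T typeA i) : Prop :=
  [/\ (0 < j)%N, inv_morph psi & exists c,
    (forall x, imul x x = x ->
       \rank (psi x).1 = (c * rk x)%N /\ \rank (psi x).2 = (c * rk x)%N) /\
    (c * q * S' j = p * S i)%N].

Lemma even_degree j : (0 < j)%N -> X = typeS -> ~~ odd (degree T' j).
Proof.
by case: j => // j _ XS; have := a'; rewrite XS => -[_]; apply.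
Qed.

(** [linked] gives divisibility by [p * S i]; the extra factor 2 needed to enter degree [2n] comes
    from the infinite power of 2 in [T']. *)
Lemma step_up i : exists j0, forall j, (j0 <= j)%N -> exists m,
  (2 * p * m * S i = q * S' j)%N /\ (2 * m * degree T i <= degree T' j)%N.
Proof.
have [p0 q0 H _] := TT'; have [j1 jP] := H i.
have [j2 [j12 dv2]] := proj1 (two_infty_dvdP T') T'_two j1.
exists j2 => j j2j; have [le _] := jP j (leq_trans j12 j2j).
have /dvdnP[m mE] : (2 * (p * S i) %| q * S' j)%N.
  apply: (@dvdn_trans (2 * (q * S' j1))); first by rewrite dvdn_mul// (jP j1 (leqnn _)).2.
  rewrite mulnCA dvdn_mul//; apply: dvdn_trans dv2 _; exact: sum_prod_dvd.
exists m; split; first by rewrite mE; ring.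
have k0 : (0 < p * S i)%N by rewrite muln_gt0 p0 sum_prod_gt0.
rewrite -(leq_pmul2l k0); apply: leq_trans le; rewrite mE.
by apply: eq_leq; rewrite /S; ring.
Qed.

Lemma exists_up i N : exists j phi, (N <= j)%N /\ good_up (i := i) (j := j) phi.
Proof.
have [j0 H] := step_up i; pose j := maxn (maxn j0 N) 1.
have [|m [mE le]] := H j; first by rewrite /j; lia.
have j1 : (0 < j)%N by rewrite /j; lia.
have [phi [pm pP]] := exists_AB char2 (degree_gt0 T i) XA (even_degree j1) le.
by exists j, phi; split; [rewrite /j; lia|split=> //; exists m].
Qed.

(** The stage [i'] lies past an index [k] with [tl k = tr k], so the transition map has equal ranks
    in both components, as any map through type O or S has. Conjugation then makes the two agree. *)
Lemma up_down i j (phi : stage F T typeA i -> stage F T' X j) : good_up phi ->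
  forall N, exists i' psi, [/\ (N <= i')%N, (i <= i')%N, good_down (j := j) (i := i') psi
    & forall x, psi (phi x) = trans (D := limSys F a) (i := i) i' x].
Proof.
move=> [j1 pm [m [mP mE]]] N; have [p0 q0 _ H] := TT'.
have [i0 iP] := H j; have [k [ik ke]] := T_sym i.
pose i' := maxn (maxn i0 N) k.+1.
have [le /dvdnP[c cE]] := iP i' (leq_trans (leq_maxl _ _) (leq_maxl _ _)).
have ii' : (i <= i')%N by rewrite /i'; lia.
have k0 : (0 < q * S' j)%N by rewrite muln_gt0 q0 sum_prod_gt0.
have fit : (c * degree T' j <= degree T i')%N.
  rewrite -(leq_pmul2l k0); apply: leq_trans le; rewrite cE.
  by apply: eq_leq; rewrite /S'; ring.
have [psi0 [qm qP]] := exists_BA F XA fit.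
have [s [sE sP]] := trans_mult F a ii'.
have tm := trans_morph (limSys F a) ii'.
pose d0 := Ordinal (degree_gt0 T i).
pose e : 'M[F]_(degree T i) := delta_mx d0 d0.
have er : \rank e = 1%N by rewrite mxrank_delta.
have ee : e *m e = e by rewrite /e mul_delta_mx.
(* The constant [q / p] cancels between the way up and the way down. *)
have s2 : (s = 2 * (c * m))%N.
  apply/eqP; rewrite -(eqn_pmul2r k0) -(eqn_pmul2r (sum_prod_gt0 T i)) -(eqn_pmul2r p0).
  apply/eqP; transitivity (p * (s * S i) * (q * S' j))%N; first by rewrite /S; ring.
  rewrite sE cE -{1}mE; rewrite /S /S'; ring.
have kk : (i <= k < i')%N by rewrite ik /i'; lia.
have ranks (x : stage F T typeA i) : imul x x = x -> rk x = 1%N ->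
    \rank (psi0 (phi x)).1 =
    \rank (trans (D := limSys F a) (i := i) i' x : stage F T typeA i').1.
  move=> xx xr; rewrite (qP (phi x)).1 mP// xr muln1.
  have := sP x xx; rewrite xr muln1 /= -(trans_sym_rank a x kk ke) addnn -muln2 s2 mulnC.
  by move/eqP; rewrite eqn_pmul2l// => /eqP.
have [||theta [thm thE thr]] := conj_AA (i0 := d0) (inv_morph_comp pm qm) tm.
- apply: ranks; first by congr pair; rewrite /= ?mulmx0.
  by rewrite /= mxrank_delta mxrank0.
- apply: ranks; first by congr pair; rewrite /= ?mulmx0.
  by rewrite /= mxrank_delta mxrank0.
exists i', (theta \o psi0); split=> //; first by rewrite /i'; lia.
split=> //; first exact: inv_morph_comp.
exists c; split=> [x xx|]; last by rewrite -mulnA -cE.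
by rewrite /= (thr _).1 (thr _).2; exact: qP.
Qed.

Lemma down_up j i (psi : stage F T' X j -> stage F T typeA i) : good_down psi ->
  forall N, exists j' phi, [/\ (N <= j')%N, (j <= j')%N, good_up (i := i) (j := j') phi
    & forall y, phi (psi y) = trans (D := limSys F a') (i := j) j' y].
Proof.
move=> [j1 pm [c [cP cE]]] N; have [p0 q0 _ _] := TT'.
have [j' [phi0 [le [j'0 qm [m [mP mE]]]]]] := exists_up i (maxn N j).
have jj' : (j <= j')%N by apply: leq_trans le; rewrite leq_maxr.
have [s [sE sP]] := trans_mult F a' jj'.
have cm : has_mult psi (c * 2)%N.
  by move=> x xx; rewrite /= (cP x xx).1 (cP x xx).2 addnn -muln2 mulnAC.
have s2 : s = (c * 2 * m)%N.
  have k0 : (0 < q * S' j)%N by rewrite muln_gt0 q0 sum_prod_gt0.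
  have k1 : (0 < p * S i)%N by rewrite muln_gt0 p0 sum_prod_gt0.
  apply/eqP; rewrite -(eqn_pmul2r k0) -(eqn_pmul2r k1).
  apply/eqP; transitivity (q * (s * S' j) * (p * S i))%N; first by ring.
  by rewrite sE -/S' -mE -{1}cE; ring.
have tm := trans_morph (limSys F a') jj'; rewrite s2 in sP.
have [theta [thm thE thr]] := conj_BB char2 XA (degree_gt0 T' j)
  (inv_morph_comp pm qm) tm (has_mult_comp pm cm mP) sP.
exists j', (theta \o phi0); split=> //; first by apply: leq_trans le; rewrite leq_maxl.
split=> //; first exact: inv_morph_comp.
exists m; split=> //; rewrite -[m]muln1; exact: has_mult_comp.
Qed.

Lemma linked_iso : inv_iso (limAlg F a) (limAlg F a').
Proof.
apply: (@intertwining F (limSys F a) (limSys F a') good_up good_down).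
- by move=> i j phi [].
- by have [j [phi [_ g]]] := exists_up 0%N 0%N; exists 0%N, j, phi.
- exact: up_down.
- exact: down_up.
Qed.

End Sufficiency.

Lemma iso_AB (F : closedFieldType) (R : realType) T T' X
    (a : admissible T typeA) (a' : admissible T' X) :
  (2%:R : F) != 0 -> X <> typeA ->
  inv_iso (limAlg F a) (limAlg F a') <->
  [/\ two_sided_symmetric T, sn_dvd sn_two_infty (sn_prod (tsum T')),
      condA1 R T T', condA2 T T' & condA3 R T T'].
Proof.
move=> char2 XA; split=> [iso|[T_sym T'_two A1 A2 A3]]; last first.
  have [p [q L]] := conds_linked A1 A2 A3.
  exact: (linked_iso char2 a a' XA T_sym T'_two L).
have [p [q L]] := iso_linked (mult_dvd_AB XA) (mult_dvd_BA XA) iso.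
have [A1 A2 A3] := linked_conds R L.
split=> //; first exact: iso_AB_symmetric XA iso.
exact: iso_AB_two_infty XA iso.
Qed.

(* Halving each [tl i] (its parity permitting) turns a sequence of type O or S
   into a two-sided symmetric one with the same invariants, whose algebra of
   type A serves as an intermediate between types O and S. *)
Section Split.
Context (T : tripleSeq).

Let l i := uphalf (tsum T i).
(** Index 0 is not split, because a triple sequence must have [tr 0 = 0]. *)
Let r i := if i is 0 then 0%N else (tsum T i)./2.
Let l' i := if i is 0 then tsum T 0 else l i.

Let sumE i : (l' i + r i = tsum T i)%N.
Proof. by case: i => [|i]; rewrite /l' /r /l ?addn0// uphalf_half -addnA addnn odd_double_half. Qed.

Let degE i : degree_of l' r (tz T) i = degree T i.
Proof. by elim: i => // i IH; rewrite degreeS /= IH -mulnDl sumE. Qed.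

Let r_le i : (r i <= l' i)%N.
Proof. by case: i => [|i] //; rewrite /l' /r /l uphalf_half leq_addl. Qed.

Let lr_gt0 i : (1 <= l' i + r i)%N.
Proof. by rewrite sumE tsum_gt0. Qed.

Let unbounded N : exists i, (N <= degree_of l' r (tz T) i)%N.
Proof. by have [i H] := t_unbounded T N; exists i; rewrite degE. Qed.

Definition split_seq : tripleSeq :=
  @TripleSeq l' r (tz T) r_le lr_gt0 erefl (tz0 T) unbounded.

Lemma tsum_split : tsum split_seq = tsum T.
Proof. by apply: funext => i; exact: sumE. Qed.

Lemma degree_split : degree split_seq = degree T.
Proof. by apply: funext => i; exact: degE. Qed.

(** The split is symmetric at each positive index with even sum. If all sums from [N.+1] on were
    odd, no further factor 2 could appear; starting at [N.+1] avoids index 0. *)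
Lemma split_symmetric : sn_dvd sn_two_infty (sn_prod (tsum T)) -> two_sided_symmetric split_seq.
Proof.
move=> /two_infty_dvdP H N; have [i [Ni dv]] := H N.+1.
apply: contrapT => none.
suff : odd (sum_prod T i %/ sum_prod T N.+1).
  apply/negP; rewrite -dvdn2 dvdn_divRL ?sum_prod_dvd//.
move: Ni => /subnK <-; elim: (i - N.+1)%N => [|k IH].
  by rewrite add0n divnn sum_prod_gt0.
rewrite addSn sum_prodS mulnC -muln_divA ?sum_prod_dvd ?leq_addl// oddM IH andbT.
apply: contrapT => /negP ev; apply: none; exists (k + N.+1)%N; split; first lia.
rewrite addnS /= /l /r uphalf_half; rewrite addnS in ev.
by rewrite (negbTE ev).
Qed.

End Split.

Section SplitInvariants.
Context (R : realType) (T : tripleSeq).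

Lemma linked_split T' p q : linked T T' p q -> linked (split_seq T) T' p q.
Proof. by rewrite /linked /half_linked /sum_prod tsum_split degree_split. Qed.

Lemma linked_refl : linked T T 1 1.
Proof.
suff H : half_linked T T 1 1 by split.
move=> i; exists i => j ij; split; last by rewrite !mul1n sum_prod_dvd.
by rewrite (leq_density R)// divr1 mul1r density_seq_noninc.
Qed.

End SplitInvariants.

Lemma iso_OS (F : closedFieldType) (R : realType) T T'
    (a : admissible T typeO) (a' : admissible T' typeS) :
  (2%:R : F) != 0 ->
  inv_iso (limAlg F a) (limAlg F a') <->
  [/\ sn_dvd sn_two_infty (sn_prod (tsum T)), sn_dvd sn_two_infty (sn_prod (tsum T')),
      condA1 R T T', condA2 T T' & condA3 R T T'].
Proof.
move=> char2; split=> [iso|[T_two T'_two A1 A2 A3]].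
  have OS : mult_dvd F typeO typeS by exact: mult_dvd_BB.
  have SO : mult_dvd F typeS typeO by exact: mult_dvd_BB.
  have [p [q L]] := iso_linked OS SO iso; have [A1 A2 A3] := linked_conds R L.
  by have [h h'] := iso_OS_two_infty char2 iso.
have [p [q L]] := conds_linked A1 A2 A3.
(* The split sequence has the invariants of [T], so its type A algebra is linked to [T] with
   constant 1 and to [T'] with the given constant. *)
have sym := split_symmetric T_two.
have aA : admissible (split_seq T) typeA by [].
apply: (@inv_iso_trans _ _ (limAlg F aA)); last first.
  exact: (linked_iso char2 _ _ _ sym T'_two (linked_split L)).
apply: inv_iso_sym.
exact: (linked_iso char2 _ _ _ sym T_two (linked_split (linked_refl R T))).
Qed.

Theorem theorem5p2 (F : closedFieldType) (R : realType) (T T' : tripleSeq) :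
  (2%N \notin [pchar F]%R ->
    (forall (aT : admissible T typeA) (aT' : admissible T' typeO),
       inv_iso (limAlg F aT) (limAlg F aT') <->
       [/\ two_sided_symmetric T,
           sn_dvd sn_two_infty (sn_prod (tsum T')),
           condA1 R T T', condA2 T T' & condA3 R T T']) /\
    (forall (aT : admissible T typeA) (aT' : admissible T' typeS),
       inv_iso (limAlg F aT) (limAlg F aT') <->
       [/\ two_sided_symmetric T,
           sn_dvd sn_two_infty (sn_prod (tsum T')),
           condA1 R T T', condA2 T T' & condA3 R T T'])) /\
  (2%N \notin [pchar F]%R ->
    forall (aT : admissible T typeO) (aT' : admissible T' typeS),
       inv_iso (limAlg F aT) (limAlg F aT') <->
       [/\ sn_dvd sn_two_infty (sn_prod (tsum T)),
           sn_dvd sn_two_infty (sn_prod (tsum T')),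
           condA1 R T T', condA2 T T' & condA3 R T T']) /\
  (2%N \in [pchar F]%R ->
    forall (X X' : invType) (aT : admissible T X) (aT' : admissible T' X'),
       X <> X' -> ~ inv_iso (limAlg F aT) (limAlg F aT')).
Proof.
have charE : (2%N \in [pchar F]) = (2%:R == 0 :> F) by rewrite inE.
split; [|split] => [char2|char2|char2]; rewrite charE in char2.
- by split=> aT aT'; exact: iso_AB.
- by move=> aT aT'; exact: iso_OS.
- by move=> X X' aT aT'; apply: char2_not_iso; exact/eqP.
Qed.
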